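(* Let $\eta=-\frac{2}{15}$ and let $f_U=\frac{1}{4\pi}$ be the isotropic state. Then $f_U$ is an $L^\infty$-local minimiser of $\mathcal{F}$, but it is not a strict $L^\infty$-local minimiser of $\mathcal{F}$.
   Context: $\mathbb{S}^2\subset\mathbb{R}^3$ is the unit sphere and $dp$ is the 2-dimensional Hausdorff measure on it. $\mathcal{P}(\mathbb{S}^2)=\{f\in L^1(\mathbb{S}^2): f\ge 0 \text{ a.e.},\ \int_{\mathbb{S}^2}f\,dp=1\}$. For $\eta\in\mathbb{R}$, the energy $\mathcal{F}:\mathcal{P}(\mathbb{S}^2)\to\mathbb{R}\cup\{+\infty\}$ is $$\mathcal{F}(f)=\int_{\mathbb{S}^2}f(p)\ln f(p)-f(p)\ln\left(\int_{\mathbb{S}^2}\left((p\cdot q)^2-\tfrac13\right)f(q)\,dq-\eta\right)dp,$$ where $-\ln$ is extended by $+\infty$ for non-positive arguments, and the conventions $0\times(+\infty)=0$ and $0\ln 0=0$ are used. $f^*\in\mathcal{P}(\mathbb{S}^2)$ is an $L^\infty$-local minimiser if there is $\epsilon>0$ such that $\mathcal{F}(f^* )\le\mathcal{F}(f)$ for all $f\in\mathcal{P}(\mathbb{S}^2)$ with $\|f-f^*\|_\infty<\epsilon$; it is strict if $\epsilon$ can be chosen so that the inequality is strict for all such $f\ne f^*$. *)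

(* Defs.v *)
From HB Require Import structures.
From mathcomp Require Import all_boot all_order all_algebra.
From mathcomp Require Import all_classical all_reals all_analysis.

Set Implicit Arguments.
Unset Strict Implicit.
Unset Printing Implicit Defensive.
Import Order.TTheory GRing.Theory Num.Theory.
Import numFieldNormedType.Exports.

Local Open Scope classical_set_scope.
Local Open Scope ring_scope.
Local Open Scope ereal_scope.

Section hausdorff.
Context {R : realType} {T : pointedType}.
Variable dist : T -> T -> R.
Implicit Types (A : set T) (U : (set T)^nat) (r : \bar R).

(* The point [0] only serves to give the empty set diameter 0. *)
Definition diam A : \bar R :=
  ereal_sup ([set 0] `|` [set (dist x y)%:E | x in A & y in A]).

(* Area of the planar disc of the same diameter; this is the standard
   normalisation, for which planar Hausdorff and Lebesgue measure agree. *)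
Definition disc_area A : \bar R := (pi / 4)%:E * (diam A * diam A).

Definition hausdorff2_pre (delta : R) A : \bar R :=
  ereal_inf [set \sum_(k <oo) disc_area (U k) |
    U in [set U | (forall k, diam (U k) <= delta%:E) /\ A `<=` \bigcup_k U k]].

(* The supremum over [delta > 0] is the limit as [delta] tends to 0. *)
Definition hausdorff2 A : \bar R :=
  ereal_sup [set hausdorff2_pre delta A | delta in [set delta | (0 < delta)%R]].

Lemma diam_ge0 A : 0 <= diam A.
Proof. by apply: ereal_sup_ubound; left. Qed.

Lemma diam_set0 : diam set0 = 0.
Proof.
apply/eqP; rewrite eq_le diam_ge0 andbT; apply: ge_ereal_sup => y [->//|].
by move=> [x []].
Qed.

Lemma disc_area_ge0 A : 0 <= disc_area A.
Proof.
by rewrite mule_ge0// ?mule_ge0 ?diam_ge0// lee_fin divr_ge0// pi_ge0.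
Qed.

Lemma disc_area_set0 : disc_area set0 = 0.
Proof. by rewrite /disc_area diam_set0 !mule0. Qed.

Let D : measurableType _ := g_sigma_algebraType [set: set T].

Let gauge (delta : R) : set D -> \bar R :=
  fun A => if diam A <= delta%:E then disc_area A else +oo.

Let gauge_ge0 delta A : 0 <= gauge delta A.
Proof. by rewrite /gauge; case: ifP => // _; exact: disc_area_ge0. Qed.

Let gauge_set0 delta : (0 < delta)%R -> gauge delta set0 = 0.
Proof.
by move=> d0; rewrite /gauge diam_set0 lee_fin (ltW d0) disc_area_set0.
Qed.

Let hausdorff2_preE delta A : hausdorff2_pre delta A = mu_ext (gauge delta) A.
Proof.
apply/eqP; rewrite eq_le; apply/andP; split.
- apply: le_ereal_inf_tmp => _ [U [_ AU] <-].
  have [Ud|] := pselect (forall k, diam (U k) <= delta%:E).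
    apply: ereal_inf_lbound; exists U => //.
    by apply: eq_eseriesr => k _; rewrite /gauge Ud.
  move=> /existsNP[k /negP Uk].
  rewrite (@eseries_pinfty _ _ _ k) ?leey// => [n _|].
    by rewrite -ltNye (lt_le_trans _ (gauge_ge0 _ _)).
  by rewrite /gauge (negbTE Uk).
- apply: le_ereal_inf_tmp => _ [U [Ud AU] <-].
  apply: ereal_inf_lbound; exists U; last first.
    by apply: eq_eseriesr => k _; rewrite /gauge Ud.
  by split=> // k; exact: sub_sigma_algebra.
Qed.

Let hausdorff2_pre_le delta A : (0 < delta)%R ->
  hausdorff2_pre delta A <= hausdorff2 A.
Proof. by move=> d0; apply: ereal_sup_ubound; exists delta. Qed.

Let hausdorff2_set0 : hausdorff2 set0 = 0.
Proof.
apply/eqP; rewrite eq_le; apply/andP; split.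
  apply: ge_ereal_sup => _ [d d0 <-].
  by rewrite hausdorff2_preE mu_ext0// gauge_set0.
apply: le_trans (hausdorff2_pre_le _ ltr01).
by rewrite hausdorff2_preE mu_ext_ge0.
Qed.

Let hausdorff2_ge0 A : 0 <= hausdorff2 A.
Proof.
apply: le_trans (hausdorff2_pre_le _ ltr01).
by rewrite hausdorff2_preE mu_ext_ge0.
Qed.

Let le_hausdorff2 : {homo hausdorff2 : A B / A `<=` B >-> A <= B}.
Proof.
move=> A B AB; apply: ge_ereal_sup => _ [d d0 <-].
apply: le_trans (hausdorff2_pre_le _ d0).
by rewrite !hausdorff2_preE le_mu_ext.
Qed.

Let hausdorff2_sigma_subadditive : sigma_subadditive hausdorff2.
Proof.
move=> F; apply: ge_ereal_sup => _ [d d0 <-].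
rewrite hausdorff2_preE.
apply: le_trans (@mu_ext_sigma_subadditive _ D _ _ (gauge_ge0 d) F) _.
apply: lee_nneseries => k _; first by rewrite mu_ext_ge0.
by rewrite -hausdorff2_preE hausdorff2_pre_le.
Qed.

HB.instance Definition _ := isOuterMeasure.Build R T hausdorff2
  hausdorff2_set0 hausdorff2_ge0 le_hausdorff2 hausdorff2_sigma_subadditive.

End hausdorff.

Section sphere.
Context {R : realType}.

Definition dot (p q : 'rV[R]_3) : R := (\sum_i p 0 i * q 0 i)%R.

(* The library norm on ['rV_3] is the sup norm. *)
Definition eucl_dist (p q : 'rV[R]_3) : R := Num.sqrt (dot (p - q) (p - q)).

End sphere.

Definition sphere_point (R : realType) := {p : 'rV[R]_3 | dot p p == 1%R}.

HB.instance Definition _ (R : realType) := Choice.on (sphere_point R).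

Lemma north_pole_subproof (R : realType) :
  dot (delta_mx ord0 ord_max : 'rV[R]_3) (delta_mx ord0 ord_max) == 1%R.
Proof.
by apply/eqP; rewrite /dot (bigD1 ord_max)//= big1 ?addr0 ?mxE ?eqxx ?mulr1//
  => i /negbTE ni; rewrite !mxE ni andbF mul0r.
Qed.

HB.instance Definition _ (R : realType) := isPointed.Build (sphere_point R)
  (exist _ (delta_mx ord0 ord_max) (north_pole_subproof R)).

(* Diameters of subsets of the sphere are Euclidean (chordal), and covering
   sets may be intersected with the sphere, so this is the Hausdorff measure of
   R^3 restricted to the subsets of the sphere. *)
Definition sphere_hausdorff (R : realType) :
    {outer_measure set (sphere_point R) -> \bar R} :=
  hausdorff2 (fun p q : sphere_point R => eucl_dist (sval p) (sval q)).

(* The sphere with the sigma-algebra of Hausdorff-measurable sets. *)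
Notation S2 R := (caratheodory_type (sphere_hausdorff R)).

Definition area {R : realType} : {measure set (S2 R) -> \bar R} :=
  (sphere_hausdorff R : set (S2 R) -> \bar R).

Section energy.
Context {R : realType}.
Implicit Types (f g : S2 R -> R) (p q : S2 R).

(* Elements of L^1 are represented by functions, identified when a.e. equal. *)
Definition densities : set (S2 R -> R) :=
  [set f | [/\ f \in Lfun area 1, (\forall p \ae area, (0 <= f p)%R)
             & \int[area]_p (f p)%:E = 1]].

Definition mean_field (eta : R) f p : R :=
  (\int[area]_q ((dot (sval p) (sval q) ^+ 2 - 3^-1) * f q) - eta)%R.

(* [lne] is -oo on nonpositive reals, [ln 0 = 0] and [0 * -oo = 0]. *)
Definition energy (eta : R) f : \bar R :=
  \int[area]_p ((f p * ln (f p))%:E - (f p)%:E * lne (mean_field eta f p)%:E).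

Definition Linfty_local_minimiser (F : (S2 R -> R) -> \bar R) f : Prop :=
  densities f /\
  exists2 eps : R, (0 < eps)%R &
    forall g, densities g -> 'N[area]_+oo[EFin \o (g \- f)%R] < eps%:E ->
      F f <= F g.

Definition strict_Linfty_local_minimiser (F : (S2 R -> R) -> \bar R) f : Prop :=
  densities f /\
  exists2 eps : R, (0 < eps)%R &
    forall g, densities g -> 'N[area]_+oo[EFin \o (g \- f)%R] < eps%:E ->
      ~ (g = f %[ae area]) -> F f < F g.

Definition isotropic : S2 R -> R := fun=> (4 * pi)^-1%R.

End energy.

(* Main.v *)
(* Write [Q] for the traceless second moment of a density [f] near [f_U]. The
   mean field is [p.Qp + 2/15 = (8 pi / 15) G(p)], where [G] is a probability
   density because [Q] is traceless, so [F(f) - F(f_U)] is the relative entropy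
   of [f] with respect to [G], which is nonnegative. The perturbations
   [(1 + (15/2) a (z^2 - 1/3)) / (4 pi)] equal their own [G] and hence have the
   energy of [f_U].
   The substance is that the Hausdorff measure of the sphere is [4 pi]. By
   invariance under isometries the moments of a coordinate are those of the
   uniform law, hence (Bernstein polynomials) a cap of chordal radius [r] has
   measure [S r^2 / 4], where [S] is the total measure. Exhausting the sphere by
   disjoint small caps gives [S <= 4 pi]; the isodiametric inequality for small
   sets, proved in polar coordinates about a boundary point, gives
   [S >= 4 pi]. *)
Require Import Defs.
From mathcomp Require Import all_boot all_order all_algebra.
From mathcomp Require Import all_classical all_reals all_analysis.
From mathcomp Require Import measurable_realfun ess_sup_inf ring lra zify.
Import Order.TTheory GRing.Theory Num.Theory.
Import numFieldNormedType.Exports.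
Set Implicit Arguments.
Unset Strict Implicit.
Unset Printing Implicit Defensive.
Local Open Scope classical_set_scope.
Local Open Scope ring_scope.

(** * Isometries of the sphere *)

(** The value [eta = - 2 / 15] comes from the spectrum of the kernel [(p.q)^2 - 1/3]. The kernel
    annihilates constants and multiplies traceless quadratic forms by [2 S / 15], where [S] is the
    area of the sphere. Adding [2 / 15] makes the mean field of the constant [1 / S] equal to
    [2 S / 15] times that constant: the same factor. Every positive density that is [1 / S] plus a
    traceless quadratic form is thus proportional to its mean field, and the isotropic state lies in
    a continuum of states of equal energy.

    This balance, and already the fact that [f_U] has mass 1, require [S = 4 pi] exactly. The
    measure is given by coverings only, with no parametrisation to integrate over. Reflections,
    measurability of half-spaces and [0 < S < +oo] are what the moment computation uses, and it
    yields integrals up to the unknown factor [S].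

    Closeness in [L^infty] keeps the density and its mean field away from 0. It holds only almost
    everywhere, so a nearby density is replaced by a truncated representative before any pointwise
    estimate. *)

Section dot_theory.
Context {R : realType}.
Implicit Types (u v w : 'rV[R]_3) (a : R).

Lemma dotE u v : dot u v =
  u 0 0 * v 0 0 + u 0 1 * v 0 1 + u 0 2%:R * v 0 2%:R.
Proof.
rewrite /dot !big_ord_recl big_ord0 addr0 addrA.
by congr (_ + _ * _ + _ * _); congr (_ _ _); apply/val_inj.
Qed.

Lemma dotC u v : dot u v = dot v u.
Proof. by rewrite !dotE; ring. Qed.

Lemma dotDl u v w : dot (u + v) w = dot u w + dot v w.
Proof. by rewrite !dotE !mxE; ring. Qed.

Lemma dotBl u v w : dot (u - v) w = dot u w - dot v w.
Proof. by rewrite !dotE !mxE; ring. Qed.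

Lemma dotZl a u w : dot (a *: u) w = a * dot u w.
Proof. by rewrite !dotE !mxE; ring. Qed.

Lemma dotDr u v w : dot w (u + v) = dot w u + dot w v.
Proof. by rewrite dotC dotDl !(dotC w). Qed.

Lemma dotBr u v w : dot w (u - v) = dot w u - dot w v.
Proof. by rewrite dotC dotBl !(dotC w). Qed.

Lemma dotZr a u w : dot w (a *: u) = a * dot w u.
Proof. by rewrite dotC dotZl !(dotC w). Qed.

Lemma dotNl u w : dot (- u) w = - dot u w.
Proof. by rewrite !dotE !mxE; ring. Qed.

Lemma dotNr u w : dot w (- u) = - dot w u.
Proof. by rewrite dotC dotNl dotC. Qed.

Definition dot_lin := (dotDl, dotDr, dotNl, dotNr, dotZl, dotZr).

Lemma dot_ge0 u : 0 <= dot u u.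
Proof. by rewrite dotE -!expr2 !addr_ge0// sqr_ge0. Qed.

Lemma dot_eq0 u : (dot u u == 0) = (u == 0).
Proof.
apply/eqP/eqP => [|->]; last by rewrite dotE !mxE; ring.
rewrite dotE => u0; apply/rowP => i; rewrite mxE.
have [x0 x1 x2] : [/\ u 0 0 = 0, u 0 1 = 0 & u 0 2%:R = 0] by split; nra.
by case: i => -[|[|[|//]]] hi; [rewrite -[RHS]x0|rewrite -[RHS]x1|rewrite -[RHS]x2];
  congr (u _ _); apply/val_inj.
Qed.

Lemma cauchy_schwarz_dot u v : dot u v ^+ 2 <= dot u u * dot v v.
Proof.
rewrite !dotE.
set a := u 0 0; set b := u 0 1; set c := u 0 _.
set x := v 0 0; set y := v 0 1; set z := v 0 _.
have := sqr_ge0 (a * y - b * x); have := sqr_ge0 (a * z - c * x).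
have := sqr_ge0 (b * z - c * y); nra.
Qed.

Lemma eucl_dist_ge0 u v : 0 <= eucl_dist u v.
Proof. exact: sqrtr_ge0. Qed.

Lemma sqr_eucl_dist u v : eucl_dist u v ^+ 2 = dot (u - v) (u - v).
Proof. by rewrite sqr_sqrtr// dot_ge0. Qed.

Lemma eucl_distC u v : eucl_dist u v = eucl_dist v u.
Proof. by rewrite /eucl_dist; congr Num.sqrt; rewrite !dot_lin (dotC v u); ring. Qed.

Lemma eucl_dist_triangle v u w :
  eucl_dist u w <= eucl_dist u v + eucl_dist v w.
Proof.
have uv0 := eucl_dist_ge0 u v; have vw0 := eucl_dist_ge0 v w.
rewrite -(@ler_pXn2r _ 2)// ?nnegrE ?addr_ge0 ?eucl_dist_ge0//.
rewrite sqrrD !sqr_eucl_dist.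
have -> : u - w = (u - v) + (v - w) by rewrite addrA subrK.
have cs : dot (u - v) (v - w) <= eucl_dist u v * eucl_dist v w.
  apply: (le_trans (ler_norm _)).
  rewrite -(@ler_pXn2r _ 2)// ?nnegrE ?mulr_ge0//.
  by rewrite real_normK ?num_real// exprMn !sqr_eucl_dist cauchy_schwarz_dot.
move: (u - v) (v - w) cs => x y cs.
rewrite dotDl !dotDr (dotC y x); lra.
Qed.

(** Reflection in the plane orthogonal to [w]. For [w = 0] it is the identity, so reflecting in
    [u - v] makes sense even when [u = v]. *)
Definition householder w u := u - (2 * dot u w / dot w w) *: w.

Lemma dot_householder w u v :
  dot (householder w u) (householder w v) = dot u v.
Proof.
rewrite /householder !dot_lin.
have [->|w0] := eqVneq (dot w w) 0; first by rewrite invr0; ring.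
by rewrite !(dotC w); field.
Qed.

Lemma householderK w : involutive (householder w).
Proof.
move=> u; rewrite /householder !dot_lin.
have [->|w0] := eqVneq (dot w w) 0; first by rewrite invr0 !mulr0 !scale0r !subr0.
rewrite -addrA -opprD -scalerDl.
rewrite [X in X *: _](_ : _ = 0) ?scale0r ?subr0//.
by field.
Qed.

(** For vectors of equal length, [2 u.(u - v)] is the squared length of [u - v]. This is the source
    of transitivity: it moves any point to any other and any linear form to any other of the same
    length. *)
Lemma householder_swap u v :
  dot u u = dot v v -> householder (u - v) u = v.
Proof.
move=> uv; rewrite /householder.
have [->|] := eqVneq u v; first by rewrite subrr scaler0 subr0.
rewrite -subr_eq0 -dot_eq0 => d0.
suff -> : 2 * dot u (u - v) = dot (u - v) (u - v).
  by rewrite divff// scale1r subKr.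
by rewrite !dot_lin uv (dotC v u); ring.
Qed.

Lemma householder_orth w u : dot u w = 0 -> householder w u = u.
Proof. by move=> uw; rewrite /householder uw mulr0 mul0r scale0r subr0. Qed.

End dot_theory.

Section sphere_theory.
Context {R : realType}.
Local Notation T := (sphere_point R).
Implicit Types (p q r : T).

Definition dist p q : R := eucl_dist (sval p) (sval q).

Lemma dot_sphere p : dot (sval p) (sval p) = 1.
Proof. by case: p => p /= /eqP. Qed.

Lemma sqr_dist p q : dist p q ^+ 2 = 2 - 2 * dot (sval p) (sval q).
Proof.
rewrite sqr_eucl_dist !dot_lin !dot_sphere (dotC (sval q)); ring.
Qed.

Lemma dist_ge0 p q : 0 <= dist p q. Proof. exact: eucl_dist_ge0. Qed.

Lemma distC p q : dist p q = dist q p. Proof. exact: eucl_distC. Qed.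

Lemma distpp p : dist p p = 0.
Proof.
by apply/eqP; rewrite -sqrf_eq0 sqr_dist dot_sphere mulr1 subrr.
Qed.

Lemma dist_triangle q p r : dist p r <= dist p q + dist q r.
Proof. exact: eucl_dist_triangle. Qed.

Lemma dot_le1 p q : dot (sval p) (sval q) <= 1.
Proof. by have := sqr_ge0 (dist p q); rewrite sqr_dist; lra. Qed.

Lemma dot_geN1 p q : -1 <= dot (sval p) (sval q).
Proof.
have := cauchy_schwarz_dot (sval p) (sval q).
by rewrite !dot_sphere mulr1; set d := dot _ _ => h; nra.
Qed.

Lemma dist_le p q (d : R) : 0 <= d ->
  (dist p q <= d) = (1 - d ^+ 2 / 2 <= dot (sval p) (sval q)).
Proof.
move=> d0; rewrite -(@ler_pXn2r _ 2)// ?nnegrE ?dist_ge0// sqr_dist.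
apply/idP/idP; lra.
Qed.

Lemma dist_le2 p q : dist p q <= 2.
Proof. by rewrite dist_le//; have := dot_geN1 p q; lra. Qed.

(** The inverse is bundled so that a preimage is the image under another isometry. *)
Record isometry := Isometry {
  iso_fun :> T -> T ;
  iso_inv : T -> T ;
  iso_funK : cancel iso_fun iso_inv ;
  iso_invK : cancel iso_inv iso_fun ;
  iso_dot : forall p q, dot (sval (iso_fun p)) (sval (iso_fun q)) =
                        dot (sval p) (sval q) }.

Lemma iso_dist (g : isometry) p q : dist (g p) (g q) = dist p q.
Proof.
by apply/eqP; rewrite -(@eqrXn2 _ 2) ?dist_ge0// !sqr_dist iso_dot.
Qed.

Lemma inv_iso_dot (g : isometry) p q :
  dot (sval (iso_inv g p)) (sval (iso_inv g q)) = dot (sval p) (sval q).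
Proof. by rewrite -(iso_dot g) !iso_invK. Qed.

Definition iso_sym (g : isometry) : isometry :=
  Isometry (@iso_invK g) (@iso_funK g) (inv_iso_dot g).

Lemma iso_comp_dot (g h : isometry) p q :
  dot (sval (g (h p))) (sval (g (h q))) = dot (sval p) (sval q).
Proof. by rewrite !iso_dot. Qed.

Definition iso_comp (g h : isometry) : isometry :=
  Isometry (can_comp (@iso_funK g) (@iso_funK h))
    (can_comp (@iso_invK h) (@iso_invK g)) (iso_comp_dot g h).

Lemma reflection_subproof (w : 'rV[R]_3) p :
  dot (householder w (sval p)) (householder w (sval p)) == 1.
Proof. by rewrite dot_householder dot_sphere. Qed.

Definition reflect_pt (w : 'rV[R]_3) p : T :=
  exist _ (householder w (sval p)) (reflection_subproof w p).

Lemma reflect_ptK w : involutive (reflect_pt w).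
Proof. by move=> p; apply/eqP; rewrite -val_eqE /= householderK. Qed.

Definition reflection (w : 'rV[R]_3) : isometry :=
  Isometry (reflect_ptK w) (reflect_ptK w)
    (fun p q => dot_householder w (sval p) (sval q)).

End sphere_theory.
Arguments isometry : clear implicits.

(** * Hausdorff measure and coverings *)

Section hausdorff_sphere.
Context {R : realType}.
Local Notation T := (sphere_point R).
Local Notation mu := (sphere_hausdorff R).
Local Notation diam := (diam (@dist R)).
Local Notation disc_area := (disc_area (@dist R)).
Implicit Types (p q r : T) (A B : set T) (d : R) (c : \bar R).
Local Open Scope ereal_scope.

Lemma diam_le A d : (0 <= d)%R ->
  (forall p q, A p -> A q -> (dist p q <= d)%R) -> diam A <= d%:E.
Proof.
move=> d0 Ad; apply: ge_ereal_sup => x [->|[p Ap [q Aq <-]]]; rewrite lee_fin//.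
exact: Ad.
Qed.

Lemma dist_le_diam A p q : A p -> A q -> (dist p q)%:E <= diam A.
Proof. by move=> Ap Aq; apply: ereal_sup_ubound; right; exists p => //; exists q. Qed.

Lemma disc_area_le A d : (0 <= d)%R -> diam A <= d%:E ->
  disc_area A <= (pi / 4 * d ^+ 2)%:E.
Proof.
move=> d0 Ad; rewrite /Defs.disc_area (EFinM (pi / 4)).
apply: lee_pmul => //; first by rewrite lee_fin divr_ge0// pi_ge0.
  by rewrite mule_ge0// diam_ge0.
by rewrite expr2 EFinM lee_pmul// ?diam_ge0.
Qed.

Lemma hausdorff_le A c :
  (forall d, (0 < d)%R -> exists U : (set T)^nat,
    [/\ forall k, diam (U k) <= d%:E, A `<=` \bigcup_k U k &
        \sum_(k <oo) disc_area (U k) <= c]) ->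
  mu A <= c.
Proof.
move=> h; apply: ge_ereal_sup => _ [d /= d0 <-].
have [U [Ud AU Uc]] := h d d0.
by apply: le_trans Uc; apply: ereal_inf_lbound; exists U.
Qed.

Lemma hausdorff_ge A c d : (0 < d)%R ->
  (forall U : (set T)^nat, (forall k, diam (U k) <= d%:E) ->
     A `<=` \bigcup_k U k -> c <= \sum_(k <oo) disc_area (U k)) ->
  c <= mu A.
Proof.
move=> d0 h; apply: le_trans (_ : hausdorff2_pre (@dist R) d A <= _); last first.
  by apply: ereal_sup_ubound; exists d.
by apply: le_ereal_inf_tmp => _ [U [Ud AU] <-]; exact: h.
Qed.

Lemma hausdorff_cover A c d : (0 < d)%R -> mu A < c ->
  exists U : (set T)^nat, [/\ forall k, diam (U k) <= d%:E, A `<=` \bigcup_k U k &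
        \sum_(k <oo) disc_area (U k) < c].
Proof.
move=> d0 Ac; have : hausdorff2_pre (@dist R) d A < c.
  by apply: le_lt_trans Ac; apply: ereal_sup_ubound; exists d.
by move=> /ereal_inf_lt[_ [U [Ud AU] <-] Uc]; exists U.
Qed.

Lemma hausdorff_le_finite A c :
  (forall d, (0 < d)%R -> exists n (U : (set T)^nat),
    [/\ forall k, (k < n)%N -> diam (U k) <= d%:E,
        A `<=` \bigcup_(k < n) U k &
        \sum_(k < n) disc_area (U k) <= c]) ->
  mu A <= c.
Proof.
move=> h; apply: hausdorff_le => d d0; have [n [U [Ud AU Uc]]] := h d d0.
exists (fun k => if (k < n)%N then U k else set0); split.
- by move=> k; case: ifPn => [/Ud//|_]; rewrite diam_set0 lee_fin ltW.
- by move=> x /AU[k /= kn Ukx]; exists k => //; rewrite kn.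
- rewrite (nneseries_split _ n); last by move=> *; exact: disc_area_ge0.
  rewrite [X in _ + X]eseries0 ?adde0; last first.
    by move=> k nk _; rewrite ltnNge nk/= disc_area_set0.
  rewrite big_mkord; apply: le_trans Uc; apply: lee_sum => i _.
  by rewrite ltn_ord.
Qed.

Lemma hausdorff_point p : mu [set p] = 0.
Proof.
apply/eqP; rewrite eq_le outer_measure_ge0 andbT.
apply: hausdorff_le_finite => d d0; exists 1%N, (fun=> [set p]); split.
- by move=> k _; apply: diam_le => [|_ _ -> ->]; rewrite ?distpp ltW.
- by move=> x xp; exists 0%N.
- rewrite big_ord1; apply: le_trans (disc_area_le (lexx _) _) _.
    by apply: diam_le => // _ _ -> ->; rewrite distpp.
  by rewrite expr0n mulr0.
Qed.

Lemma diam_iso (g : isometry R) A : diam (g @` A) = diam A.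
Proof.
rewrite /Defs.diam; congr (ereal_sup (_ `|` _)).
apply/seteqP; split=> [x|x].
  by move=> [_ [p Ap <-] [_ [q Aq <-] <-]]; exists p => //; exists q => //; rewrite iso_dist.
move=> [p Ap [q Aq <-]]; exists (g p); first by exists p.
by exists (g q); [exists q|rewrite iso_dist].
Qed.

Lemma hausdorff_iso_le (g : isometry R) A : mu (g @` A) <= mu A.
Proof.
apply: ge_ereal_sup => _ [d d0 <-].
apply: le_trans (_ : hausdorff2_pre (@dist R) d A <= _); last first.
  by apply: ereal_sup_ubound; exists d.
apply: le_ereal_inf_tmp => _ [U [Ud AU] <-].
apply: ereal_inf_lbound; exists (fun k => g @` U k).
  split=> [k|]; first by rewrite diam_iso Ud.
  by move=> _ [x /AU[k _ Ux] <-]; exists k => //; exists x.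
by apply: eq_eseriesr => k _; rewrite /Defs.disc_area diam_iso.
Qed.

Lemma preimage_iso (g : isometry R) A : g @^-1` A = iso_sym g @` A.
Proof.
apply/seteqP; split=> [x Agx|_ [x Ax <-]].
  by exists (g x) => //=; rewrite iso_funK.
by rewrite /= iso_invK.
Qed.

Lemma hausdorff_preimage_iso (g : isometry R) A : mu (g @^-1` A) = mu A.
Proof.
apply/eqP; rewrite eq_le; apply/andP; split.
  by rewrite preimage_iso hausdorff_iso_le.
have {1}-> : A = g @` (g @^-1` A).
  apply/seteqP; split=> [x Ax|_ [x Ax <-]//].
  by exists (iso_inv g x); rewrite /= iso_invK.
exact: hausdorff_iso_le.
Qed.

(** Testing the preimage against [X] amounts to testing [A] against the image of [X] under [g],
    since [mu] is invariant. *)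
Lemma caratheodory_preimage_iso (g : isometry R) A :
  mu.-caratheodory A -> mu.-caratheodory (g @^-1` A).
Proof.
move=> mA X; rewrite -[in LHS](hausdorff_preimage_iso (iso_sym g)) mA.
congr (_ + _); rewrite -[in RHS](hausdorff_preimage_iso (iso_sym g)).
  by rewrite preimage_setI -comp_preimage; congr (mu (_ `&` _));
    apply/seteqP; split => x /=; rewrite iso_invK.
by rewrite preimage_setI preimage_setC -comp_preimage; congr (mu (_ `&` ~` _));
    apply/seteqP; split => x /=; rewrite iso_invK.
Qed.

End hausdorff_sphere.

(** * Measurability of half-spaces *)

Section metric_outer.
Context {R : realType}.
Local Notation T := (sphere_point R).
Local Notation mu := (sphere_hausdorff R).
Local Notation diam := (diam (@dist R)).
Local Notation disc_area := (disc_area (@dist R)).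
Implicit Types (p q r : T) (A B : set T) (d : R) (c : \bar R).
Local Open Scope ereal_scope.

(** A covering set of diameter at most [e] cannot meet both [A] and [B], so a fine cover of the
    union splits into two covers. The meshes [d1] and [d2] are independent so that the two suprema
    can be taken one after the other. *)
Lemma hausdorff_pre_separated A B (e d1 d2 : R) :
  (0 < e)%R -> (0 < d1)%R -> (0 < d2)%R ->
  (forall p q, A p -> B q -> (e < dist p q)%R) ->
  hausdorff2_pre (@dist R) d1 A + hausdorff2_pre (@dist R) d2 B <= mu (A `|` B).
Proof.
move=> e0 d10 d20 AB.
apply: (@hausdorff_ge _ _ _ (Num.min e (Num.min d1 d2))).
  by rewrite !lt_min e0 d10.
move=> U Ud ABU.
pose UA k := if `[< U k `&` A !=set0 >] then U k else set0.
pose UB k := if `[< U k `&` B !=set0 >] then U k else set0.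
have Udle k d : (Num.min e (Num.min d1 d2) <= d)%R -> diam (U k) <= d%:E.
  by move=> h; apply: le_trans (Ud k) _; rewrite lee_fin.
apply: (@le_trans _ _ (\sum_(k <oo) disc_area (UA k) + \sum_(k <oo) disc_area (UB k))).
  apply: leeD; apply: ereal_inf_lbound; [exists UA|exists UB] => //; split.
  - move=> k; rewrite /UA; case: asboolP => _; last by rewrite diam_set0 lee_fin ltW.
    by apply: Udle; rewrite !ge_min lexx orbT.
  - move=> x Ax; have [k _ Ukx] := ABU x (or_introl Ax).
    by exists k => //; rewrite /UA asboolT//; exists x.
  - move=> k; rewrite /UB; case: asboolP => _; last by rewrite diam_set0 lee_fin ltW.
    by apply: Udle; rewrite !ge_min lexx !orbT.
  - move=> x Bx; have [k _ Ukx] := ABU x (or_intror Bx).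
    by exists k => //; rewrite /UB asboolT//; exists x.
rewrite -nneseriesD; [|by move=> *; exact: disc_area_ge0|by move=> *; exact: disc_area_ge0].
apply: lee_nneseries => k _; first by rewrite adde_ge0// disc_area_ge0.
rewrite /UA /UB; case: asboolP => [[p [Up Ap]]|_]; last first.
  by rewrite disc_area_set0 add0e; case: ifPn => // _; rewrite ?disc_area_set0 ?disc_area_ge0.
case: asboolP => [[q [Uq Bq]]|_]; last by rewrite disc_area_set0 adde0.
have := AB _ _ Ap Bq; rewrite ltNge => /negP[].
rewrite -lee_fin; apply: le_trans (dist_le_diam Up Uq) _.
by apply: Udle; rewrite ge_min lexx.
Qed.

Lemma hausdorff_separated A B (e : R) : (0 < e)%R ->
  (forall p q, A p -> B q -> (e < dist p q)%R) ->
  mu A + mu B <= mu (A `|` B).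
Proof.
move=> e0 AB.
have [->|Moo] := eqVneq (mu (A `|` B)) +oo; first by rewrite leey.
have Mfin : mu (A `|` B) \is a fin_num.
  by rewrite fin_num_abs gee0_abs ?outer_measure_ge0// lt_neqAle Moo leey.
have sub_fin (C : set T) : C `<=` A `|` B -> mu C \is a fin_num.
  move=> CAB; rewrite ge0_fin_numE ?outer_measure_ge0//.
  by apply: le_lt_trans (le_outer_measure mu _ _ CAB) _; rewrite ltey_eq Mfin.
have Afin := sub_fin A (@subsetUl _ A B).
rewrite addeC -leeBrDr//; apply: ge_ereal_sup => _ [d2 /= d20 <-].
rewrite leeBrDl//.
have Bfin : hausdorff2_pre (@dist R) d2 B \is a fin_num.
  have Bmu : hausdorff2_pre (@dist R) d2 B <= mu B by apply: ereal_sup_ubound; exists d2.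
  rewrite ge0_fin_numE; last first.
    apply: le_ereal_inf_tmp => _ [U _ <-]; apply: nneseries_ge0 => *; exact: disc_area_ge0.
  by apply: le_lt_trans Bmu _; rewrite ltey_eq sub_fin//; exact: subsetUr.
rewrite -leeBrDr//; apply: ge_ereal_sup => _ [d1 /= d10 <-].
rewrite leeBrDr//; exact: (hausdorff_pre_separated e0).
Qed.

(* Caratheodory's criterion for a metric outer measure: rings of equal parity
   are positively separated, so their measures are summable and the tail near
   the boundary [g = s] vanishes. *)
Section lipschitz_sublevel.
Variable g : T -> R.
Hypothesis g_lip : forall p q, (g p - g q <= dist p q)%R.
Variable s : R.
Variable X : set T.

Let ring_ k := X `&` [set p | (s + k.+2%:R^-1 < g p <= s + k.+1%:R^-1)%R].
Let above n := X `&` [set p | (s + n.+1%:R^-1 < g p)%R].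

Let hausdorff_gap A B (a b : R) : (a < b)%R ->
  A `<=` [set p | (g p <= a)%R] -> B `<=` [set p | (b < g p)%R] ->
  mu A + mu B <= mu (A `|` B).
Proof.
move=> ab Aa Bb; apply: (@hausdorff_separated _ _ (b - a)%R); first by rewrite subr_gt0.
move=> p q /Aa /= ga /Bb /= gb; apply: (@lt_le_trans _ _ (g q - g p)%R); first lra.
by rewrite distC.
Qed.

Let sum_rings b n : \sum_(k < n) mu (ring_ (k.*2 + b)) <= mu X.
Proof.
apply: (@le_trans _ _ (mu (\big[setU/set0]_(k < n) ring_ (k.*2 + b)))); last first.
  by apply: le_outer_measure; rewrite -(bigcup_mkord _ (fun k => ring_ (k.*2 + b))) => x [k _ []].
elim: n => [|n IH]; first by rewrite !big_ord0 outer_measure0.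
rewrite !big_ord_recr/=; apply: le_trans (leeD2r _ IH) _.
case: n {IH} => [|n]; first by rewrite !big_ord0 outer_measure0 add0e set0U.
rewrite addeC setUC.
apply: (@hausdorff_gap _ _ (s + (n.*2 + b).+3%:R^-1)%R (s + (n.*2 + b).+2%:R^-1)%R).
- by rewrite ltrD2l ltf_pV2 ?posrE ?ltr0n// ltr_nat.
- by move=> x [_ /= /andP[_]]; rewrite doubleS.
- rewrite -(bigcup_mkord n.+1 (fun k => ring_ (k.*2 + b))).
  move=> x [k /= kn [_ /andP[h _]]]; apply: le_lt_trans h.
  rewrite lerD2l lef_pV2 ?posrE ?ltr0n// ler_nat !ltnS leq_add2r leq_double.
  by rewrite -ltnS.
Qed.

Let sum_rings_all n : \sum_(0 <= k < n) mu (ring_ k) <= mu X + mu X.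
Proof.
apply: (@le_trans _ _ (\sum_(0 <= k < n.*2) mu (ring_ k))).
  rewrite [leRHS](@big_cat_nat _ _ _ n)//; last by rewrite -addnn leq_addl.
  by rewrite leeDl// sume_ge0// => *; exact: outer_measure_ge0.
suff -> : \sum_(0 <= k < n.*2) mu (ring_ k) =
   \sum_(k < n) mu (ring_ (k.*2 + 0)) + \sum_(k < n) mu (ring_ (k.*2 + 1)).
  by apply: leeD; exact: sum_rings.
elim: n => [|n IH]; first by rewrite !big_ord0 big_geq// adde0.
rewrite doubleS 2?big_nat_recr// IH 2!big_ord_recr addn0 addn1.
exact: (etrans (esym (addeA _ _ _)) (addeACA _ _ _ _)).
Qed.

Lemma caratheodory_sublevel_le :
  mu (X `&` [set p | (g p <= s)%R]) + mu (X `&` ~` [set p | (g p <= s)%R]) <= mu X.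
Proof.
set A := [set p | _].
have [->|Moo] := eqVneq (mu X) +oo; first by rewrite leey.
have Mfin : mu X \is a fin_num.
  by rewrite fin_num_abs gee0_abs ?outer_measure_ge0// lt_neqAle Moo leey.
have ring_ge0 k : 0 <= mu (ring_ k) by [].
have summable : \sum_(k <oo) mu (ring_ k) < +oo.
  apply: (@le_lt_trans _ _ (mu X + mu X)); last by rewrite -ge0_fin_numE ?adde_ge0// fin_numD Mfin.
  apply: lime_le; first exact: is_cvg_nneseries.
  by apply: nearW => n; exact: sum_rings_all.
have key n : mu (X `&` A) + mu (X `&` ~` A) <= mu X + \sum_(n <= k <oo) mu (ring_ k).
  apply: (@le_trans _ _ (mu (X `&` A) + (mu (above n) + \sum_(n <= k <oo) mu (ring_ k)))).
    apply: leeD2l; apply: le_trans (leeD2l _ (outer_measure_sigma_subadditive_tail _ _ _)).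
    apply: le_trans (outer_measureU2 _ _ _); apply: le_outer_measure.
    move=> x [Xx /= /negP]; rewrite -ltNge => sx.
    have [h|h] := ltP (s + n.+1%:R^-1)%R (g x); first by left.
    (* With [T] the integer part of [t], [T <= t < T + 1] reads [1 / (T + 1) < g x - s <= 1 / T]:
       [x] lies in the ring of index [T - 1]. *)
    right; pose t := ((g x - s)^-1)%R.
    have t0 : (0 < t)%R by rewrite invr_gt0 subr_gt0.
    have nt : (n.+1%:R <= t)%R.
      by rewrite -[leLHS]invrK lef_pV2 ?posrE ?invr_gt0 ?ltr0n ?subr_gt0// lerBlDl.
    have /andP[t1 t2] := truncn_itv (ltW t0).
    have nT : (n < Num.truncn t)%N.
      by rewrite -ltnS -(ltr_nat R); apply: le_lt_trans t2.
    exists (Num.truncn t).-1 => /=.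
      by apply/negP; rewrite -leqNgt -ltnS prednK// (leq_trans _ nT).
    split=> //=; rewrite prednK ?(leq_trans _ nT)//.
    have -> : (g x = s + t^-1)%R by rewrite invrK addrC subrK.
    rewrite ltrD2l lerD2l ltf_pV2 ?posrE ?ltr0n// t2/=.
    by rewrite lef_pV2 ?posrE ?ltr0n// (leq_trans _ nT).
  rewrite addeA leeD2r//.
  apply: (@le_trans _ _ (mu ((X `&` A) `|` above n))); last first.
    by apply: le_outer_measure => x [[]|[]].
  apply: (@hausdorff_gap _ _ s (s + n.+1%:R^-1)%R).
  - by rewrite ltrDl invr_gt0 ltr0n.
  - by move=> x [].
  - by move=> x [].
rewrite -[leRHS]adde0.
have : mu X + \sum_(n <= k <oo) mu (ring_ k) @[n --> \oo] --> mu X + 0.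
  apply: cvgeD; [by rewrite fin_num_adde_defr| exact: cvg_cst|].
  exact: nneseries_tail_cvg.
by move=> /cvge_to_ge; apply; apply: nearW.
Qed.

End lipschitz_sublevel.

Lemma caratheodory_sublevel (g : T -> R) (s : R) :
  (forall p q, (g p - g q <= dist p q)%R) ->
  mu.-caratheodory [set p | (g p <= s)%R].
Proof. by move=> gl; apply: le_caratheodory_measurable => X; exact: caratheodory_sublevel_le. Qed.

Lemma dot_lipschitz (v : 'rV[R]_3) p q : dot v v = 1%R ->
  (dot (sval p) v - dot (sval q) v <= dist p q)%R.
Proof.
move=> v1; rewrite -dotBl; apply: le_trans (ler_norm _) _.
rewrite -(@ler_pXn2r _ 2)// ?nnegrE ?dist_ge0// real_normK ?num_real//.
rewrite sqr_eucl_dist; apply: le_trans (cauchy_schwarz_dot _ _) _.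
by rewrite v1 mulr1.
Qed.

(** For a unit vector [v] the form [p.v] is 1-Lipschitz by Cauchy-Schwarz; other nonzero vectors are
    rescaled. *)
Lemma caratheodory_halfspace (v : 'rV[R]_3) (s : R) :
  mu.-caratheodory [set p : T | (dot (sval p) v <= s)%R].
Proof.
have [->|v0] := eqVneq v 0%R.
  have dot0 p : dot (sval p) 0%R = 0%R :> R by rewrite dotE !mxE; ring.
  have [s0|s0] := leP 0%R s.
    rewrite (_ : [set p | _] = setT); last by apply/seteqP; split=> // p _ /=; rewrite dot0.
    by rewrite -setC0; apply: caratheodory_measurable_setC; exact: caratheodory_measurable_set0.
  rewrite (_ : [set p | _] = set0); last first.
    by apply/seteqP; split=> // p /=; rewrite dot0 leNgt s0.
  exact: caratheodory_measurable_set0.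
have vv : (0 < dot v v)%R by rewrite lt_neqAle eq_sym dot_eq0 v0 dot_ge0.
pose n := Num.sqrt (dot v v); have n0 : (0 < n)%R by rewrite sqrtr_gt0.
have := @caratheodory_sublevel (fun p => dot (sval p) (n^-1 *: v)) (s / n).
rewrite (_ : [set p | (_ <= s / n)%R] = [set p : T | (dot (sval p) v <= s)%R]); last first.
  by apply/seteqP; split=> p /=; rewrite dotZr mulrC ler_pM2r ?invr_gt0.
apply=> p q; apply: dot_lipschitz; rewrite !dot_lin mulrA -expr2.
by rewrite -(sqr_sqrtr (ltW vv)) -/n exprVn mulVf// expf_neq0 ?gt_eqF.
Qed.

End metric_outer.

(** * Finiteness and positivity of the total measure *)

Section coordinates.
Context {R : realType}.
Local Notation T := (sphere_point R).
Implicit Types (p q r : T).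

Definition cx p : R := sval p 0 0.
Definition cy p : R := sval p 0 1.
Definition cz p : R := sval p 0 2%:R.

Lemma dot_coord p q : dot (sval p) (sval q) = cx p * cx q + cy p * cy q + cz p * cz q.
Proof. exact: dotE. Qed.

Lemma sphere_eq p : cx p ^+ 2 + cy p ^+ 2 + cz p ^+ 2 = 1.
Proof. by rewrite !expr2 -dot_coord dot_sphere. Qed.

Lemma sqr_dist_coord p q :
  dist p q ^+ 2 = (cx p - cx q) ^+ 2 + (cy p - cy q) ^+ 2 + (cz p - cz q) ^+ 2.
Proof. rewrite sqr_dist dot_coord; have := sphere_eq p; have := sphere_eq q; nra. Qed.

Definition row3 (x y z : R) : 'rV[R]_3 := \row_i nth 0 [:: x; y; z] i.

Lemma dot_row3 x y z (v : 'rV[R]_3) :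
  dot v (row3 x y z) = v 0 0 * x + v 0 1 * y + v 0 2%:R * z.
Proof. by rewrite dotE !mxE. Qed.

Lemma dot_row33 x y z : dot (row3 x y z) (row3 x y z) = x ^+ 2 + y ^+ 2 + z ^+ 2.
Proof. by rewrite dot_row3 !mxE. Qed.

Lemma sphere_point_ex (x y z : R) : x ^+ 2 + y ^+ 2 + z ^+ 2 = 1 ->
  exists2 p, sval p = row3 x y z & [/\ cx p = x, cy p = y & cz p = z].
Proof.
move=> h; have h' : dot (row3 x y z) (row3 x y z) == 1 by rewrite dot_row33 h.
exists (exist (fun v : 'rV_3 => is_true (dot v v == 1)) _ h') => //.
by split; rewrite /cx /cy /cz /= mxE.
Qed.

End coordinates.

(** Controls a chord inside one cell of a grid of step [1 / n]: [U], [V], [W] are coordinate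
    differences multiplied by [n], and [s], [t], [r] are coordinate sums. The relation between them
    is the difference of two sphere equations. The sum is in fact at most [1 + 1 + 16]. *)
Lemma chart_bound (R : realType) (U V W s t r : R) :
  `|U| <= 1 -> `|V| <= 1 -> `|s| <= 2 -> `|t| <= 2 -> 1 <= r ->
  W * r = - U * s - V * t -> U ^+ 2 + V ^+ 2 + W ^+ 2 <= 5 ^+ 2.
Proof.
move=> U1 V1 s2 t2 r1 Wr.
have W4 : `|W| <= 4.
  have : `|W * r| <= 4.
    rewrite Wr; apply: le_trans (ler_normB _ _) _; rewrite !normrM normrN.
    have : `|U| * `|s| <= 1 * 2 by apply: ler_pM.
    have : `|V| * `|t| <= 1 * 2 by apply: ler_pM.
    lra.
  rewrite normrM (ger0_norm (le_trans ler01 r1)); apply: le_trans.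
  by rewrite ler_peMr.
have sq x (a : R) : `|x| <= a -> x ^+ 2 <= a ^+ 2.
  move=> xa; rewrite -(real_normK (num_real x)) ler_pXn2r// nnegrE//.
  exact: le_trans (normr_ge0 x) xa.
have := sq _ _ U1; have := sq _ _ V1; have := sq _ _ W4; lra.
Qed.

Lemma sumsq1_le1 (R : realType) (x y z : R) :
  x ^+ 2 + y ^+ 2 + z ^+ 2 = 1 -> `|x| <= 1.
Proof.
move=> h; rewrite -(@ler_pXn2r _ 2)// ?nnegrE// real_normK ?num_real//.
by rewrite expr1n -h -addrA lerDl addr_ge0// sqr_ge0.
Qed.

Section finite_positive.
Context {R : realType}.
Local Notation T := (sphere_point R).
Local Notation mu := (sphere_hausdorff R).
Local Notation diam := (diam (@dist R)).
Local Notation disc_area := (disc_area (@dist R)).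
Implicit Types (p q r : T) (A B : set T) (d : R) (c : \bar R).
Local Open Scope ereal_scope.

Definition rdiam A : R := fine (diam A).

Lemma diamE A : diam A = (rdiam A)%:E.
Proof.
rewrite fineK// ge0_fin_numE ?diam_ge0//.
by apply: (@le_lt_trans _ _ 2%:E); rewrite ?ltry//; apply: diam_le => // p q _ _; exact: dist_le2.
Qed.

Lemma rdiam_ge0 A : (0 <= rdiam A)%R.
Proof. by rewrite -lee_fin -diamE diam_ge0. Qed.

Lemma dist_le_rdiam A p q : A p -> A q -> (dist p q <= rdiam A)%R.
Proof. by move=> Ap Aq; rewrite -lee_fin -diamE dist_le_diam. Qed.

Lemma disc_areaE A : disc_area A = (pi / 4 * rdiam A ^+ 2)%:E.
Proof. by rewrite /Defs.disc_area diamE -!EFinM expr2. Qed.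

Section graph_chart.
Variables u v w : T -> R.
Hypothesis uvw : forall p, (u p ^+ 2 + v p ^+ 2 + w p ^+ 2 = 1)%R.
Hypothesis dist_uvw : forall p q,
  (dist p q ^+ 2 = (u p - u q) ^+ 2 + (v p - v q) ^+ 2 + (w p - w q) ^+ 2)%R.

Let cell n a b : set T := [set p | (2^-1 <= w p)%R /\
  ((a%:R <= n%:R * (u p + 1) <= a.+1%:R)%R /\ (b%:R <= n%:R * (v p + 1) <= b.+1%:R)%R)].

Let diam_cell n a b : (0 < n)%N -> diam (cell n a b) <= (5 / n%:R)%:E.
Proof.
move=> n0; have n0' : (0 < n%:R :> R)%R by rewrite ltr0n.
apply: diam_le; first by rewrite divr_ge0// ltW.
move=> p q [wp [/andP[pa pa'] /andP[pb pb']]] [wq [/andP[qa qa'] /andP[qb qb']]].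
rewrite -(@ler_pXn2r _ 2)// ?nnegrE ?dist_ge0 ?divr_ge0 ?(ltW n0')//.
rewrite expr_div_n ler_pdivlMr ?exprn_gt0// dist_uvw.
have := uvw p; have := uvw q.
set U := (n%:R * (u p - u q))%R; set V := (n%:R * (v p - v q))%R.
set W := (n%:R * (w p - w q))%R.
move=> hq hp.
have -> : (((u p - u q) ^+ 2 + (v p - v q) ^+ 2 + (w p - w q) ^+ 2) * n%:R ^+ 2
  = U ^+ 2 + V ^+ 2 + W ^+ 2)%R by rewrite /U /V /W; ring.
move: pa pa' pb pb' qa qa' qb qb'; rewrite -(natr1 a) -(natr1 b) => pa pa' pb pb' qa qa' qb qb'.
have U1 : (-1 <= U <= 1)%R by rewrite /U; apply/andP; split; lra.
have V1 : (-1 <= V <= 1)%R by rewrite /V; apply/andP; split; lra.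
have Wsum : (W * (w p + w q) = - U * (u p + u q) - V * (v p + v q))%R.
  rewrite /U /V /W.
  have : (w p ^+ 2 - w q ^+ 2 = - (u p ^+ 2 - u q ^+ 2) - (v p ^+ 2 - v q ^+ 2))%R by lra.
  by move=> h; transitivity (n%:R * (w p ^+ 2 - w q ^+ 2))%R; [ring|rewrite h; ring].
have bnd2 (x y : R) : (`|x| <= 1 -> `|y| <= 1 -> `|x + y| <= 2)%R.
  by move=> x1 y1; apply: le_trans (ler_normD _ _) _; lra.
apply: (chart_bound _ _ _ _ _ Wsum); rewrite ?ler_norml//.
- by rewrite -ler_norml; apply: bnd2; [exact: sumsq1_le1 hp|exact: sumsq1_le1 hq].
- rewrite -ler_norml; apply: bnd2.
    by apply: (@sumsq1_le1 _ _ (u p) (w p)); rewrite -hp; ring.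
  by apply: (@sumsq1_le1 _ _ (u q) (w q)); rewrite -hq; ring.
- lra.
Qed.

Let cover_index (t : R) n : (0 < n)%N -> (-1 <= t <= 1)%R ->
  exists2 a, (a < (2 * n).+1)%N & (a%:R <= n%:R * (t + 1) <= a.+1%:R)%R.
Proof.
move=> n0 /andP[t1 t2]; have n0' : (0 < n%:R :> R)%R by rewrite ltr0n.
have h0 : (0 <= n%:R * (t + 1))%R by apply: mulr_ge0; [exact: ltW|lra].
have /andP[h1 h2] := truncn_itv h0.
exists (Num.truncn (n%:R * (t + 1))%R); last by rewrite h1 ltW.
rewrite ltnS -(ler_nat R); apply: le_trans h1 _.
by rewrite natrM mulrC ler_pM2r//; lra.
Qed.

(** Where [w >= 1/2] the sphere is a Lipschitz graph over the [(u, v)] square, so small grid cells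
    give small pieces. The constant is [225 = 25 * 9]: squared diameters are at most [25 / n^2], and
    there are [(2 n + 1)^2 <= 9 n^2] cells. *)
Lemma graph_chart_finite : mu [set p | (2^-1 <= w p)%R] < +oo.
Proof.
apply: (@le_lt_trans _ _ (pi / 4 * 225)%:E); last exact: ltry.
apply: hausdorff_le_finite => d d0.
pose n := (Num.truncn (5 / d)%R).+1.
have n0 : (0 < n)%N by [].
have n0' : (0 < n%:R :> R)%R by rewrite ltr0n.
have nd : (5 / n%:R <= d)%R.
  rewrite ler_pdivrMr// mulrC -ler_pdivrMr//.
  by have /andP[_ /ltW] := @truncn_itv R (5 / d)%R (divr_ge0 (ler0n _ _) (ltW d0)).
pose m := (2 * n).+1.
exists (m * m)%N, (fun k => cell n (k %/ m) (k %% m)); split.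
- by move=> k _; apply: le_trans (diam_cell _ _ n0) _; rewrite lee_fin.
- move=> p /= wp.
  have up : (-1 <= u p <= 1)%R by rewrite -ler_norml; exact: sumsq1_le1 (uvw p).
  have vp : (-1 <= v p <= 1)%R.
    by rewrite -ler_norml; apply: (@sumsq1_le1 _ _ (u p) (w p)); rewrite -(uvw p); ring.
  have [a am ha] := cover_index n0 up.
  have [b bm hb] := cover_index n0 vp.
  exists (a * m + b)%N => /=.
    by apply: (@leq_trans (a.+1 * m)%N); [rewrite mulSn addnC ltn_add2r|rewrite leq_mul2r orbC am].
  by rewrite divnMDl// modnMDl divn_small// modn_small// addn0; split.
- apply: (@le_trans _ _ (\sum_(k < m * m) (pi / 4 * (5 / n%:R) ^+ 2)%:E)).
    apply: lee_sum => k _; apply: disc_area_le; last exact: diam_cell.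
    by rewrite divr_ge0// ltW.
  rewrite sumEFin lee_fin sumr_const card_ord -[leLHS]mulr_natl.
  rewrite (_ : (m * m)%:R = m%:R * m%:R :> R)%R; last exact: natrM.
  have m3 : (m%:R <= 3 * n%:R :> R)%R by rewrite -natrM ler_nat /m; lia.
  rewrite mulrCA ler_pM2l ?divr_gt0 ?pi_gt0// expr_div_n mulrA ler_pdivrMr ?exprn_gt0//.
  have : (m%:R * m%:R <= (3 * n%:R) * (3 * n%:R) :> R)%R by apply: ler_pM.
  by nra.
Qed.

End graph_chart.

(** Six charts suffice: three coordinates all below [1/2] in absolute value would have squares
    summing to less than [3/4]. *)
Lemma sphere_finite : mu setT < +oo.
Proof.
have chart (u v w : T -> R) :
    (forall p, (u p ^+ 2 + v p ^+ 2 + w p ^+ 2 = 1)%R) ->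
    (forall p q, (dist p q ^+ 2 = (u p - u q) ^+ 2 + (v p - v q) ^+ 2 + (w p - w q) ^+ 2)%R) ->
    mu ([set p | (2^-1 <= w p)%R] `|` [set p | (2^-1 <= - w p)%R]) < +oo.
  move=> h1 h2; apply: le_lt_trans (outer_measureU2 _ _ _) _; apply: lte_add_pinfty.
    exact: (graph_chart_finite h1 h2).
  apply: (@graph_chart_finite u v (fun p => - w p)%R) => [p|p q]; first by rewrite sqrrN.
  by rewrite h2; ring.
set C := fun w : T -> R => [set p | (2^-1 <= w p)%R] `|` [set p | (2^-1 <= - w p)%R].
apply: (@le_lt_trans _ _ (mu (C cx `|` C cy `|` C cz))).
  apply: le_outer_measure => p _; have := sphere_eq p => h.
  have [x1|/negP x1] := pselect ((2^-1 <= cx p) || (2^-1 <= - cx p))%R.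
    by left; left; apply/orP.
  have [y1|/negP y1] := pselect ((2^-1 <= cy p) || (2^-1 <= - cy p))%R.
    by left; right; apply/orP.
  have [z1|/negP z1] := pselect ((2^-1 <= cz p) || (2^-1 <= - cz p))%R.
    by right; apply/orP.
  move: x1 y1 z1; rewrite !negb_or -!ltNge.
  by move=> /andP[? ?] /andP[? ?] /andP[? ?]; exfalso; nra.
apply: le_lt_trans (outer_measureU2 _ _ _) _; apply: lte_add_pinfty.
  apply: le_lt_trans (outer_measureU2 _ _ _) _; apply: lte_add_pinfty.
    apply: (chart cy cz) => [p|p q]; first by rewrite -(sphere_eq p); ring.
    by rewrite sqr_dist_coord; ring.
  apply: (chart cx cz) => [p|p q]; first by rewrite -(sphere_eq p); ring.
  by rewrite sqr_dist_coord; ring.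
apply: (chart cx cy) => [p|p q]; first by rewrite -(sphere_eq p); ring.
by rewrite sqr_dist_coord; ring.
Qed.

(* Projection to the equatorial plane does not increase diameters. *)
Lemma sphere_positive : 0 < mu setT.
Proof.
(* This is [pi / 4] times the area of the square [Q] below, whose points all lift to the sphere. A
   set of diameter [d] projects into a square of side [d], and [d^2] is [4 / pi] times its disc
   area. *)
apply: (@lt_le_trans _ _ (pi / 16)%:E); first by rewrite lte_fin divr_gt0// pi_gt0.
apply: (@hausdorff_ge _ _ _ 1%R) => // U _ UT.
pose lam := (@lebesgue_measure R \x @lebesgue_measure R).
pose Q : set (R * R) := `[0%R, (2^-1)%R]%classic `*` `[0%R, (2^-1)%R]%classic.
have lamI (a d : R) : (0 <= d)%R -> lebesgue_measure `[a, (a + d)%R]%classic = d%:E.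
  move=> d0; rewrite lebesgue_measure_itv /= lte_fin ltrDl.
  case: ltP => [_|d0']; first by rewrite -EFinB addrC addKr.
  by have -> : d = 0%R by apply/eqP; rewrite eq_le d0 d0'.
have lamX (A B : set R) : measurable A -> measurable B ->
    lam (A `*` B) = lebesgue_measure A * lebesgue_measure B.
  by move=> mA mB; exact: product_measure1E.
have lam0 : lam set0 = 0 by exact: measure0.
have lamQ : lam Q = (4^-1)%:E.
  rewrite lamX// -[(2^-1)%R]add0r lamI// -EFinM.
  by congr EFin; field.
pose box k : set (R * R) := 
  if `[< U k !=set0 >] then
    `[inf (cx @` U k), (inf (cx @` U k) + rdiam (U k))%R]%classic `*`
    `[inf (cy @` U k), (inf (cy @` U k) + rdiam (U k))%R]%classic
  else set0.
have mbox k : measurable (box k).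
  by rewrite /box; case: ifPn => // _; apply: measurableX.
have lambox k : lam (box k) <= (rdiam (U k) ^+ 2)%:E.
  rewrite /box; case: ifPn => _; last by rewrite lam0 lee_fin sqr_ge0.
  by rewrite lamX// !lamI ?rdiam_ge0// -EFinM expr2.
have coordx p q : (cx p - cx q <= dist p q)%R.
  apply: le_trans (ler_norm _) _; rewrite -(@ler_pXn2r _ 2)// ?nnegrE ?dist_ge0//.
  by rewrite real_normK ?num_real// sqr_dist_coord -addrA lerDl addr_ge0 ?sqr_ge0.
have coordy p q : (cy p - cy q <= dist p q)%R.
  apply: le_trans (ler_norm _) _; rewrite -(@ler_pXn2r _ 2)// ?nnegrE ?dist_ge0//.
  by rewrite real_normK ?num_real// sqr_dist_coord addrAC lerDr addr_ge0 ?sqr_ge0.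
have boxin (h : T -> R) k p : (forall p q, (h p - h q <= dist p q)%R) -> U k p ->
    `[inf (h @` U k), (inf (h @` U k) + rdiam (U k))%R]%classic (h p).
  move=> hl Up; have lb : has_lbound (h @` U k).
    exists (h p - rdiam (U k))%R => _ [q Uq <-]; rewrite lerBlDr -lerBlDl.
    exact: le_trans (hl p q) (dist_le_rdiam Up Uq).
  rewrite /= in_itv/=; apply/andP; split; first by apply: ge_inf => //; exists p.
  rewrite -lerBlDr; apply: lb_le_inf; first by exists (h p), p.
  move=> _ [q Uq <-]; rewrite lerBlDr -lerBlDl.
  exact: le_trans (hl p q) (dist_le_rdiam Up Uq).
have Qbox : Q `<=` \bigcup_k box k.
  move=> [x y] [/=]; rewrite !in_itv/= => /andP[x0 x1] /andP[y0 y1].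
  have z0 : (0 <= 1 - x ^+ 2 - y ^+ 2)%R by nra.
  have [|p _ [<- <- _]] := @sphere_point_ex R x y (Num.sqrt (1 - x ^+ 2 - y ^+ 2)).
    by rewrite sqr_sqrtr//; ring.
  have [k _ Up] := UT p I; exists k => //; rewrite /box asboolT; last by exists p.
  by split; apply: boxin.
have : lam Q <= \sum_(k <oo) lam (box k).
  by apply: measure_sigma_subadditive => //; apply: measurableX.
rewrite lamQ => h.
have -> : (pi / 16 = pi / 4 * 4^-1 :> R)%R by field.
rewrite EFinM; apply: (@le_trans _ _ ((pi / 4)%:E * \sum_(k <oo) (rdiam (U k) ^+ 2)%:E)).
  apply: lee_pmul => //; [by rewrite lee_fin divr_ge0// pi_ge0|].
  by apply: le_trans h _; apply: lee_nneseries => // k _.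
rewrite -nneseriesZl; last by move=> k _; rewrite lee_fin sqr_ge0.
apply: lee_nneseries => k _; rewrite ?disc_areaE -EFinM// lee_fin.
by rewrite mulr_ge0 ?sqr_ge0// divr_ge0 ?pi_ge0.
Qed.

End finite_positive.

(** * Integration over the sphere *)

Section sphere_integral.
Context {R : realType}.
Local Notation T := (sphere_point R).
Local Notation mu := (sphere_hausdorff R).
Implicit Types (f h : S2 R -> R) (p q : S2 R) (v w : 'rV[R]_3).

Definition total : R := fine (mu setT).

Lemma totalE : mu setT = total%:E.
Proof. by rewrite fineK// ge0_fin_numE ?sphere_finite. Qed.

Lemma total_gt0 : 0 < total.
Proof. by rewrite -lte_fin -totalE sphere_positive. Qed.

Lemma area_setT : area [set: S2 R] = total%:E.
Proof. exact: totalE. Qed.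

Lemma measurable_fun_dot v : measurable_fun [set: S2 R] (fun p => dot (sval p) v).
Proof.
move=> mT; apply: (measurability _ (measurable_realfun.RGenOInfty.measurableE R)) => //.
move=> _ [_ [r ->] <-]; rewrite setTI.
rewrite (_ : _ @^-1` _ = ~` [set p : S2 R | dot (sval p) v <= r]).
  by apply: measurableC; exact: caratheodory_halfspace.
apply/seteqP; split=> p /=; rewrite in_itv/= andbT ltNge; first by move/negP.
by move=> /negP.
Qed.

(** Bounded measurable functions form an algebra, and they are integrable because the total measure
    is finite. Linearity of [intS] then needs no further integrability argument. *)
Definition bmeas f := measurable_fun setT f /\ exists M, forall p, `|f p| <= M.

Lemma eq_bmeas f h : f =1 h -> bmeas f -> bmeas h.
Proof. by move=> /funext ->. Qed.

Lemma bmeas_cst c : bmeas (fun=> c).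
Proof. by split=> //; exists `|c|. Qed.

Lemma bmeasD f h : bmeas f -> bmeas h -> bmeas (fun p => f p + h p).
Proof.
move=> [mf [M fM]] [mh [N hN]]; split; first exact: measurable_funD.
by exists (M + N) => p; apply: le_trans (ler_normD _ _) _; exact: lerD.
Qed.

Lemma bmeasM f h : bmeas f -> bmeas h -> bmeas (fun p => f p * h p).
Proof.
move=> [mf [M fM]] [mh [N hN]]; split; first exact: measurable_funM.
by exists (M * N) => p; rewrite normrM; apply: ler_pM.
Qed.

Lemma bmeasZ c f : bmeas f -> bmeas (fun p => c * f p).
Proof. exact: bmeasM (bmeas_cst c). Qed.

Lemma bmeasN f : bmeas f -> bmeas (fun p => - f p).
Proof. by move=> /(bmeasZ (-1)); apply: eq_bmeas => p; rewrite mulN1r. Qed.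

Lemma bmeasB f h : bmeas f -> bmeas h -> bmeas (fun p => f p - h p).
Proof. by move=> bf /bmeasN; exact: bmeasD. Qed.

Lemma bmeasX n f : bmeas f -> bmeas (fun p => f p ^+ n).
Proof.
move=> bf; elim: n => [|n IH]; first exact: bmeas_cst.
by apply: eq_bmeas (bmeasM bf IH) => p; rewrite exprS.
Qed.

Lemma bmeas_sum (I : Type) (s : seq I) (P : pred I) (F : I -> S2 R -> R) :
  (forall i, P i -> bmeas (F i)) -> bmeas (fun p => \sum_(i <- s | P i) F i p).
Proof.
move=> bF; elim: s => [|i s IH].
  by apply: eq_bmeas (bmeas_cst 0) => p; rewrite big_nil.
have bi : bmeas (fun p => if P i then F i p else 0).
  by case Pi: (P i); [exact: bF|exact: bmeas_cst].
apply: eq_bmeas (bmeasD bi IH) => p.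
by rewrite big_cons; case: ifP; rewrite ?add0r.
Qed.

Lemma dot_norm_le (p : S2 R) v : `|dot (sval p) v| <= Num.sqrt (dot v v).
Proof.
rewrite -(@ler_pXn2r _ 2)// ?nnegrE ?sqrtr_ge0// real_normK ?num_real//.
rewrite sqr_sqrtr ?dot_ge0//; apply: le_trans (cauchy_schwarz_dot _ _) _.
by rewrite dot_sphere mul1r.
Qed.

Lemma bmeas_dot v : bmeas (fun p => dot (sval p) v).
Proof.
split; first exact: measurable_fun_dot.
by exists (Num.sqrt (dot v v)) => p; exact: dot_norm_le.
Qed.

Lemma cxE (p : T) : cx p = dot (sval p) (row3 1 0 0).
Proof. by rewrite dot_row3 /cx; ring. Qed.

Lemma cyE (p : T) : cy p = dot (sval p) (row3 0 1 0).
Proof. by rewrite dot_row3 /cy; ring. Qed.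

Lemma czE (p : T) : cz p = dot (sval p) (row3 0 0 1).
Proof. by rewrite dot_row3 /cz; ring. Qed.

Lemma bmeas_cx : bmeas (fun p => cx p).
Proof. by apply: eq_bmeas (bmeas_dot _) => p; rewrite cxE. Qed.

Lemma bmeas_cy : bmeas (fun p => cy p).
Proof. by apply: eq_bmeas (bmeas_dot _) => p; rewrite cyE. Qed.

Lemma bmeas_cz : bmeas (fun p => cz p).
Proof. by apply: eq_bmeas (bmeas_dot _) => p; rewrite czE. Qed.

Lemma bmeas_integrable f : bmeas f -> area.-integrable setT (EFin \o f).
Proof.
move=> [mf [M fM]]; apply: measurable_bounded_integrable => //.
  by have -> : area setT = total%:E := area_setT; rewrite ltry.
by exists M; split; [exact: num_real|move=> x Mx p _; apply: le_trans (fM p) (ltW Mx)].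
Qed.

Definition intS f : R := \int[area]_p f p.

Lemma intSD f h : bmeas f -> bmeas h ->
  intS (fun p => f p + h p) = intS f + intS h.
Proof. by move=> /bmeas_integrable bf /bmeas_integrable bh; exact: RintegralD. Qed.

Lemma intSB f h : bmeas f -> bmeas h ->
  intS (fun p => f p - h p) = intS f - intS h.
Proof. by move=> /bmeas_integrable bf /bmeas_integrable bh; exact: RintegralB. Qed.

Lemma intSZ c f : bmeas f -> intS (fun p => c * f p) = c * intS f.
Proof. by move=> /bmeas_integrable bf; exact: RintegralZl. Qed.

Lemma intS_cst c : intS (fun=> c) = c * total.
Proof. by rewrite /intS Rintegral_cst//; congr (_ * fine _); exact: area_setT. Qed.

Lemma le_intS f h : bmeas f -> bmeas h -> (forall p, f p <= h p) -> intS f <= intS h.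
Proof. by move=> /bmeas_integrable bf /bmeas_integrable bh fh; apply: le_Rintegral. Qed.

Lemma intS_sum (I : Type) (s : seq I) (P : pred I) (F : I -> S2 R -> R) :
  (forall i, P i -> bmeas (F i)) ->
  intS (fun p => \sum_(i <- s | P i) F i p) = \sum_(i <- s | P i) intS (F i).
Proof.
move=> bF; elim: s => [|i s IH].
  rewrite big_nil; transitivity (intS (fun=> 0)); last by rewrite intS_cst mul0r.
  by congr intS; apply/funext => p; rewrite big_nil.
rewrite big_cons; case: ifPn => Pi.
  rewrite -IH -intSD; [|exact: bF|exact: bmeas_sum].
  by congr intS; apply/funext => p; rewrite big_cons Pi.
by rewrite -IH; congr intS; apply/funext => p; rewrite big_cons (negbTE Pi).
Qed.

Lemma measurable_iso (g : isometry R) : measurable_fun [set: S2 R] (g : S2 R -> S2 R).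
Proof. by move=> _ A mA; rewrite setTI; exact: caratheodory_preimage_iso. Qed.

Lemma intS_iso (g : isometry R) f : bmeas f -> intS (fun p => f (g p)) = intS f.
Proof.
move=> bf; rewrite /intS /Rintegral; congr fine.
have mg := measurable_iso g.
have bfg : bmeas (fun p => f (g p)).
  case: bf => mf [M fM]; split; last by exists M.
  exact: (measurableT_comp mf mg).
transitivity (\int[pushforward area (g : S2 R -> S2 R)]_p (f p)%:E)%E.
  have mf : measurable_fun [set: S2 R] (EFin \o f) by apply/measurable_EFinP; case: bf.
  exact: esym (@integral_pushforward _ _ _ _ _ _ mg area setT _ mf
    (bmeas_integrable bfg) measurableT).
by apply: eq_measure_integral => A mA _; exact: hausdorff_preimage_iso.
Qed.

End sphere_integral.

(** * Moments and Archimedes' theorem *)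

Section moments.
Context {R : realType}.
Implicit Types (p q : S2 R) (v w : 'rV[R]_3).

Lemma dot_reflection w p v :
  dot (sval (reflection w p)) v = dot (sval p) (householder w v).
Proof. by rewrite /= -[v in LHS](householderK w) dot_householder. Qed.

(** The reflection in [v - w] exchanges [v] and [w]. *)
Lemma intS_dot_norm n v w : dot v v = dot w w ->
  intS (fun p : S2 R => dot (sval p) v ^+ n) = intS (fun p : S2 R => dot (sval p) w ^+ n).
Proof.
move=> vw; rewrite -[RHS](intS_iso (reflection (v - w))); last exact/bmeasX/bmeas_dot.
congr intS; apply/funext => p; rewrite dot_reflection; congr (dot _ _ ^+ _).
by rewrite -[LHS](householderK (v - w)) householder_swap.
Qed.

Lemma iso_coord_swap : exists g : isometry R,
  forall p, [/\ cx (g p) = cy p, cy (g p) = cx p & cz (g p) = cz p].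
Proof.
exists (reflection (row3 1 (-1) 0)) => p.
by rewrite /cx /cy /cz /= /householder dot_row3 dot_row33 !mxE/=; split; field.
Qed.

Lemma iso_coord_swapyz : exists g : isometry R,
  forall p, [/\ cx (g p) = cx p, cy (g p) = cz p & cz (g p) = cy p].
Proof.
exists (reflection (row3 0 1 (-1))) => p.
by rewrite /cx /cy /cz /= /householder dot_row3 dot_row33 !mxE/=; split; field.
Qed.

Lemma iso_coord_negx : exists g : isometry R,
  forall p, [/\ cx (g p) = - cx p, cy (g p) = cy p & cz (g p) = cz p].
Proof.
exists (reflection (row3 1 0 0)) => p.
by rewrite /cx /cy /cz /= /householder dot_row3 dot_row33 !mxE/=; split; field.
Qed.

Lemma iso_coord_negz : exists g : isometry R,
  forall p, [/\ cx (g p) = cx p, cy (g p) = cy p & cz (g p) = - cz p].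
Proof.
exists (reflection (row3 0 0 1)) => p.
by rewrite /cx /cy /cz /= /householder dot_row3 dot_row33 !mxE/=; split; field.
Qed.

Definition even_moment k : R := intS (fun p : S2 R => cz p ^+ (2 * k)).

Lemma bmeas_czX n : bmeas (fun p : S2 R => cz p ^+ n).
Proof. exact: bmeasX bmeas_cz. Qed.

(* Both sides are coefficients of [t^2] in the polynomial
   [t |-> int (z + t y)^(2k+2)], which by rotation invariance is
   [(1 + t^2)^(k+1) int z^(2k+2)]. *)
Lemma mixed_moment k :
  (2 * k + 1)%:R * intS (fun p : S2 R => cz p ^+ (2 * k) * cy p ^+ 2) = even_moment k.+1.
Proof.
pose n := (2 * k.+1)%N.
pose m i := intS (fun p : S2 R => cz p ^+ (n - i) * cy p ^+ i).
pose P : {poly R} := \poly_(i < n.+1) (m i *+ 'C(n, i)).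
pose Q : {poly R} := even_moment k.+1 *: (1 + 'X^2) ^+ k.+1.
have bm i : bmeas (fun p : S2 R => cz p ^+ (n - i) * cy p ^+ i).
  by apply: bmeasM; [exact: bmeas_czX|exact/bmeasX/bmeas_cy].
have PQ : P = Q.
  have PQt t : P.[t] = Q.[t].
    rewrite /P /Q horner_poly !hornerE.
    transitivity (intS (fun p : S2 R => dot (sval p) (row3 0 t 1) ^+ n)).
      rewrite (_ : (fun _ => _) = (fun p : S2 R =>
          \sum_(i < n.+1) (t ^+ i *+ 'C(n, i)) * (cz p ^+ (n - i) * cy p ^+ i))).
        rewrite intS_sum => [|i _]; last exact: bmeasZ.
        apply: eq_bigr => i _; rewrite intSZ// /m.
        by rewrite mulrnAl mulrnAl mulrC.
      apply/funext => p; rewrite dot_row3 mulr0 add0r mulr1 addrC exprDn.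
      apply: eq_bigr => i _; rewrite exprMn -mulrnAl.
      by rewrite mulrnAl mulrnAl; congr (_ *+ _); rewrite /cz /cy; ring.
    pose s := Num.sqrt (1 + t ^+ 2).
    have s2 : s ^+ 2 = 1 + t ^+ 2 by rewrite sqr_sqrtr// addr_ge0// sqr_ge0.
    rewrite (@intS_dot_norm n _ (row3 0 0 s)); last first.
      by rewrite !dot_row33 s2; ring.
    rewrite (_ : (fun _ => _) = (fun p : S2 R => s ^+ n * cz p ^+ n)).
      rewrite intSZ; last exact: bmeas_czX.
      by rewrite [RHS]mulrC; congr (_ * _); rewrite /n exprM s2.
    by apply/funext => p; rewrite dot_row3 !mulr0 !add0r exprMn mulrC.
  apply/eqP; rewrite -subr_eq0; apply/eqP.
  apply: (@roots_geq_poly_eq0 _ _ [seq i%:R | i <- iota 0 (size (P - Q))]).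
  - by apply/allP => x _; rewrite rootE hornerD hornerN PQt subrr.
  - by rewrite map_inj_uniq ?iota_uniq// => i j /eqP; rewrite eqr_nat => /eqP.
  - by rewrite size_map size_iota.
have n2 : (n - 2 = 2 * k)%N by rewrite /n; lia.
(* The factor [k + 1] of this binomial is also the coefficient of [t^2] in [(1 + t^2)^(k+1)], and it
   cancels at the end. *)
have binE : 'C(n, 2) = (k.+1 * (2 * k + 1))%N.
  rewrite bin2 /n (_ : (2 * k.+1).-1 = 2 * k + 1)%N; last by lia.
  by rewrite -mulnA mul2n doubleK.
have P2 : P`_2 = m 2%N *+ 'C(n, 2).
  by rewrite coef_poly (_ : (2 < n.+1)%N = true)// /n; lia.
have Q2 : Q`_2 = even_moment k.+1 * k.+1%:R.
  rewrite coefZ; congr (_ * _).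
  rewrite exprDn coef_sum (bigD1 (inord 1))//= inordK//.
  rewrite expr1n mul1r bin1 expr1 coefMn coefXn/= big1 ?addr0// => i.
  rewrite -val_eqE/= inordK// => i1.
  rewrite expr1n mul1r -exprM coefMn coefXn.
  by case: i i1 => [[|[|i]] hi]//= _; rewrite ?mul0rn// mulnS /= mul0rn.
have k0 : k.+1%:R != 0 :> R by rewrite pnatr_eq0.
apply: (mulIf k0); rewrite -Q2 -PQ P2 binE /m n2.
by rewrite -[RHS]mulr_natr natrM [RHS]mulrC [k.+1%:R * _]mulrC mulrAC.
Qed.

(** Inserting [x^2 + y^2 + z^2 = 1] into the moment of order [2k] gives the next one plus two equal
    mixed moments, each of which is [1 / (2k + 1)] of the next one. *)
Lemma even_momentS k : (2 * k + 3)%:R * even_moment k.+1 = (2 * k + 1)%:R * even_moment k.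
Proof.
have bz : bmeas (fun p : S2 R => cz p ^+ (2 * k)) by exact: bmeas_czX.
have b1 : bmeas (fun p : S2 R => cz p ^+ (2 * k) * cy p ^+ 2).
  exact: bmeasM bz (bmeasX 2 bmeas_cy).
have b2 : bmeas (fun p : S2 R => cz p ^+ (2 * k) * cx p ^+ 2).
  exact: bmeasM bz (bmeasX 2 bmeas_cx).
have xy : intS (fun p : S2 R => cz p ^+ (2 * k) * cx p ^+ 2) =
          intS (fun p : S2 R => cz p ^+ (2 * k) * cy p ^+ 2).
  have [g gp] := iso_coord_swap; rewrite -(intS_iso g b1).
  by congr intS; apply/funext => p; have [_ -> ->] := gp p.
have : even_moment k = even_moment k.+1 + intS (fun p : S2 R => cz p ^+ (2 * k) * cy p ^+ 2)
   + intS (fun p : S2 R => cz p ^+ (2 * k) * cx p ^+ 2).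
  have b3 := bmeas_czX (2 * k.+1).
  rewrite -(intSD b3 b1) -(intSD (bmeasD b3 b1) b2).
  congr intS; apply/funext => p.
  rewrite mulnS exprD -[LHS]mulr1 -[1 in LHS](sphere_eq p); ring.
rewrite xy => ->; have := mixed_moment k; rewrite !natrD; lra.
Qed.

Lemma even_momentE k : even_moment k = total / (2 * k + 1)%:R.
Proof.
elim: k => [|k IH].
  rewrite /even_moment muln0 add0n divr1; rewrite -[RHS]mul1r -intS_cst.
  by congr intS; apply/funext => p; rewrite expr0.
have k3 : (2 * k + 3)%:R != 0 :> R by rewrite pnatr_eq0 addnS.
have k1 : (2 * k + 1)%:R != 0 :> R by rewrite pnatr_eq0 addnS.
apply: (mulfI k3); rewrite even_momentS IH.
rewrite mulnS (_ : (2 + 2 * k + 1 = 2 * k + 3)%N); last by lia.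
by rewrite mulrCA divff// mulr1 mulrCA divff// mulr1.
Qed.

Lemma odd_moment k : intS (fun p : S2 R => cz p ^+ (2 * k).+1) = 0.
Proof.
have [g gp] := iso_coord_negz.
have := intS_iso g (bmeas_czX (2 * k).+1).
rewrite (_ : (fun _ => _) = (fun p : S2 R => -1 * cz p ^+ (2 * k).+1)).
  rewrite intSZ; last exact: bmeas_czX.
  lra.
apply/funext => p; have [_ _ ->] := gp p.
by rewrite exprNn -signr_odd /= oddM /= expr1.
Qed.

(* Archimedes: [z] is uniformly distributed on [[-1, 1]]. *)
Lemma intS_deriv (Q : {poly R}) :
  intS (fun p : S2 R => Q^`().[cz p]) = total / 2 * (Q.[1] - Q.[-1]).
Proof.
have QE : Q = \sum_(i < size Q) Q`_i *: 'X^i by rewrite -[LHS]coefK poly_def.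
have dQE x : Q^`().[x] = \sum_(i < size Q) (Q`_i * i%:R) * x ^+ i.-1.
  rewrite {1}QE raddf_sum horner_sum; apply: eq_bigr => i _.
  by rewrite /= derivZ derivXn hornerZ hornerMn hornerXn -mulrA mulr_natl.
transitivity (intS (fun p : S2 R => \sum_(i < size Q) (Q`_i * i%:R) * cz p ^+ i.-1)).
  by congr intS; apply/funext => p; rewrite dQE.
rewrite intS_sum => [|i _]; last exact: bmeasZ (bmeas_czX _).
rewrite !horner_coef -sumrB mulr_sumr; apply: eq_bigr => i _.
rewrite (intSZ _ (bmeas_czX _)) -mulrBr mulrCA -mulrA; congr (_ * _).
rewrite expr1n; case: (nat_of_ord i) => [|j]; first by rewrite mul0r expr0 subrr mulr0.
rewrite -signr_odd /=; have [oj|oj] := boolP (odd j).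
  rewrite /= expr0 subrr mulr0 (_ : j = (2 * j./2).+1); last first.
    by rewrite -[LHS]odd_double_half oj mul2n.
  by rewrite odd_moment mulr0.
rewrite /= expr1 opprK /= (_ : j = (2 * j./2)%N); last first.
  by rewrite -[LHS]odd_double_half (negbTE oj) mul2n.
have := even_momentE j./2; rewrite /even_moment => ->.
have h : (2 * j./2 + 1)%:R != 0 :> R by rewrite pnatr_eq0 addnS.
rewrite -[(2 * j./2).+1]addn1; field.
by rewrite addn1 in h; rewrite -natr1 natrM in h.
Qed.

End moments.

(** * Bernstein polynomials and Chebyshev's inequality for the binomial law *)

Section bernstein.
Context {R : realType}.
Implicit Types (u d : R) (g h : nat -> R) (n k m : nat).

Definition bernstein n k u : R := u ^+ k * (1 - u) ^+ (n - k) *+ 'C(n, k).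

(** For [u] in [[0, 1]], the expectation of [g] under the binomial law with parameters [n] and
    [u]. *)
Definition bernstein_sum n g u : R := \sum_(k < n.+1) bernstein n k u * g k.

Lemma bernstein_ge0 n k u : 0 <= u <= 1 -> 0 <= bernstein n k u.
Proof.
by move=> /andP[u0 u1]; rewrite mulrn_wge0// mulr_ge0// exprn_ge0// subr_ge0.
Qed.

Lemma bernstein_sum1 n u : bernstein_sum n (fun=> 1) u = 1.
Proof.
rewrite -[RHS](expr1n _ n) -[X in X ^+ n](subrK u) exprDn.
by apply: eq_bigr => k _; rewrite mulr1 /bernstein mulrC.
Qed.

Lemma bernstein_sumD n g h u :
  bernstein_sum n (fun k => g k + h k) u = bernstein_sum n g u + bernstein_sum n h u.
Proof. by rewrite -big_split; apply: eq_bigr => k _; rewrite mulrDr. Qed.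

Lemma bernstein_sumZ n c g u :
  bernstein_sum n (fun k => c * g k) u = c * bernstein_sum n g u.
Proof. by rewrite mulr_sumr; apply: eq_bigr => k _; rewrite mulrCA. Qed.

Lemma le_bernstein_sum n g h u : 0 <= u <= 1 ->
  (forall k, (k <= n)%N -> g k <= h k) -> bernstein_sum n g u <= bernstein_sum n h u.
Proof.
move=> u01 gh; apply: ler_sum => k _; apply: ler_wpM2l; first exact: bernstein_ge0.
by apply: gh; rewrite -ltnS.
Qed.

(** Absorption, [(k + 1) C(n + 1, k + 1) = (n + 1) C(n, k)]. Used once it gives the mean, used twice
    the second factorial moment. *)
Lemma bernstein_sum_shift n g u :
  bernstein_sum n.+1 (fun k => k%:R * g k) u =
  n.+1%:R * u * bernstein_sum n (fun k => g k.+1) u.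
Proof.
rewrite /bernstein_sum big_ord_recl mul0r mulr0 add0r mulr_sumr.
apply: eq_bigr => k _; rewrite lift0 /bernstein subSS exprS.
have -> : u * u ^+ k * (1 - u) ^+ (n - k) *+ 'C(n.+1, k.+1) * (k.+1%:R * g k.+1) =
    u * u ^+ k * (1 - u) ^+ (n - k) * g k.+1 * (k.+1 * 'C(n.+1, k.+1))%:R.
  by rewrite natrM -[X in X * _ = _]mulr_natr; ring.
rewrite -mul_bin_diag natrM -[X in _ = _ * (X * _)]mulr_natr /=; ring.
Qed.

Lemma bernstein_variance n u : 0 <= u <= 1 ->
  bernstein_sum n (fun k => (k%:R - n%:R * u) ^+ 2) u <= n%:R / 4.
Proof.
move=> /andP[u0 u1].
have m1 : bernstein_sum n (fun k => k%:R) u = n%:R * u.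
  case: n => [|n]; first by rewrite /bernstein_sum big_ord1 mulr0 mul0r.
  have := bernstein_sum_shift n (fun=> 1) u; rewrite bernstein_sum1 mulr1 => <-.
  by apply: eq_bigr => k _; rewrite mulr1.
have m2 : bernstein_sum n (fun k => k%:R * (k%:R - 1)) u = n%:R * (n%:R - 1) * u ^+ 2.
  case: n {m1} => [|n]; first by rewrite /bernstein_sum big_ord1 !mul0r mulr0.
  rewrite (bernstein_sum_shift n (fun k => k%:R - 1)).
  rewrite (_ : bernstein_sum _ _ _ = n%:R * u); first by rewrite -natr1; ring.
  case: n => [|n]; first by rewrite /bernstein_sum big_ord1 subrr mulr0 mul0r.
  have := bernstein_sum_shift n (fun=> 1) u; rewrite bernstein_sum1 mulr1 => <-.
  by apply: eq_bigr => k _; rewrite mulr1 -natr1 addrK.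
rewrite (_ : bernstein_sum _ _ _ = n%:R * u * (1 - u)); last first.
  transitivity (bernstein_sum n (fun k => (k%:R * (k%:R - 1) +
     (1 - 2 * (n%:R * u)) * k%:R) + (n%:R * u) ^+ 2 * 1) u).
    by apply: eq_bigr => k _; ring.
  by rewrite !bernstein_sumD !bernstein_sumZ bernstein_sum1 m1 m2; ring.
rewrite -mulrA ler_wpM2l//; have := sqr_ge0 (1 - 2 * u); lra.
Qed.

(** Chebyshev's inequality, where [g] plays the indicator of a deviation of at least [n d] and
    enters through its quadratic majorant. The bound is the variance bound [n / 4] divided by
    [(n d)^2]. *)
Lemma bernstein_chebyshev n g u d : (0 < n)%N -> 0 < d -> 0 <= u <= 1 ->
  (forall k, (k <= n)%N -> g k <= (k%:R - n%:R * u) ^+ 2 / (n%:R * d) ^+ 2) ->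
  bernstein_sum n g u <= (4 * n%:R * d ^+ 2)^-1.
Proof.
move=> n0 d0 u01 gk; have n0' : 0 < n%:R :> R by rewrite ltr0n.
apply: le_trans (le_bernstein_sum u01 gk) _.
under [X in bernstein_sum _ X]eq_fun do rewrite mulrC.
rewrite bernstein_sumZ.
apply: (@le_trans _ _ (((n%:R * d) ^+ 2)^-1 * (n%:R / 4))).
  by rewrite ler_wpM2l ?invr_ge0 ?sqr_ge0// bernstein_variance.
rewrite le_eqVlt; apply/orP; left; apply/eqP.
by field; rewrite !gt_eqF.
Qed.

(** The probability of at least [m] successes: a polynomial in [u] that approximates the indicator
    of [u >= m / n]. *)
Definition bernstein_tail n m u := bernstein_sum n (fun k => (m <= k)%:R) u.

Lemma bernstein_tail_upper n m u d : (0 < n)%N -> 0 < d -> 0 <= u <= 1 ->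
  m%:R / n%:R + d <= u -> 1 - bernstein_tail n m u <= (4 * n%:R * d ^+ 2)^-1.
Proof.
move=> n0 d0 u01 mu; have n0' : 0 < n%:R :> R by rewrite ltr0n.
rewrite -[X in X - _](bernstein_sum1 n u) -mulN1r -bernstein_sumZ -bernstein_sumD.
apply: bernstein_chebyshev => // k _.
case: leqP => km; first by rewrite mulr1 subrr divr_ge0// sqr_ge0.
rewrite mulr0 addr0 ler_pdivlMr ?exprn_gt0 ?mulr_gt0// mul1r -[leRHS]sqrrN opprB.
have km' : k%:R <= m%:R :> R by rewrite ler_nat ltnW.
have : n%:R * (m%:R / n%:R + d) <= n%:R * u by rewrite ler_wpM2l// ltW.
rewrite mulrDr mulrCA divff ?gt_eqF// mulr1 => h.
have h' : n%:R * d <= n%:R * u - k%:R by lra.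
by rewrite ler_pXn2r// nnegrE ?(le_trans _ h')// mulr_ge0// ltW.
Qed.

Lemma bernstein_tail_lower n m u d : (0 < n)%N -> 0 < d -> 0 <= u <= 1 ->
  u <= m%:R / n%:R - d -> bernstein_tail n m u <= (4 * n%:R * d ^+ 2)^-1.
Proof.
move=> n0 d0 u01 mu; have n0' : 0 < n%:R :> R by rewrite ltr0n.
apply: bernstein_chebyshev => // k _.
case: leqP => km; last by rewrite divr_ge0// sqr_ge0.
rewrite ler_pdivlMr ?exprn_gt0 ?mulr_gt0// mul1r.
have km' : m%:R <= k%:R :> R by rewrite ler_nat.
have : n%:R * u <= n%:R * (m%:R / n%:R - d) by rewrite ler_wpM2l// ltW.
rewrite mulrBr mulrCA divff ?gt_eqF// mulr1 => h.
have h' : n%:R * d <= k%:R - n%:R * u by lra.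
by rewrite ler_pXn2r// nnegrE ?(le_trans _ h')// mulr_ge0// ltW.
Qed.

Lemma bernstein_tail_le1 n m u : 0 <= u <= 1 -> bernstein_tail n m u <= 1.
Proof.
move=> u01; rewrite -[leRHS](bernstein_sum1 n u); apply: le_bernstein_sum => // k _.
by rewrite lern1 leq_b1.
Qed.

Lemma bernstein_tail_ge0 n m u : 0 <= u <= 1 -> 0 <= bernstein_tail n m u.
Proof. by move=> u01; apply: sumr_ge0 => k _; rewrite mulr_ge0// bernstein_ge0. Qed.

End bernstein.

(** * Beta integrals of the height and the measure of caps *)

Section cap_measure.
Context {R : realType}.
Local Notation mu := (sphere_hausdorff R).
Implicit Types (p q : S2 R).

Definition height p : R := (1 + cz p) / 2.

Lemma cz_itv p : -1 <= cz p <= 1.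
Proof.
rewrite -ler_norml; apply: (@sumsq1_le1 _ _ (cx p) (cy p)).
by rewrite -(sphere_eq p); ring. Qed.

Lemma height_itv p : 0 <= height p <= 1.
Proof. by have := cz_itv p; rewrite /height => /andP[? ?]; apply/andP; split; lra. Qed.

Lemma bmeas_height : bmeas (fun p => height p).
Proof.
apply: eq_bmeas (bmeasZ 2^-1 (bmeasD (bmeas_cst 1) bmeas_cz)) => p.
by rewrite /height mulrC.
Qed.

Lemma bmeas_beta i j : bmeas (fun p => height p ^+ i * (1 - height p) ^+ j).
Proof.
exact: bmeasM (bmeasX i bmeas_height) (bmeasX j (bmeasB (bmeas_cst 1) bmeas_height)).
Qed.

Definition beta_moment i j := intS (fun p => height p ^+ i * (1 - height p) ^+ j).

Let U : {poly R} := 2^-1 *: (1 + 'X).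
Let V : {poly R} := 2^-1 *: (1 - 'X).

Let U_height p : U.[cz p] = height p.
Proof. by rewrite /U !hornerE /height mulrC. Qed.

Let V_height p : V.[cz p] = 1 - height p.
Proof. by rewrite /V !hornerE /height; field. Qed.

Let dU : U^`() = (2^-1)%:P.
Proof. by rewrite /U derivZ derivD derivX derivC add0r -mul_polyC mulr1. Qed.

Let dV : V^`() = - (2^-1)%:P.
Proof. by rewrite /V derivZ derivB derivX derivC sub0r -mul_polyC mulrN1. Qed.

Let UV1 : (U.[1] = 1) * (U.[-1] = 0) * (V.[1] = 0) * (V.[-1] = 1).
Proof. by rewrite /U /V !hornerE; do !split; field. Qed.

Lemma beta_moment0 n : n.+1%:R * beta_moment n 0 = total.
Proof.
have := intS_deriv (U ^+ n.+1).
rewrite (_ : (fun _ => _) = (fun p => (n.+1%:R / 2) * (height p ^+ n * (1 - height p) ^+ 0))).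
  rewrite (intSZ _ (bmeas_beta _ _)) -/(beta_moment n 0) => h.
  by move: h; rewrite !horner_exp !UV1 expr1n expr0n/= subr0; lra.
apply/funext => p; rewrite deriv_exp dU hornerMn hornerM horner_exp U_height hornerC.
by rewrite expr0 mulr1 -mulr_natl mulrA.
Qed.

(** Integration by parts: the product of powers of [U] and [V] vanishes at both ends of the
    interval, so its derivative has integral zero. *)
Lemma beta_moment_shift i j :
  i.+1%:R * beta_moment i j.+1 = j.+1%:R * beta_moment i.+1 j.
Proof.
have := intS_deriv (U ^+ i.+1 * V ^+ j.+1).
rewrite (_ : (fun _ => _) = (fun p =>
    (i.+1%:R / 2) * (height p ^+ i * (1 - height p) ^+ j.+1) -
    (j.+1%:R / 2) * (height p ^+ i.+1 * (1 - height p) ^+ j))).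
  rewrite (intSB (bmeasZ _ (bmeas_beta _ _)) (bmeasZ _ (bmeas_beta _ _))).
  rewrite !(intSZ _ (bmeas_beta _ _)) -/(beta_moment i j.+1) -/(beta_moment i.+1 j).
  by rewrite !hornerM !horner_exp !UV1 !expr0n/= mulr0 mul0r subrr mulr0; lra.
apply/funext => p; rewrite derivM !deriv_exp dU dV.
rewrite !(hornerD, hornerMn, hornerM, horner_exp, hornerN, hornerC).
rewrite !U_height !V_height /= -(mulr_natl _ i.+1) -(mulr_natl _ j.+1); ring.
Qed.

(** All Bernstein polynomials of degree [n] have the same integral: the shift of the beta moments is
    compensated by the ratio of consecutive binomials. The induction on [n - k] starts from the pure
    power [k = n]. *)
Lemma intS_bernstein n k : (k <= n)%N ->
  intS (fun p => bernstein n k (height p)) = total / n.+1%:R.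
Proof.
move=> kn; have -> : intS (fun p => bernstein n k (height p)) =
    'C(n, k)%:R * beta_moment k (n - k).
  rewrite -(intSZ _ (bmeas_beta _ _)); congr intS; apply/funext => p.
  by rewrite /bernstein mulr_natl.
have n0 : n.+1%:R != 0 :> R by rewrite pnatr_eq0.
have [j nE] : exists j, (n = j + k)%N by exists (n - k)%N; rewrite subnK.
elim: j k nE kn => [|j IH] k nE kn.
  rewrite -(beta_moment0 n) nE add0n subnn binn mul1r.
  by rewrite nE add0n in n0; field.
rewrite -(IH k.+1) ?nE ?addSnnS ?leq_addl//.
have k0 : k.+1%:R != 0 :> R by rewrite pnatr_eq0.
apply: (mulfI k0); rewrite [RHS]mulrA -natrM mul_bin_left natrM.
rewrite -addSnnS addnK (_ : (j.+1 + k - k.+1 = j)%N); last by lia.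
by rewrite mulrCA beta_moment_shift; ring.
Qed.

Lemma bmeas_bernstein n k : bmeas (fun p => bernstein n k (height p)).
Proof.
by apply: eq_bmeas (bmeasZ 'C(n, k)%:R (bmeas_beta k (n - k))) => p; rewrite mulr_natl.
Qed.

Lemma bmeas_tail n m : bmeas (fun p => bernstein_tail n m (height p)).
Proof.
apply: bmeas_sum => k _.
by apply: eq_bmeas (bmeasZ (m <= k)%:R (bmeas_bernstein n k)) => p; rewrite mulrC.
Qed.

Lemma intS_tail n m : (m <= n.+1)%N ->
  intS (fun p => bernstein_tail n m (height p)) = total * (n.+1 - m)%:R / n.+1%:R.
Proof.
move=> mn.
transitivity (\sum_(k < n.+1) (m <= k)%:R * (total / n.+1%:R) : R).
  rewrite /bernstein_tail /bernstein_sum intS_sum => [|k _]; last first.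
    by apply: eq_bmeas (bmeasZ (m <= k)%:R (bmeas_bernstein n k)) => p; rewrite mulrC.
  apply: eq_bigr => k _; rewrite -(@intS_bernstein n k); last by rewrite -ltnS.
  by rewrite -(intSZ _ (bmeas_bernstein _ _)); congr intS; apply/funext => p; rewrite mulrC.
rewrite -mulr_suml mulrCA mulrA -natr_sum; congr (_ * _%:R * _).
by elim: n.+1 => [|N IH]; [rewrite big_ord0|rewrite big_ord_recr/= IH; lia].
Qed.

Lemma measurable_cap (t : R) : measurable [set p : S2 R | t <= height p].
Proof.
have [mh _] := bmeas_height.
have := mh measurableT _ (measurable_itv `[t, +oo[); rewrite setTI.
by congr measurable; apply/seteqP; split => p /=; rewrite in_itv/= andbT.
Qed.

Lemma bmeas_indic (A : set (S2 R)) : measurable A -> bmeas \1_A.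
Proof.
move=> mA; split; first exact: measurable_indic.
by exists 1 => p; rewrite indicE; case: (_ \in _); rewrite ?normr1 ?normr0.
Qed.

Lemma intS_indic (A : set (S2 R)) : measurable A -> intS \1_A = fine (mu A).
Proof. by move=> mA; rewrite /intS /Rintegral integral_indic// setIT. Qed.

Lemma hausdorff_fineE (A : set (S2 R)) : mu A = (fine (mu A))%:E.
Proof.
rewrite fineK// ge0_fin_numE ?outer_measure_ge0//.
by apply: le_lt_trans (@sphere_finite R); exact: le_outer_measure.
Qed.

Lemma le_fine_hausdorff (A B : set (S2 R)) : A `<=` B -> fine (mu A) <= fine (mu B).
Proof. by move=> AB; rewrite -lee_fin -!hausdorff_fineE; exact: le_outer_measure. Qed.

(** Any [n >= e^-3] makes both the Chebyshev error at distance [e] and the spacing [1 / (n + 1)] at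
    most [e]. *)
Let large_index (e : R) : 0 < e -> e <= 1 -> exists2 n, (0 < n)%N &
  (4 * n%:R * e ^+ 2)^-1 <= e /\ n.+1%:R^-1 <= e.
Proof.
move=> e0 e1; pose n := (Num.truncn (e ^+ 3)^-1).+1.
have n0 : 0 < n%:R :> R by rewrite ltr0n.
have e3 : 0 < e ^+ 3 by rewrite exprn_gt0.
have ne : 1 <= n%:R * e ^+ 3.
  rewrite -ler_pdivrMr// mul1r.
  by have /andP[_ /ltW] := @truncn_itv R (e ^+ 3)^-1 (ltW (etrans (invr_gt0 _) e3)).
exists n => //; split.
  rewrite -[leLHS]mul1r ler_pdivrMr ?mulr_gt0 ?exprn_gt0//.
  have -> : e * (4 * n%:R * e ^+ 2) = 4 * (n%:R * e ^+ 3) by ring.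
  lra.
rewrite -[leLHS]mul1r ler_pdivrMr ?ltr0n// -natr1 mulrDr mulr1.
have : n%:R * e ^+ 3 <= n%:R * e.
  by rewrite ler_wpM2l ?(ltW n0)// exprS ler_piMr ?(ltW e0)// exprn_ile1// ltW.
lra.
Qed.

(** The indicator of the cap is at most [e] plus the tail polynomial with threshold
    [m / n <= t - e]. The integral of that polynomial exceeds [total * (1 - t)] by at most
    [3 e * total], which covers the shift of the threshold and the rounding. *)
Let cap_upper (t e : R) : 0 <= t <= 1 -> 0 < e -> e <= 1 ->
  fine (mu [set p | t <= height p]) <= total * (1 - t) + total * 4 * e.
Proof.
move=> /andP[t0 t1] e0 e1; have T0 := @total_gt0 R.
(* A threshold [t - e] below 0 could not be rounded down to a natural number; then the total measure
   is already a good enough bound. *)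
have [te|te] := leP t e.
  apply: (@le_trans _ _ total); first exact: le_fine_hausdorff.
  have : 0 <= total * (e - t) by apply: mulr_ge0; [exact: ltW|lra].
  have : 0 <= total * e by apply: mulr_ge0; exact: ltW.
  by move=> ? ?; lra.
have [n n0 [ne1 ne2]] := large_index e0 e1.
have n0' : 0 < n%:R :> R by rewrite ltr0n.
have x0 : 0 <= n%:R * (t - e) by apply: mulr_ge0; [exact: ltW|lra].
have /andP[m1 m2] := truncn_itv x0; set m := Num.truncn _ in m1 m2.
have mn : (m <= n)%N.
  by rewrite -(ler_nat R); apply: le_trans m1 _; rewrite -[leRHS]mulr1 ler_wpM2l ?ltW//; lra.
have le_pt p : \1_[set p | t <= height p] p <= bernstein_tail n m (height p) + e.
  rewrite indicE; have [tp|tp] := leP t (height p).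
    rewrite mem_set//= -lerBlDl.
    apply: le_trans ne1; apply: bernstein_tail_upper => //; first exact: height_itv.
    apply: le_trans tp; rewrite -lerBrDr ler_pdivrMr// mulrC//.
  rewrite memNset/=; last by move=> /=; rewrite leNgt tp.
  by rewrite addr_ge0 ?(ltW e0)// bernstein_tail_ge0// height_itv.
rewrite -intS_indic; last exact: measurable_cap.
apply: le_trans (le_intS (bmeas_indic (measurable_cap _))
  (bmeasD (bmeas_tail n m) (bmeas_cst e)) le_pt) _.
rewrite (intSD (bmeas_tail n m) (bmeas_cst e)) intS_cst intS_tail ?(leq_trans mn)//.
rewrite natrB ?(leq_trans mn)//.
set N := n.+1%:R in ne2 *.
have N0 : 0 < N by rewrite ltr0n.
have nN : n%:R = N - 1 by rewrite /N -natr1 addrK.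
have NN : N^-1 * N = 1 by rewrite mulVf// gt_eqF.
have h : (N - m%:R) / N <= 1 - t + 3 * e.
  rewrite ler_pdivrMr//; move: m2; rewrite -natr1 nN.
  have : 1 <= e * N by rewrite -NN ler_pM2r.
  nra.
have : total * ((N - m%:R) / N) <= total * (1 - t + 3 * e) by rewrite ler_pM2l.
by rewrite -mulrA; move: (_ / N) => z; lra.
Qed.

(** The mirror image of the upper bound, with the threshold [(m + 1) / n] just above [t + e]. *)
Let cap_lower (t e : R) : 0 <= t <= 1 -> 0 < e -> e <= 1 ->
  total * (1 - t) <= fine (mu [set p | t <= height p]) + total * 4 * e.
Proof.
move=> /andP[t0 t1] e0 e1; have T0 := @total_gt0 R.
have Te : 0 <= total * e by apply: mulr_ge0; exact: ltW.
have [te|te] := leP 1 (t + e).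
  have : 0 <= total * (t + e - 1) by apply: mulr_ge0; [exact: ltW|lra].
  have : 0 <= fine (mu [set p | t <= height p]) by rewrite fine_ge0.
  by move=> ? ?; lra.
have [n n0 [ne1 ne2]] := large_index e0 e1.
have n0' : 0 < n%:R :> R by rewrite ltr0n.
have x0 : 0 <= n%:R * (t + e) by apply: mulr_ge0; [exact: ltW|lra].
have /andP[m1 m2] := truncn_itv x0; set m := Num.truncn _ in m1 m2.
have mn : (m.+1 <= n.+1)%N.
  rewrite ltnS -(ler_nat R); apply: le_trans m1 _.
  by rewrite -[leRHS]mulr1 ler_wpM2l ?ltW//; lra.
have le_pt p : bernstein_tail n m.+1 (height p) <= \1_[set p | t <= height p] p + e.
  rewrite indicE; have [tp|tp] := leP t (height p).
    rewrite mem_set//=; apply: (@le_trans _ _ 1); last by rewrite lerDl ltW.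
    exact/bernstein_tail_le1/height_itv.
  rewrite memNset/= ?add0r; last by move=> /=; rewrite leNgt tp.
  apply: le_trans ne1; apply: bernstein_tail_lower => //; first exact: height_itv.
  apply: (le_trans (ltW tp)); rewrite lerBrDr ler_pdivlMr// mulrC; exact: ltW.
rewrite -intS_indic; last exact: measurable_cap.
have := le_intS (bmeas_tail n m.+1)
  (bmeasD (bmeas_indic (measurable_cap t)) (bmeas_cst e)) le_pt.
rewrite (intSD (bmeas_indic (measurable_cap t)) (bmeas_cst e)) intS_cst intS_tail//.
rewrite natrB//.
set N := n.+1%:R in ne2 *.
have N0 : 0 < N by rewrite ltr0n.
have nN : n%:R = N - 1 by rewrite /N -natr1 addrK.
have NN : N^-1 * N = 1 by rewrite mulVf// gt_eqF.
have h : 1 - t - 2 * e <= (N - m.+1%:R) / N.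
  rewrite ler_pdivlMr//; move: m1; rewrite -natr1 nN.
  have : 1 <= e * N by rewrite -NN ler_pM2r.
  nra.
have : total * (1 - t - 2 * e) <= total * ((N - m.+1%:R) / N) by rewrite ler_pM2l.
by rewrite -mulrA; move: (_ / N) => z; lra.
Qed.

Lemma hausdorff_cap_height (t : R) : 0 <= t <= 1 ->
  mu [set p | t <= height p] = (total * (1 - t))%:E.
Proof.
move=> t01; rewrite hausdorff_fineE; congr EFin; have T0 := @total_gt0 R.
have small (x y : R) : (forall e, 0 < e -> e <= 1 -> x <= y + total * 4 * e) -> x <= y.
  move=> xy; apply/ler_addgt0Pr => d d0.
  pose e := Num.min 1 (d / (total * 4)).
  have T4 : 0 < total * 4 :> R by rewrite mulr_gt0.
  apply: le_trans (xy e _ _) _; rewrite ?lt_min ?ltr01 ?divr_gt0// ?ge_min ?lexx//.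
  rewrite lerD2l mulrC -ler_pdivlMr// ge_min lexx orbT//.
apply/eqP; rewrite eq_le; apply/andP; split; apply: small => e e0 e1.
  exact: cap_upper.
exact: cap_lower.
Qed.

Lemma iso_to_point (p q : sphere_point R) : exists g : isometry R, g p = q.
Proof.
exists (reflection (sval p - sval q)); apply/eqP; rewrite -val_eqE /=.
by rewrite householder_swap// !dot_sphere.
Qed.

Definition closed_cap (q : sphere_point R) (r : R) : set (sphere_point R) :=
  [set p | dist p q <= r].

Lemma closed_cap_iso (g : isometry R) q r :
  g @^-1` (closed_cap (g q) r) = closed_cap q r.
Proof. by apply/seteqP; split=> p; rewrite /closed_cap /= iso_dist. Qed.

Lemma measurable_closed_cap q r : measurable (closed_cap q r : set (S2 R)).
Proof.
have [r0|r0] := leP 0 r; last first.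
  rewrite (_ : closed_cap q r = set0)//; apply/seteqP; split=> // p /=.
  by rewrite /closed_cap /= leNgt (lt_le_trans r0)// dist_ge0.
rewrite (_ : closed_cap q r =
  [set p : S2 R | dot (sval p) (- sval q) <= - (1 - r ^+ 2 / 2)]).
  exact: caratheodory_halfspace.
by apply/seteqP; split=> p; rewrite /closed_cap /= dist_le// dotNr lerN2.
Qed.

(** The squared distance to the pole is [4 (1 - height)], so a cap is a superlevel set of the
    height. The measure is exactly quadratic in the chordal radius, as for planar discs. *)
Lemma hausdorff_closed_cap q r : 0 <= r <= 2 ->
  mu (closed_cap q r) = (total / 4 * r ^+ 2)%:E.
Proof.
move=> /andP[r0 r2].
have [N _ [N0 N1 N2]] := @sphere_point_ex R 0 0 1 (ltac:(ring)).
have [g gq] := iso_to_point q N.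
rewrite -(closed_cap_iso g) hausdorff_preimage_iso gq.
rewrite (_ : closed_cap N r = [set p | 1 - r ^+ 2 / 4 <= height p]).
  rewrite hausdorff_cap_height; first by congr EFin; field.
  by apply/andP; split; [nra|have := sqr_ge0 r; lra].
apply/seteqP; split=> p; rewrite /closed_cap /= dist_le// dot_coord N0 N1 N2 /height; lra.
Qed.

End cap_measure.

(** * The area of the sphere: upper bound *)

Section packing.
Context {R : realType}.
Local Notation T := (sphere_point R).
Local Notation mu := (sphere_hausdorff R).
Local Notation diam := (diam (@dist R)).
Local Notation disc_area := (disc_area (@dist R)).
Implicit Types (p q : T) (s : seq (T * R)) (l : seq T) (rho d : R) (A B : set T).

Definition rhausdorff A : R := fine (mu A).

Lemma rhausdorffE A : mu A = (rhausdorff A)%:E. Proof. exact: hausdorff_fineE. Qed.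

Lemma rhausdorff_ge0 A : 0 <= rhausdorff A. Proof. by rewrite fine_ge0. Qed.

Lemma le_rhausdorff A B : A `<=` B -> rhausdorff A <= rhausdorff B.
Proof. exact: le_fine_hausdorff. Qed.

Lemma rhausdorff_le_total A : rhausdorff A <= total. Proof. exact: le_rhausdorff. Qed.

Lemma rhausdorffU A B : rhausdorff (A `|` B) <= rhausdorff A + rhausdorff B.
Proof. by rewrite -lee_fin EFinD -!rhausdorffE; exact: outer_measureU2. Qed.

Lemma rhausdorff_closed_cap q r : 0 <= r <= 2 -> rhausdorff (closed_cap q r) = total / 4 * r ^+ 2.
Proof. by move=> r02; rewrite /rhausdorff hausdorff_closed_cap. Qed.

(* A pair (centre, radius) encodes a closed cap. *)
Definition uncovered s : set T := [set p | all (fun c => c.2 < dist p c.1) s].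

Lemma uncovered_cons c s : uncovered (c :: s) = uncovered s `&` ~` closed_cap c.1 c.2.
Proof.
apply/seteqP; split=> p; rewrite /uncovered /closed_cap /=.
  by move=> /andP[h1 h2]; split=> //; apply/negP; rewrite -ltNge.
by move=> [-> /negP]; rewrite -ltNge => ->.
Qed.

Lemma measurable_uncovered s : measurable (uncovered s : set (S2 R)).
Proof.
elim: s => [|c s IH]; first by rewrite (_ : uncovered [::] = setT)//; apply/seteqP; split.
rewrite uncovered_cons; apply: measurableI => //; apply: measurableC.
exact: measurable_closed_cap.
Qed.

(** A point left uncovered after all radii grow by [rho] is the centre of a cap of radius [rho]
    disjoint from all caps of [s]. *)
Definition inflate rho s := [seq (c.1, c.2 + rho) | c <- s].

Lemma uncovered_inflate rho s p : uncovered (inflate rho s) p ->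
  closed_cap p rho `<=` uncovered s.
Proof.
rewrite /uncovered /inflate /= all_map => /allP h q; rewrite /closed_cap /= => qp.
apply/allP => c /h /=; have := dist_triangle q p c.1; rewrite (distC p q); lra.
Qed.

Lemma rhausdorff_uncovered_cons p rho s : uncovered (inflate rho s) p ->
  rhausdorff (uncovered ((p, rho) :: s)) + rhausdorff (closed_cap p rho) = rhausdorff (uncovered s).
Proof.
move=> /uncovered_inflate ps; apply: EFin_inj; rewrite EFinD -!rhausdorffE.
rewrite (measurable_closed_cap p rho (uncovered s)) uncovered_cons addeC.
by rewrite (setIidr ps).
Qed.

Definition caps rho l : seq (T * R) := [seq (p, rho) | p <- l].

(** Each centre is admissible with respect to [s] and the centres behind it in the list, so the caps
    of radius [rho] about [l] are disjoint from one another and from the caps of [s]. *)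
Fixpoint separated rho s l : Prop :=
  if l is p :: l' then uncovered (inflate rho (caps rho l' ++ s)) p /\ separated rho s l'
  else True.

Lemma rhausdorff_separated rho s l : 0 <= rho <= 2 -> separated rho s l ->
  rhausdorff (uncovered (caps rho l ++ s)) + (size l)%:R * (total / 4 * rho ^+ 2) =
  rhausdorff (uncovered s).
Proof.
move=> rho02; elim: l => [|p l IH] /=; first by rewrite mul0r addr0.
move=> [pl /IH <-]; rewrite -(rhausdorff_uncovered_cons pl) rhausdorff_closed_cap// -natr1; ring.
Qed.

(** Each cap takes the fixed measure [total / 4 * rho^2] out of a finite total, so the length of a
    separated list is bounded and a longest one exists. A point still available would lengthen
    it. *)
Lemma maximal_separated rho s : 0 < rho -> rho <= 2 -> exists2 l, separated rho s l &
  uncovered (inflate rho (caps rho l ++ s)) = set0.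
Proof.
move=> r0 r2; have rho02 : 0 <= rho <= 2 by rewrite ltW.
have T0 := @total_gt0 R.
have m0 : 0 < total / 4 * rho ^+ 2 by rewrite mulr_gt0 ?exprn_gt0// divr_gt0.
pose Q n := `[< exists2 l, separated rho s l & size l = n >].
have exQ : exists n, Q n by exists 0%N; apply/asboolP; exists [::].
have bndQ n : Q n -> (n <= Num.truncn (total / (total / 4 * rho ^+ 2)))%N.
  move=> /asboolP[l sl <-]; rewrite -ltnS -(ltr_nat R).
  have /andP[_] := truncn_itv (divr_ge0 (ltW T0) (ltW m0)); apply: le_lt_trans.
  rewrite ler_pdivlMr//; have := rhausdorff_separated rho02 sl.
  by have := rhausdorff_le_total (uncovered s);
    have := rhausdorff_ge0 (uncovered (caps rho l ++ s)); lra.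
case: (ex_maxnP exQ bndQ) => n /asboolP[l sl ln] nmax.
exists l => //; apply/seteqP; split=> // p pl.
have : Q n.+1 by apply/asboolP; exists (p :: l); rewrite /= ?ln.
by move=> /nmax; rewrite ltnn.
Qed.

(** The uncovered set is cut out by finitely many strict inequalities, so it is the increasing union
    of the sets left after inflating by [1 / (n + 1)]. Continuity from below gives half of its
    measure. *)
Lemma uncovered_exhaust s d : 0 < d -> 0 < rhausdorff (uncovered s) ->
  exists2 rho, 0 < rho <= d &
    rhausdorff (uncovered s) / 2 <= rhausdorff (uncovered (inflate rho s)).
Proof.
move=> d0 s0.
pose K n : set (S2 R) := uncovered (inflate n.+1%:R^-1 s).
have Knd : nondecreasing_seq K.
  move=> m n mn; apply/subsetPset => p; rewrite /K /uncovered /inflate /= !all_map.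
  apply: sub_all => c /=; apply: le_lt_trans.
  by rewrite lerD2l lef_pV2 ?posrE ?ltr0n// ler_nat.
have KU : \bigcup_n K n = uncovered s.
  apply/seteqP; split=> [p [n _]|p].
    rewrite /K /uncovered /inflate /= all_map; apply: sub_all => c /=; apply: le_lt_trans.
    by rewrite lerDl invr_ge0.
  rewrite /uncovered /= => sp.
  suff [n hn] : exists n, all (fun c => c.2 + n.+1%:R^-1 < dist p c.1) s.
    by exists n => //; rewrite /K /uncovered /inflate /= all_map.
  elim: s sp {s0 K Knd} => [|c s IH] /=; first by exists 0%N.
  move=> /andP[cp /IH[n hn]]; have [m cm] := ltr_add_invr cp.
  exists (maxn m n); apply/andP; split.
    apply: le_lt_trans cm; rewrite lerD2l lef_pV2 ?posrE ?ltr0n// ler_nat ltnS leq_maxl//.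
  apply: sub_all hn => c' /=; apply: le_lt_trans.
  by rewrite lerD2l lef_pV2 ?posrE ?ltr0n// ler_nat ltnS leq_maxr.
have mK n : measurable (K n) by exact: measurable_uncovered.
have cvgK : area (K n) @[n --> \oo] --> area (uncovered s : set (S2 R)).
  by rewrite -KU; apply: nondecreasing_cvg_mu => //; rewrite KU; exact: measurable_uncovered.
have [n dn] : exists n, n.+1%:R^-1 <= d.
  by have [n] := ltr_add_invr d0; rewrite add0r => /ltW; exists n.
have [k [hk nk]] : exists k, rhausdorff (uncovered s) / 2 <= rhausdorff (K k) /\ (n <= k)%N.
  apply: contrapT => /forallNP h.
  have : (area (uncovered s : set (S2 R)) <= (rhausdorff (uncovered s) / 2)%:E)%E.
    apply: cvge_to_le cvgK _; exists n => // k /= nk.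
    rewrite -[leLHS]/(mu (K k)) rhausdorffE lee_fin leNgt; apply/negP => hk.
    by apply: (h k); split=> //; exact: ltW.
  by rewrite -[leLHS]/(mu (uncovered s)) rhausdorffE lee_fin; lra.
exists k.+1%:R^-1 => //; rewrite invr_gt0 ltr0n/=; apply: le_trans dn.
by rewrite lef_pV2 ?posrE ?ltr0n// ler_nat.
Qed.

(** By maximality every point outside the inflated caps of [s] is within [2 rho] of some centre in
    [l]. The bound [rho <= 1] keeps [2 rho] in the range of the cap formula. *)
Lemma rhausdorff_covered rho s l : 0 < rho <= 1 ->
  uncovered (inflate rho (caps rho l ++ s)) = set0 ->
  rhausdorff (uncovered (inflate rho s)) <= (size l)%:R * (total * rho ^+ 2).
Proof.
move=> /andP[r0 r1] l0.
have sub : uncovered (inflate rho s) `<=` ~` uncovered (caps (2 * rho) l).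
  move=> p ps pl; suff : set0 p by []; rewrite -l0.
  rewrite /uncovered /inflate /= map_cat all_cat; apply/andP; split=> //.
  move: pl; rewrite /uncovered /caps /= !all_map; apply: sub_all => q /=.
  by rewrite (_ : 2 * rho = rho + rho)//; ring.
apply: le_trans (le_rhausdorff sub) _; elim: l {l0 sub} => [|p l IH].
  rewrite mul0r /uncovered /= (_ : ~` _ = set0) /rhausdorff ?outer_measure0//.
  by apply/seteqP; split=> p //= /(_ isT).
rewrite /caps map_cons uncovered_cons setCI setCK.
apply: le_trans (rhausdorffU _ _) _; rewrite rhausdorff_closed_cap /=; last first.
  by apply/andP; split; lra.
rewrite -natr1; move: IH; rewrite /caps; lra.
Qed.

(* Caps of radius [rho] about a maximal [2 rho]-separated set are disjoint, and
   doubling the radii, which multiplies their areas by 4, covers. *)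
Lemma packing_step s d : 0 < d -> exists s',
  [/\ all (fun c => 0 < c.2 <= d) s',
      rhausdorff (uncovered (s' ++ s)) + \sum_(c <- s') total / 4 * c.2 ^+ 2 <=
        rhausdorff (uncovered s) &
      rhausdorff (uncovered (s' ++ s)) <= 7 / 8 * rhausdorff (uncovered s)].
Proof.
move=> d0; have := rhausdorff_ge0 (uncovered s); rewrite le_eqVlt => /predU1P[s0|s0].
  by exists [::]; rewrite big_nil /= -s0 addr0 mulr0; split.
have d1 : 0 < Num.min d 1 by rewrite lt_min d0 ltr01.
have [rho /andP[r0]] := uncovered_exhaust d1 s0.
rewrite le_min => /andP[rd r1] hrho.
have [l sl l0] := maximal_separated s r0 (le_trans r1 (ler1n _ 2)).
have r02 : 0 <= rho <= 2 by apply/andP; split; lra.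
have r01 : 0 < rho <= 1 by rewrite r0.
have h1 := rhausdorff_separated r02 sl.
have h2 := rhausdorff_covered r01 l0.
exists (caps rho l); split.
- by rewrite all_map; apply/allP => p _ /=; rewrite r0.
- by rewrite big_map /= big_const_seq count_predT iter_addr_0 -[X in _ + X <= _]mulr_natl h1.
(* The doubled caps measure at least half of the uncovered part, and the caps themselves a quarter
   of that: at least [1/8] is removed. *)
- have h3 := le_trans hrho h2.
  set N := (size l)%:R in h1 h3.
  have -> : rhausdorff (uncovered (caps rho l ++ s)) =
      rhausdorff (uncovered s) - N * (total / 4 * rho ^+ 2) by rewrite -h1; ring.
  have -> : N * (total / 4 * rho ^+ 2) = N * (total * rho ^+ 2) / 4 by field.
  lra.
Qed.

Lemma efficient_packing d e : 0 < d -> 0 < e -> exists s,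
  [/\ all (fun c => 0 < c.2 <= d) s, \sum_(c <- s) total / 4 * c.2 ^+ 2 <= total &
      rhausdorff (uncovered s) < e].
Proof.
move=> d0 e0; have T0 := @total_gt0 R.
have iter n : exists s, [/\ all (fun c => 0 < c.2 <= d) s,
      rhausdorff (uncovered s) + \sum_(c <- s) total / 4 * c.2 ^+ 2 <= total &
      rhausdorff (uncovered s) <= (7 / 8) ^+ n * total].
  elim: n => [|n [s [sd ss sn]]].
    by exists [::]; rewrite big_nil /= addr0 expr0 mul1r; split=> //; exact: rhausdorff_le_total.
  have [s' [s'd s's s'n]] := packing_step s d0.
  exists (s' ++ s); split; first by rewrite all_cat s'd.
    by rewrite big_cat /=; lra.
  by rewrite exprS -mulrA; apply: le_trans s'n _; rewrite ler_pM2l; lra.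
have [n hn] : exists n, (7 / 8) ^+ n * total < e.
  have : (fun n => (7 / 8 : R) ^+ n) @ \oo --> (0 : R).
    by apply: cvg_expr; rewrite ger0_norm; lra.
  move=> /cvgrPdist_lt /(_ (e / total)); rewrite divr_gt0// => /(_ isT)[n _ /(_ n (leqnn n))].
  have q0 : 0 <= 7 / 8 :> R by lra.
  rewrite /= sub0r normrN ger0_norm ?exprn_ge0//.
  by rewrite ltr_pdivlMr//; exists n.
have [s [sd ss sn]] := iter n; exists s; split=> //.
  by have := rhausdorff_ge0 (uncovered s); lra.
exact: le_lt_trans sn hn.
Qed.

Lemma disc_area_closed_cap q r : 0 <= r ->
  (diam (closed_cap q r) <= (2 * r)%:E)%E /\ (disc_area (closed_cap q r) <= (pi * r ^+ 2)%:E)%E.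
Proof.
move=> r0; have h : (diam (closed_cap q r) <= (2 * r)%:E)%E.
  apply: diam_le; first by rewrite mulr_ge0.
  move=> p1 p2; rewrite /closed_cap /= => h1 h2.
  by have := dist_triangle q p1 p2; rewrite (distC q p2); lra.
split=> //; apply: le_trans (disc_area_le _ h) _; first by rewrite mulr_ge0.
by rewrite lee_fin le_eqVlt; apply/orP; left; apply/eqP; field.
Qed.

(** A cap of radius [r] has disc area at most [pi r^2], which is [4 pi / total] times its measure.
    Disjoint caps therefore cost at most [4 pi], and the remainder, of measure below [e], has a fine
    cover that costs less than [e]. *)
Lemma total_le : total <= 4 * pi :> R.
Proof.
have T0 := @total_gt0 R.
apply/ler_addgt0Pr => e e0; rewrite -lee_fin -totalE; apply: hausdorff_le => d d0.
have d2 : 0 < d / 2 by rewrite divr_gt0.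
have [s [sd ss se]] := efficient_packing d2 e0.
have : (mu (uncovered s) < e%:E)%E by rewrite rhausdorffE lte_fin.
move=> /(hausdorff_cover d0)[U [Ud sU Ue]].
pose c0 : T * R := (point, 0).
exists (fun k => if (k < size s)%N then closed_cap (nth c0 s k).1 (nth c0 s k).2
                 else U (k - size s)%N); split.
- move=> k; case: ltnP => // ks; have /andP[r0 rd] := all_nthP c0 sd k ks.
  apply: le_trans (disc_area_closed_cap _ (ltW r0)).1 _.
  by rewrite lee_fin; lra.
- move=> p _; have [sp|/negP] := pselect (uncovered s p).
    have [k _ Uk] := sU p sp; exists (size s + k)%N => //.
    by rewrite ltnNge leq_addr /= addKn.
  rewrite -has_predC => /hasP[c cs /=]; rewrite -leNgt => pc.
  exists (index c s) => //=; rewrite index_mem cs nth_index//.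
- rewrite (nneseries_split _ (size s)); last by move=> *; exact: disc_area_ge0.
  rewrite add0n EFinD; apply: leeD.
    apply: (@le_trans _ _ (\sum_(0 <= k < size s)
      (4 * pi / total * (total / 4 * (nth c0 s k).2 ^+ 2))%:E)%E).
      rewrite big_nat [leRHS]big_nat; apply: lee_sum => k /= ks; rewrite ks.
      have /andP[r0 rd] := all_nthP c0 sd k ks.
      apply: le_trans (disc_area_closed_cap _ (ltW r0)).2 _.
      by rewrite lee_fin le_eqVlt; apply/orP; left; apply/eqP; field; rewrite gt_eqF.
    rewrite sumEFin lee_fin -mulr_sumr.
    have -> : \sum_(0 <= k < size s) total / 4 * (nth c0 s k).2 ^+ 2 =
       \sum_(c <- s) total / 4 * c.2 ^+ 2 by rewrite (big_nth c0).
    by rewrite mulrAC ler_pdivrMr// ler_wpM2l// mulr_ge0// pi_ge0.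
  apply: le_trans (ltW Ue); rewrite -nneseries_addn; last first.
    by move=> k; case: ifP => _; exact: disc_area_ge0.
  apply: lee_nneseries => [k _ _|k _]; first exact: disc_area_ge0.
  by rewrite ltnNge leq_addl /= addnK.
Qed.

End packing.

(** * The area of the sphere: lower bound *)

Section sectors.
Context {R : realType}.
Local Notation T := (sphere_point R).
Local Notation mu := (sphere_hausdorff R).
Implicit Types (p q : T) (a w r : R) (k n : nat).

Lemma rotation_subproof a p :
  dot (row3 (cx p * cos a - cy p * sin a) (cx p * sin a + cy p * cos a) (cz p))
      (row3 (cx p * cos a - cy p * sin a) (cx p * sin a + cy p * cos a) (cz p)) == 1.
Proof.
apply/eqP; rewrite dot_row33 -(sphere_eq p).
transitivity ((cx p ^+ 2 + cy p ^+ 2) * (cos a ^+ 2 + sin a ^+ 2) + cz p ^+ 2); first by ring.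
by rewrite cos2Dsin2 mulr1.
Qed.

Definition rotate_pt a p : T :=
  exist (fun v : 'rV_3 => is_true (dot v v == 1)) _ (rotation_subproof a p).

Lemma rotate_ptE a p : [/\ cx (rotate_pt a p) = cx p * cos a - cy p * sin a,
  cy (rotate_pt a p) = cx p * sin a + cy p * cos a & cz (rotate_pt a p) = cz p].
Proof. by rewrite /cx /cy /cz /= !mxE. Qed.

Lemma coord_inj p q : cx p = cx q -> cy p = cy q -> cz p = cz q -> p = q.
Proof.
move=> x y z; apply/eqP; rewrite -val_eqE /= -subr_eq0 -dot_eq0 -sqr_eucl_dist -/(dist p q).
by rewrite sqr_dist_coord x y z !subrr expr0n /= !addr0.
Qed.

Lemma rotate_ptK a : cancel (rotate_pt a) (rotate_pt (- a)).
Proof.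
move=> p; have [x y z] := rotate_ptE a p.
have [x' y' z'] := rotate_ptE (- a) (rotate_pt a p).
have cs := cos2Dsin2 a.
apply: coord_inj; rewrite ?x' ?y' ?z' ?x ?y ?z// cosN sinN.
  by transitivity (cx p * (cos a ^+ 2 + sin a ^+ 2)); [ring|rewrite cs mulr1].
by transitivity (cy p * (cos a ^+ 2 + sin a ^+ 2)); [ring|rewrite cs mulr1].
Qed.

Lemma rotate_ptNK a : cancel (rotate_pt (- a)) (rotate_pt a).
Proof. by move=> p; have := rotate_ptK (- a) p; rewrite opprK. Qed.

Lemma dot_rotate_pt a p q :
  dot (sval (rotate_pt a p)) (sval (rotate_pt a q)) = dot (sval p) (sval q).
Proof.
rewrite !dot_coord; have [-> -> ->] := rotate_ptE a p; have [-> -> ->] := rotate_ptE a q.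
transitivity ((cx p * cx q + cy p * cy q) * (cos a ^+ 2 + sin a ^+ 2) + cz p * cz q); first by ring.
by rewrite cos2Dsin2 mulr1.
Qed.

Definition rotation a : isometry R :=
  Isometry (@rotate_ptK a) (@rotate_ptNK a) (@dot_rotate_pt a).

(** Encoded by the existence of polar coordinates, in place of an argument function; [0 < rho]
    leaves out the two poles. *)
Definition sector w k : set T := [set p | exists rho theta,
  [/\ 0 < rho, k%:R * w <= theta < k.+1%:R * w, cx p = rho * cos theta &
      cy p = rho * sin theta]].

Lemma sector_rotation w k : sector w k = rotation (- (k%:R * w)) @^-1` sector w 0.
Proof.
apply/seteqP; split=> p /=; have [px py _] := rotate_ptE (- (k%:R * w)) p.
  move=> [rho [t [r0 /andP[t1 t2] x y]]]; exists rho, (t - k%:R * w); split=> //.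
  - rewrite mul0r mul1r; apply/andP; split; first by rewrite subr_ge0.
    by rewrite ltrBlDr; apply: lt_le_trans t2 _; rewrite -natr1 mulrDl mul1r addrC.
  - by rewrite px x y cosN sinN cosB; ring.
  - by rewrite py x y cosN sinN sinB; ring.
move=> [rho [t [r0 /andP[]]]]; rewrite mul0r mul1r => t1 t2; rewrite px py cosN sinN => x y.
have cs := cos2Dsin2 (k%:R * w); set c := cos _ in x y cs; set s := sin _ in x y cs.
exists rho, (t + k%:R * w); split=> //.
- apply/andP; split; first by rewrite lerDr.
  by rewrite -natr1 mulrDl mul1r addrC ltrD2l.
- rewrite cosD -/c -/s mulrBr mulrA -x [rho * (sin t * s)]mulrA -y.
  by transitivity (cx p * (c ^+ 2 + s ^+ 2)); [rewrite cs mulr1|ring].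
- rewrite sinD -/c -/s mulrDr mulrA -y [rho * (cos t * s)]mulrA -x.
  by transitivity (cy p * (c ^+ 2 + s ^+ 2)); [rewrite cs mulr1|ring].
Qed.

Lemma polar_upper (x y : R) : 0 <= y -> 0 < x ^+ 2 + y ^+ 2 ->
  exists rho t, [/\ 0 < rho, 0 <= t <= pi, x = rho * cos t & y = rho * sin t].
Proof.
move=> y0 xy0; pose rho := Num.sqrt (x ^+ 2 + y ^+ 2).
have r0 : 0 < rho by rewrite sqrtr_gt0.
have r2 : rho ^+ 2 = x ^+ 2 + y ^+ 2 by rewrite sqr_sqrtr// ltW.
have xr : -1 <= x / rho <= 1.
  rewrite -ler_norml normrM normfV (gtr0_norm r0) ler_pdivrMr// mul1r.
  rewrite -(@ler_pXn2r _ 2)// ?nnegrE ?(ltW r0)// real_normK ?num_real// r2.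
  by rewrite lerDl sqr_ge0.
exists rho, (acos (x / rho)); split=> //.
- by rewrite acos_ge0// acos_lepi.
- by rewrite acosK ?in_itv//= mulrCA divff ?mulr1// gt_eqF.
- rewrite sin_acos//.
  have -> : 1 - (x / rho) ^+ 2 = (y / rho) ^+ 2.
    by rewrite !expr_div_n r2; field; rewrite gt_eqF.
  by rewrite sqrtr_sqr ger0_norm ?divr_ge0 ?(ltW r0)// mulrCA divff ?mulr1// gt_eqF.
Qed.

(** The sector is a wedge between two planes through the axis: [y >= 0] and [x sin w - y cos w > 0],
    the latter expression being [rho sin (w - t)]. *)
Lemma measurable_sector0 w : 0 < w <= pi / 2 -> measurable (sector w 0 : set (S2 R)).
Proof.
move=> /andP[w0 wpi]; have P0 := pi_gt0 R.
have -> : sector w 0 = [set p : S2 R | dot (sval p) (row3 0 (-1) 0) <= 0] `&`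
    ~` [set p : S2 R | dot (sval p) (row3 (sin w) (- cos w) 0) <= 0].
  have cw : 0 <= cos w by rewrite cos_ge0_pihalf// wpi andbT; lra.
  have sw : 0 < sin w by rewrite sin_gt0_pi//; apply/andP; split; lra.
  apply/seteqP; split=> p /=; rewrite !dot_row3 -!/(cx p) -!/(cy p) -!/(cz p).
    move=> [rho [t [r0 /andP[]]]]; rewrite mul0r mul1r => t0 tw x y.
    have st : 0 <= sin t by rewrite sin_ge0_pi//; apply/andP; split; lra.
    have yp : 0 <= cy p by rewrite y mulr_ge0// ltW.
    split; first by lra.
    apply/negP; rewrite -ltNge x y.
    have -> : rho * cos t * sin w + rho * sin t * - cos w + cz p * 0 = rho * sin (w - t).
      by rewrite sinB; ring.
    by rewrite mulr_gt0// sin_gt0_pi//; apply/andP; split; lra.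
  move=> [y0 /negP]; rewrite -ltNge mulr0 addr0 => xs.
  have yp : 0 <= cy p by lra.
  have xy0 : 0 < cx p ^+ 2 + cy p ^+ 2.
    rewrite lt_neqAle addr_ge0 ?sqr_ge0// andbT eq_sym; apply/eqP => h.
    have [x0 y00] : cx p = 0 /\ cy p = 0 by split; nra.
    by move: xs; rewrite x0 y00; lra.
  have [rho [t [r0 /andP[t0 tpi] x y]]] := polar_upper yp xy0.
  exists rho, t; split=> //; rewrite mul0r mul1r t0 /=.
  rewrite ltNge; apply/negP => wt.
  move: xs; rewrite x y.
  have -> : rho * cos t * sin w + rho * sin t * - cos w = - (rho * sin (t - w)).
    by rewrite sinB; ring.
  have : 0 <= rho * sin (t - w).
    by rewrite mulr_ge0 ?(ltW r0)// sin_ge0_pi//; apply/andP; split; lra.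
  lra.
apply: measurableI; first exact: caratheodory_halfspace.
by apply: measurableC; exact: caratheodory_halfspace.
Qed.

Lemma measurable_sector w k : 0 < w <= pi / 2 -> measurable (sector w k : set (S2 R)).
Proof.
move=> w0; rewrite sector_rotation; apply: caratheodory_preimage_iso.
exact: measurable_sector0.
Qed.

(** The radii agree, so [cos (t - t') = 1] and the sine of half of [t - t'] vanishes; that half lies
    strictly between [- pi] and [pi]. *)
Lemma polar_angle_inj (rho rho' t t' : R) : 0 < rho -> 0 < rho' ->
  0 <= t < 2 * pi -> 0 <= t' < 2 * pi ->
  rho * cos t = rho' * cos t' -> rho * sin t = rho' * sin t' -> t = t'.
Proof.
move=> r0 r0' /andP[t0 t1] /andP[t0' t1'] hc hs.
have rr : rho = rho'.
  apply/eqP; rewrite -(@eqrXn2 _ 2) ?(ltW r0) ?(ltW r0')//; apply/eqP.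
  rewrite -[LHS]mulr1 -(cos2Dsin2 t) -[RHS]mulr1 -(cos2Dsin2 t') !mulrDr -!exprMn hc hs//.
have rn0 : rho != 0 by rewrite gt_eqF.
have c : cos t = cos t' by apply: (mulfI rn0); rewrite hc rr.
have s : sin t = sin t' by apply: (mulfI rn0); rewrite hs rr.
have cos1 : cos (t - t') = 1 by rewrite cosB c s -!expr2 cos2Dsin2.
pose h := (t - t') / 2.
have sh : sin h = 0.
  have : cos (h *+ 2) = 1 by rewrite -mulr_natr /h divfK.
  rewrite cos_mulr2n cos2sin2 => e; apply/eqP; rewrite -sqrf_eq0; apply/eqP; move: e.
  by rewrite -mulr_natr; lra.
have sgn (x : R) : 0 < x < pi -> sin x != 0 by move=> /sin_gt0_pi /lt0r_neq0.
have [h0|h0|//] := ltgtP t t'.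
- have := sgn (- h); rewrite sinN sh oppr0 eqxx => /(_ _) e.
  by have := e (ltac:(apply/andP; split; rewrite /h; lra)).
- have := sgn h; rewrite sh eqxx => e.
  by have := e (ltac:(apply/andP; split; rewrite /h; lra)).
Qed.

Lemma sector_disjoint w n j k : 0 < w -> n%:R * w = 2 * pi -> (j < n)%N -> (k < n)%N ->
  sector w j `&` sector w k !=set0 -> j = k.
Proof.
move=> w0 nw jn kn [p [[rho [t [r0 /andP[t1 t2] x y]]] [rho' [t' [r0' /andP[t1' t2'] x' y']]]]].
have rng i s : (i < n)%N -> i%:R * w <= s -> s < i.+1%:R * w -> 0 <= s < 2 * pi.
  move=> ni is1 is2; apply/andP; split; first by apply: le_trans is1; rewrite mulr_ge0// ltW.
  by apply: lt_le_trans is2 _; rewrite -nw ler_pM2r// ler_nat.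
have tt : t = t'.
  apply: (polar_angle_inj r0 r0'); [exact: rng t1 t2|exact: rng t1' t2'|
    by rewrite -x|by rewrite -y].
have le_idx (a b : nat) : a%:R * w <= t -> t < b.+1%:R * w -> (a <= b)%N.
  by move=> ta tb; rewrite -ltnS -(ltr_nat R) -(ltr_pM2r w0); exact: le_lt_trans ta tb.
by apply/eqP; rewrite eqn_leq !le_idx// tt.
Qed.

Definition north : T := xget point [set p | [/\ cx p = 0, cy p = 0 & cz p = 1]].

Lemma northE : [/\ cx north = 0, cy north = 0 & cz north = 1].
Proof.
have [p _ hp] := @sphere_point_ex R 0 0 1 (ltac:(ring)).
exact: (@xgetI _ _ [set p | [/\ cx p = 0, cy p = 0 & cz p = 1]] p hp).
Qed.

Lemma sqr_dist_north p : dist p north ^+ 2 = 2 - 2 * cz p.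
Proof. by rewrite sqr_dist dot_coord; have [-> -> ->] := northE; ring. Qed.

(** The [n] sectors are disjoint, and rotations about the axis permute them while preserving the
    cap, so each gets at most a share [1 / n]. *)
Lemma rhausdorff_sector_cap w n k r : 0 < w <= pi / 2 -> n%:R * w = 2 * pi -> 0 <= r <= 2 ->
  n%:R * rhausdorff (sector w k `&` closed_cap north r) <= total / 4 * r ^+ 2.
Proof.
move=> w0 nw r02; have /andP[w0' _] := w0.
set C := closed_cap north r.
have same j : rhausdorff (sector w j `&` C) = rhausdorff (sector w 0 `&` C).
  rewrite sector_rotation -[C in LHS](@closed_cap_iso R (rotation (- (j%:R * w)))).
  have -> : rotation (- (j%:R * w)) north = north.
    have [x y z] := rotate_ptE (- (j%:R * w)) north; have [x0 y0 z0] := northE.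
    by apply: coord_inj; rewrite ?x ?y ?z ?x0 ?y0 ?z0; ring.
  by rewrite -preimage_setI /rhausdorff hausdorff_preimage_iso.
rewrite same -(rhausdorff_closed_cap north r02) -/C.
(* What remains of the cap once the first [m] sectors are removed; measurability of a sector allows
   them to be peeled off one by one. *)
pose X m := C `&` [set p | forall j, (j < m)%N -> ~ sector w j p].
suff : forall m, (m <= n)%N ->
    m%:R * rhausdorff (sector w 0 `&` C) + rhausdorff (X m) <= rhausdorff C.
  by move=> /(_ n (leqnn n)); have := rhausdorff_ge0 (X n); lra.
elim=> [_|m IH mn]; first by rewrite mul0r add0r le_rhausdorff// => p [].
have := IH (ltnW mn).
suff -> : rhausdorff (X m) = rhausdorff (sector w m `&` C) + rhausdorff (X m.+1).
  by rewrite same -natr1; lra.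
apply: EFin_inj; rewrite EFinD -!rhausdorffE (measurable_sector m w0 (X m)).
congr (mu _ + mu _)%E.
  apply/seteqP; split=> p; first by move=> [[]].
  move=> [sp Cp]; split=> //; split=> // j jm sj.
  have := sector_disjoint w0' nw (ltn_trans jm mn) mn (ex_intro _ p (conj sj sp)).
  by move=> jm'; rewrite jm' ltnn in jm.
apply/seteqP; split=> p.
  move=> [[Cp sp] ns]; split=> // j; rewrite ltnS leq_eqVlt => /predU1P[->//|]; exact: sp.
by move=> [Cp sp]; split; [split=> // j jm; apply: sp; rewrite ltnS ltnW|apply: sp].
Qed.

End sectors.

(** * Small sets in a half sphere, in polar coordinates about the pole *)

Section isodiametric.
Context {R : realType}.
Local Notation T := (sphere_point R).
Local Notation mu := (sphere_hausdorff R).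
Local Notation diam := (diam (@dist R)).
Local Notation disc_area := (disc_area (@dist R)).
Implicit Types (p q : T) (A : set T) (d : R) (N k : nat).

(** There are [N] sectors to a right angle, so sector [k + N] is sector [k] after a quarter turn. *)
Definition sector_angle N : R := pi / (2 * N%:R).

Lemma sector_angleE N : (0 < N)%N -> N%:R * sector_angle N = pi / 2.
Proof. by move=> N0; rewrite /sector_angle; field; rewrite pnatr_eq0 -lt0n. Qed.

Lemma sector_angle_gt0 N : (0 < N)%N -> 0 < sector_angle N.
Proof. by move=> N0; rewrite divr_gt0 ?pi_gt0// mulr_gt0// ltr0n. Qed.

Lemma sector_angle_le N : (0 < N)%N -> sector_angle N <= pi / 2.
Proof.
move=> N0; rewrite -(sector_angleE N0) ler_peMl ?(ltW (sector_angle_gt0 N0))//.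
by rewrite -[1]/(1%:R) ler_nat.
Qed.

(* Spherical Pythagoras: for points at squared chordal distances [a] and [b]
   from the pole in orthogonal directions, their squared distance is
   [a + b - a b / 2]. *)
Lemma sector_pair_bound N k p q d : (0 < N)%N -> 
  sin (sector_angle N) + d ^+ 2 / 4 < 1 ->
  sector (sector_angle N) k p -> sector (sector_angle N) (k + N) q -> 
  dist p q ^+ 2 <= d ^+ 2 -> 2 - 2 * cz p <= d ^+ 2 -> 2 - 2 * cz q <= d ^+ 2 ->
  (2 - 2 * cz p) + (2 - 2 * cz q) <= d ^+ 2 / (1 - sin (sector_angle N) - d ^+ 2 / 4).
Proof.
move=> N0 small [rho [t [r0 /andP[t1 t2] x y]]] [rho' [t' [r0' /andP[t1' t2'] x' y']]].
have w0 := sector_angle_gt0 N0; have wpi := sector_angle_le N0; have wN := sector_angleE N0.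
set w := sector_angle N in small t1 t2 t1' t2' w0 wpi wN *.
(* The two angles differ by [pi / 2] up to less than [w]. *)
have cosle : cos (t' - t) <= sin w.
  have -> : cos (t' - t) = sin (pi / 2 - (t' - t)).
    by rewrite -[LHS]cosN -sinDpihalf; congr sin; ring.
  have kN : (k + N)%:R * w = k%:R * w + pi / 2 by rewrite natrD mulrDl wN.
  have kS i : i.+1%:R * w = i%:R * w + w by rewrite -natr1 mulrDl mul1r.
  move: t1' t2' t2; rewrite kN !kS kN => t1' t2' t2.
  have mem (v : R) : - (pi / 2) <= v -> v <= pi / 2 -> v \in `[- (pi / 2), pi / 2].
    by move=> ? ?; rewrite in_itv; apply/andP.
  have sin_mono (u v : R) : - (pi / 2) <= u -> v <= pi / 2 -> u < v -> sin u < sin v.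
    by move=> u1 v1 uv; rewrite ltr_sin//; apply: mem => //; lra.
  by apply/ltW/sin_mono; lra.
have sw : 0 <= sin w by rewrite sin_ge0_pi//; apply/andP; split; have := pi_gt0 R; lra.
rewrite sqr_dist dot_coord x y x' y'.
have -> : rho * cos t * (rho' * cos t') + rho * sin t * (rho' * sin t') =
   rho * rho' * cos (t' - t) by rewrite cosB; ring.
have hp := sphere_eq p; have hq := sphere_eq q.
have rz : rho ^+ 2 = 1 - cz p ^+ 2.
  rewrite -hp x y -[LHS]mulr1 -(cos2Dsin2 t); ring.
have rz' : rho' ^+ 2 = 1 - cz q ^+ 2.
  rewrite -hq x' y' -[LHS]mulr1 -(cos2Dsin2 t'); ring.
have /andP[_ z1] := cz_itv p; have /andP[_ z1'] := cz_itv q.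
set z := cz p in rz z1 *; set z' := cz q in rz' z1' *.
move=> dd ad bd.
have rr : rho * rho' * cos (t' - t) <= rho * rho' * sin w.
  by rewrite ler_pM2l// mulr_gt0.
(* Combines [2 rho rho' <= rho^2 + rho'^2] with [1 - z^2 <= 2 - 2 z]. *)
have rr2 : rho * rho' * sin w <= ((2 - 2 * z) + (2 - 2 * z')) / 2 * sin w.
  rewrite ler_wpM2r//; have := sqr_ge0 (rho - rho'); have := sqr_ge0 (1 - z).
  have := sqr_ge0 (1 - z'); rewrite !sqrrB rz rz'; lra.
(* Averaging the next two bounds gives [a b / 2 <= (a + b) d^2 / 4], with [a] and [b] the squared
   distances to the pole. *)
have ab : (2 - 2 * z) * (2 - 2 * z') <= (2 - 2 * z) * d ^+ 2 by rewrite ler_wpM2l//; lra.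
have ab' : (2 - 2 * z) * (2 - 2 * z') <= (2 - 2 * z') * d ^+ 2.
  by rewrite mulrC ler_wpM2l//; lra.
rewrite ler_pdivlMr; last by lra.
lra.
Qed.

(* The polar-coordinate proof of the isodiametric inequality, discretised:
   [A] is covered by caps of the [2 N + 1] sectors of the half sphere, and the
   sectors [k] and [k + N] are nearly orthogonal. *)
Lemma half_cap_bound N A d : (1 < N)%N -> 0 <= d <= 1 ->
  sin (sector_angle N) + d ^+ 2 / 4 < 1 ->
  (forall p, A p -> 0 <= cy p) -> (forall p, A p -> dist p north <= d) ->
  (forall p q, A p -> A q -> dist p q <= d) ->
  rhausdorff A <= total / 16 * d ^+ 2 * ((1 - sin (sector_angle N) - d ^+ 2 / 4)^-1 + N%:R^-1).
Proof.
move=> N1 /andP[d0 d1] small Ay Ad AA.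
have N0 : (0 < N)%N by exact: ltnW.
have w0 := sector_angle_gt0 N0; have wpi := sector_angle_le N0; have wN := sector_angleE N0.
have Nr0 : 0 < N%:R :> R by rewrite ltr0n.
set w := sector_angle N in small w0 wpi wN *.
pose c p : R := 2 - 2 * cz p.
have cE p : c p = dist p north ^+ 2 by rewrite sqr_dist_north.
have cd p : A p -> c p <= d ^+ 2.
  by move=> /Ad h; rewrite cE ler_pXn2r// nnegrE dist_ge0.
pose V k := [set c p | p in A `&` sector w k].
(* Squared chordal radius of the part of [A] in sector [k], equal to 0 for an empty part by the
   default value of [sup]. *)
pose r k := sup (V k).
have Vub k : has_ubound (V k) by exists (d ^+ 2) => _ [p [Ap _] <-]; exact: cd.
have cr k p : A p -> sector w k p -> c p <= r k.
  by move=> Ap sp; apply: ub_le_sup => //; exists p.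
have rle k x : 0 <= x -> (forall p, A p -> sector w k p -> c p <= x) -> r k <= x.
  move=> x0 h; have [V0|/set0P V0] := eqVneq (V k) set0; first by rewrite /r V0 sup0.
  by apply: ge_sup => // _ [p [Ap sp] <-]; exact: h.
have rd k : r k <= d ^+ 2 by apply: (rle _ _) => [|p Ap _]; [exact: sqr_ge0|exact: cd].
have r_ge0 k : 0 <= r k.
  have [V0|/set0P [x [p [Ap sp] _]]] := eqVneq (V k) set0; first by rewrite /r V0 sup0.
  by apply: le_trans (cr _ _ Ap sp); rewrite cE sqr_ge0.
pose C := d ^+ 2 / (1 - sin w - d ^+ 2 / 4).
have sw : 0 <= sin w by rewrite sin_ge0_pi//; apply/andP; split; have := pi_gt0 R; lra.
have dC : d ^+ 2 <= C.
  rewrite /C ler_pdivlMr; last by lra.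
  have : 0 <= d ^+ 2 * sin w by rewrite mulr_ge0// sqr_ge0.
  by have := sqr_ge0 (d ^+ 2); rewrite [(d ^+ 2) ^+ 2]expr2; lra.
have rpair k : r k + r (k + N)%N <= C.
  rewrite -lerBrDr; apply: (rle _ _) => [|p Ap sp]; first by rewrite subr_ge0 (le_trans (rd _)).
  rewrite lerBrDr addrC -lerBrDr; apply: (rle _ _) => [|q Aq sq].
    by rewrite subr_ge0 (le_trans (cd _ Ap)).
  rewrite lerBrDr addrC; apply: (sector_pair_bound N0 small sp sq); [|exact: cd|exact: cd].
  by rewrite ler_pXn2r ?nnegrE ?dist_ge0//; exact: AA.
(* The first [2 N] sectors pair up as [k] and [k + N]. The last one, needed for the angle [pi],
   costs [d^2] and is the source of the term [1 / N] in the bound. *)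
have sumr : \sum_(k < (N + N).+1) r k <= N%:R * C + d ^+ 2.
  rewrite big_ord_recr /= lerD// big_split_ord /= -big_split /=.
  apply: (@le_trans _ _ (\sum_(k < N) C)); last by rewrite sumr_const card_ord mulr_natl.
  by apply: ler_sum => k _; rewrite (addnC N).
pose D k := sector w k `&` closed_cap north (Num.sqrt (r k)).
have Acover : A `<=` [set north] `|` \big[setU/set0]_(k < (N + N).+1) D k.
  move=> p Ap; have [xy0|xy0] := leP (cx p ^+ 2 + cy p ^+ 2) 0.
    left; have h := sphere_eq p; have [nx ny nz] := @northE R.
    have [x0 y0] : cx p = 0 /\ cy p = 0 by split; nra.
    rewrite /=; apply: coord_inj; rewrite ?x0 ?y0 ?nx ?ny ?nz//.
    (* The south pole is excluded: its squared distance to [north] is 4. *)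
    have := cd _ Ap; rewrite /c => cp; have : d ^+ 2 <= 1 by rewrite exprn_ile1.
    by move: h; rewrite x0 y0; nra.
  right; have [rho [t [r0 /andP[t0 tpi] x y]]] := polar_upper (Ay _ Ap) xy0.
  have tw0 : 0 <= t / w by rewrite divr_ge0// ltW.
  have /andP[k1 k2] := truncn_itv tw0; set k := Num.truncn _ in k1 k2.
  have sk : sector w k p.
    by exists rho, t; split=> //; rewrite -ler_pdivlMr// -ltr_pdivrMr// k1.
  rewrite -(bigcup_mkord _ D); exists k => /=.
    rewrite ltnS -(ler_nat R) natrD; apply: le_trans k1 _; rewrite ler_pdivrMr//.
    by rewrite mulrDl wN; lra.
  split=> //; rewrite /closed_cap /= -(@ler_pXn2r _ 2) ?nnegrE ?sqrtr_ge0 ?dist_ge0//.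
  by rewrite [leRHS]sqr_sqrtr// -cE cr.
have hD k : rhausdorff (D k) <= total / 16 / N%:R * r k.
  have wpi' : 0 < w <= pi / 2 by rewrite w0.
  have nw : (4 * N)%:R * w = 2 * pi by rewrite natrM -mulrA wN; field.
  have sr : 0 <= Num.sqrt (r k) <= 2.
    rewrite sqrtr_ge0/= -(@ler_pXn2r _ 2) ?nnegrE ?sqrtr_ge0// sqr_sqrtr//.
    apply: le_trans (rd k) _; have h1 : d ^+ 2 <= 1 by rewrite exprn_ile1.
    by apply: le_trans h1 _; rewrite expr_ge1 ?ler1n.
  have := rhausdorff_sector_cap k wpi' nw sr; rewrite sqr_sqrtr// -/(D k) natrM => h.
  rewrite mulrAC ler_pdivlMr//; lra.
apply: (@le_trans _ _ (\sum_(k < (N + N).+1) rhausdorff (D k))).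
  rewrite -lee_fin -rhausdorffE -sumEFin.
  apply: le_trans (le_outer_measure mu _ _ Acover) _.
  apply: le_trans (outer_measureU2 _ _ _) _; rewrite hausdorff_point add0e.
  apply: le_trans (outer_measure_subadditive _ _ _) _.
  by apply: lee_sum => k _; rewrite rhausdorffE.
apply: (@le_trans _ _ (\sum_(k < (N + N).+1) total / 16 / N%:R * r k)).
  by apply: ler_sum => k _; exact: hD.
have T0 := @total_gt0 R.
rewrite -mulr_sumr; apply: (@le_trans _ _ (total / 16 / N%:R * (N%:R * C + d ^+ 2))).
  by rewrite ler_wpM2l// !divr_ge0// ltW.
rewrite le_eqVlt; apply/orP; left; apply/eqP; rewrite /C.
by field; rewrite !gt_eqF//; lra.
Qed.

End isodiametric.

(** * The isodiametric inequality and the value of the area *)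

Section lower_bound.
Context {R : realType}.
Local Notation T := (sphere_point R).
Local Notation mu := (sphere_hausdorff R).
Local Notation diam := (diam (@dist R)).
Local Notation disc_area := (disc_area (@dist R)).
Implicit Types (p q : T) (A : set T) (d e : R) (N k : nat).

(* [A] lies on one side of a great circle through a point near [A]: rotate a
   meridian until it first meets [A]. *)
Lemma half_space_position A d e : A !=set0 -> 0 < e -> d <= 1 ->
  (forall p q, A p -> A q -> dist p q <= d) ->
  exists g : isometry R, (forall p, A p -> 0 <= cy (g p)) /\
    (forall p, A p -> dist (g p) north <= d + e).
Proof.
move=> [a Aa] e0 d1 AA.
(* With a point of [A] moved to [(1, 0, 0)] and [d <= 1], all of [A] has [x >= 1/2], so the slope
   [y / x] is defined and bounded below. *)
have [E _ [Ex Ey Ez]] := @sphere_point_ex R 1 0 0 (ltac:(ring)).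
have [h ha] := iso_to_point a E.
have cxh p : A p -> 1 / 2 <= cx (h p).
  move=> Ap; have : dist (h p) E <= 1 by rewrite -ha iso_dist (le_trans (AA _ _ Ap Aa)).
  by rewrite dist_le// dot_coord Ex Ey Ez; lra.
have cx0 p : A p -> 0 < cx (h p) by move=> /cxh; lra.
have cyN1 p : -1 <= cy (h p).
  suff : `|cy (h p)| <= 1 by rewrite ler_norml => /andP[].
  by apply: (@sumsq1_le1 _ _ (cx (h p)) (cz (h p))); rewrite -(sphere_eq (h p)); ring.
pose slope p : R := cy (h p) / cx (h p).
pose S := [set slope p | p in A].
have Sinf : has_inf S.
  split; first by exists (slope a), a.
  exists (- 2) => _ [p Ap <-]; rewrite /slope ler_pdivlMr ?cx0//.
  by have := cxh _ Ap; have := cyN1 p; lra.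
pose m := inf S.
pose e' := Num.min (e / 2) (1 / 2).
have e'0 : 0 < e' by rewrite lt_min !divr_gt0.
have e'e : 2 * e' <= e.
  by have h1 : e' <= e / 2; [rewrite ge_min lexx|lra].
have e'1 : e' <= 1 / 2 by rewrite ge_min lexx orbT.
(* The least slope need not be attained. The point [p'] nearly attains it, hence is close to the
   bounding plane [y = m x]; this is the reason for [e] in the conclusion. *)
have [_ [p' Ap' <-] p'm] := inf_adherent e'0 Sinf.
pose c := Num.sqrt (1 + m ^+ 2).
have c2 : c ^+ 2 = 1 + m ^+ 2 by rewrite sqr_sqrtr// addr_ge0// sqr_ge0.
have c0 : 0 < c by rewrite sqrtr_gt0; have := sqr_ge0 m; lra.
have c1 : 1 <= c.
  by rewrite -(@ler_pXn2r _ 2)// ?nnegrE ?(ltW c0)// c2 expr1n lerDl sqr_ge0.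
pose n := row3 (- m / c) (c^-1) 0.
have nn : dot n n = 1.
  rewrite dot_row33 (_ : _ + _ + _ = (1 + m ^+ 2) / c ^+ 2); last by field; rewrite gt_eqF.
  by rewrite -c2 divff// expf_neq0// gt_eqF.
have dotn q : dot (sval q) n = (cy q - m * cx q) / c.
  by rewrite dot_row3 /cx /cy; field; rewrite gt_eqF.
have dotn_ge0 p : A p -> 0 <= dot (sval (h p)) n.
  move=> Ap; rewrite dotn divr_ge0 ?(ltW c0)// subr_ge0 -ler_pdivlMr ?cx0//.
  by apply: ge_inf; [case: Sinf|exists p].
pose s := dot (sval (h p')) n.
have s0 : 0 <= s by exact: dotn_ge0.
have se : s <= e'.
  rewrite /s dotn ler_pdivrMr//.
  have h1 : cy (h p') - m * cx (h p') <= e' * cx (h p').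
    have : cy (h p') = slope p' * cx (h p') by rewrite /slope divfK// gt_eqF// cx0.
    move=> ->; rewrite -mulrBl ler_wpM2r ?(ltW (cx0 _ Ap'))//.
    by have : slope p' < m + e' := p'm; lra.
  apply: le_trans h1 _; rewrite ler_wpM2l ?(ltW e'0)//; apply: le_trans c1.
  have : `|cx (h p')| <= 1.
    by apply: (@sumsq1_le1 _ _ (cy (h p')) (cz (h p'))); exact: sphere_eq.
  by rewrite ler_norml => /andP[].
(* The projection of [h p'] onto the bounding plane, rescaled to the sphere as [p0] below. *)
pose v := sval (h p') - s *: n.
have s1 : s ^+ 2 <= 1 / 4.
  have : s ^+ 2 <= (1 / 2) ^+ 2 by rewrite ler_pXn2r ?nnegrE ?divr_ge0// (le_trans se).
  by lra.
have vv : dot v v = 1 - s ^+ 2.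
  by rewrite /v !dot_lin nn (dotC n) dot_sphere -/s; ring.
have vn : dot v n = 0 by rewrite /v !dot_lin nn -/s; ring.
pose b := Num.sqrt (1 - s ^+ 2).
have b0 : 0 < b by rewrite sqrtr_gt0; lra.
have b2 : b ^+ 2 = 1 - s ^+ 2 by rewrite sqr_sqrtr//; lra.
have p0P : dot (b^-1 *: v) (b^-1 *: v) == 1.
  by apply/eqP; rewrite dotZl dotZr vv -b2; field; rewrite gt_eqF.
pose p0 : T := exist (fun v : 'rV_3 => is_true (dot v v == 1)) _ p0P.
have p0n : dot (sval p0) n = 0 by rewrite /= dotZl vn mulr0.
have p'p0 : dist (h p') p0 <= e.
  apply: le_trans e'e; rewrite -(@ler_pXn2r _ 2)// ?nnegrE ?dist_ge0 ?mulr_ge0 ?(ltW e'0)//.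
  rewrite sqr_dist /= dotZr.
  have -> : dot (sval (h p')) v = b ^+ 2.
    by rewrite b2 /v !dot_lin dot_sphere -/s; ring.
  have -> : b^-1 * b ^+ 2 = b by field; rewrite gt_eqF.
  have bb : b ^+ 2 <= b.
    rewrite expr2 ler_piMl ?(ltW b0)// -(@ler_pXn2r _ 2)// ?nnegrE ?(ltW b0)//.
    by rewrite b2 expr1n; have := sqr_ge0 s; lra.
  have : s ^+ 2 <= e' ^+ 2 by rewrite ler_pXn2r ?nnegrE// ltW.
  by have := sqr_ge0 e'; lra.
(* One reflection sends [p0] to the pole; a second one fixes the pole and exchanges the transported
   normal [n1] with the [y] axis. *)
pose w1 := sval p0 - sval (@north R); pose n1 := householder w1 n.
have [nx ny nz] := @northE R.
have w1p0 : householder w1 (sval p0) = sval (@north R).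
  by rewrite householder_swap// !dot_sphere.
have n1n1 : dot n1 n1 = 1 by rewrite dot_householder.
have n1north : dot (sval (@north R)) n1 = 0 by rewrite -w1p0 dot_householder.
pose e2 : 'rV[R]_3 := row3 0 1 0.
have e2e2 : dot e2 e2 = 1 by rewrite dot_row33; ring.
pose w2 := n1 - e2.
have w2n : householder w2 (sval (@north R)) = sval (@north R).
  by apply: householder_orth; rewrite dotBr n1north dot_row3 -/(cy _) ny; ring.
have w2e : householder w2 e2 = n1.
  by rewrite -[RHS](householderK w2) householder_swap// n1n1.
exists (iso_comp (reflection w2) (iso_comp (reflection w1) h)); split=> p Ap.
  rewrite cyE /= -/e2 -[e2](householderK w2) dot_householder w2e dot_householder.
  exact: dotn_ge0.
have -> : @north R = reflection w2 (reflection w1 p0).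
  by apply/eqP; rewrite -val_eqE /= w1p0 w2n.
have : dist (h p) p0 <= d + e.
  apply: le_trans (dist_triangle (h p') _ _) _; rewrite iso_dist lerD//.
  exact: AA.
by rewrite -(iso_dist (reflection w1)) -(iso_dist (reflection w2)).
Qed.

Lemma small_angle e : 0 < e -> exists N, [/\ (1 < N)%N, N%:R^-1 <= e &
  sin (sector_angle N) <= e :> R].
Proof.
move=> e0; have := @continuous_sin R 0; rewrite /continuous_at sin0.
move=> /cvgrPdist_lt /(_ _ e0) [x /= x0 hx].
pose M := Num.max (e^-1) (pi / x).
pose N := (Num.truncn M).+2.
have M0 : 0 <= M by rewrite le_max invr_ge0 ltW.
have MN : M <= N%:R.
  by have /andP[_ /ltW h] := truncn_itv M0; apply: le_trans h _; rewrite ler_nat.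
have N0 : 0 < N%:R :> R by rewrite ltr0n.
exists N; split=> //.
  rewrite invf_ple ?posrE//; apply: le_trans MN; by rewrite le_max lexx.
have : `|0 - sin (sector_angle N)| < e.
  apply: hx => /=; rewrite /sector_angle sub0r normrN ger0_norm ?divr_ge0 ?pi_ge0//;
    rewrite ?mulr_ge0 ?(ltW N0)//.
  rewrite ltr_pdivrMr ?mulr_gt0//; apply: (@lt_le_trans _ _ (x * (2 * M))).
    have : pi / x <= M by rewrite le_max lexx orbT.
    by rewrite ler_pdivrMr// => h; have := pi_gt0 R; lra.
  by rewrite ler_wpM2l ?(ltW x0)// ler_wpM2l.
by rewrite sub0r normrN => /ltW; apply: le_trans; exact: ler_norm.
Qed.

(** The half sphere bound applies to a copy of [A] within [d + x] of the pole, and then [x] tends to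
    0. With [d + x <= e / 2] and with [sin w] and [1 / N] at most [e / 8], the bracket in that bound
    is at most [1 + e / 2 + e / 8]. *)
Lemma isodiametric e : 0 < e -> e <= 1 -> exists2 d0, 0 < d0 &
  forall A d, 0 <= d <= d0 -> (forall p q, A p -> A q -> dist p q <= d) ->
    rhausdorff A <= total / 16 * (1 + e) * d ^+ 2.
Proof.
move=> e0 e1; have T0 := @total_gt0 R.
have [N [N1 Ne se]] := @small_angle (e / 8) (divr_gt0 e0 (ltr0n _ 8)).
exists (e / 4); first by rewrite divr_gt0.
move=> A d /andP[d0 de] AA.
have [->|/set0P A0] := eqVneq A set0.
  by rewrite /rhausdorff outer_measure0 !mulr_ge0 ?sqr_ge0 ?divr_ge0 ?addr_ge0// ltW.
have main x : 0 < x -> x <= e / 4 -> rhausdorff A <= total / 16 * (1 + e) * (d + x) ^+ 2.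
  move=> x0 xe; have d1 : d <= 1 by lra.
  have [g [gy gn]] := half_space_position A0 x0 d1 AA.
  have dx : d + x <= e / 2 by lra.
  have dx0 : 0 <= d + x by lra.
  have dx2 : (d + x) ^+ 2 <= e / 4.
    apply: (@le_trans _ _ ((e / 2) ^+ 2)); first by rewrite ler_pXn2r ?nnegrE//; lra.
    have : e ^+ 2 <= e by rewrite expr2 ler_piMl// ltW.
    lra.
  apply: (@le_trans _ _ (rhausdorff (g @` A))).
    have -> : rhausdorff (g @` A) = rhausdorff (g @^-1` (g @` A)).
      by rewrite /rhausdorff hausdorff_preimage_iso.
    apply: le_rhausdorff.
    by move=> p Ap; exists p.
  apply: le_trans (half_cap_bound (d := d + x) N1 _ _ _ _ _) _.
  - by rewrite dx0/=; lra.
  - lra.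
  - by move=> _ [p Ap <-]; exact: gy.
  - by move=> _ [p Ap <-]; exact: gn.
  - by move=> _ _ [p Ap <-] [q Aq <-]; rewrite iso_dist; apply: le_trans (AA _ _ Ap Aq) _; lra.
  rewrite [leRHS](mulrAC _ (1 + e)) ler_wpM2l//.
    by rewrite mulr_ge0 ?sqr_ge0// divr_ge0// ltW.
  set t := sin _ in se *.
  have t1 : 0 < 1 - t - (d + x) ^+ 2 / 4 by lra.
  have : (1 - t - (d + x) ^+ 2 / 4)^-1 <= 1 + e / 2.
    rewrite -[leLHS]mul1r ler_pdivrMr//.
    apply: (@le_trans _ _ ((1 + e / 2) * (1 - 3 / 16 * e))); last first.
      by rewrite ler_wpM2l//; lra.
    have : e ^+ 2 <= e by rewrite expr2 ler_piMl// ltW.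
    lra.
  lra.
apply/ler_addgt0Pr => y y0.
have K0 : 0 < total / 16 * (1 + e) by rewrite mulr_gt0 ?divr_gt0//; lra.
pose x := Num.min (e / 4) (y / (total / 16 * (1 + e) * 3)).
have x0 : 0 < x by rewrite lt_min !divr_gt0//; apply: mulr_gt0.
have xe : x <= e / 4 by rewrite ge_min lexx.
apply: le_trans (main x x0 xe) _.
have xy : total / 16 * (1 + e) * (3 * x) <= y.
  have K3 : 0 < total / 16 * (1 + e) * 3 by apply: mulr_gt0.
  by rewrite mulrA mulrC -ler_pdivlMr// ge_min lexx orbT.
apply: (@le_trans _ _ (total / 16 * (1 + e) * (d ^+ 2 + 3 * x))); last first.
  by rewrite mulrDr lerD2l.
rewrite ler_wpM2l ?(ltW K0)// sqrrD -addrA lerD2l.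
have : d * x <= 1 * x by rewrite ler_wpM2r ?(ltW x0)//; lra.
have : x ^+ 2 <= 1 * x by rewrite expr2 ler_wpM2r ?(ltW x0)//; lra.
by rewrite mulr2n; lra.
Qed.

(** A small covering set measures at most [total * (1 + e) / (4 pi)] times its disc area. Summing
    over a cover bounds [total] by that factor times the total disc area; [total] cancels, and every
    fine cover costs at least [4 pi / (1 + e)]. *)
Lemma total_ge : 4 * pi <= total :> R.
Proof.
have T0 := @total_gt0 R; have P0 := pi_gt0 R.
have key e : 0 < e -> e <= 1 -> 4 * pi <= total * (1 + e).
  move=> e0 e1; have [d d0 iso] := isodiametric e0 e1.
  have e10 : 0 < 1 + e by lra.
  rewrite -ler_pdivrMr// -lee_fin -totalE.
  apply: (hausdorff_ge d0) => U Ud UT.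
  pose c : R := 4 * pi / (total * (1 + e)).
  have c0 : 0 <= c by rewrite divr_ge0 ?mulr_ge0 ?ltW.
  have -> : 4 * pi / (1 + e) = c * total.
    by rewrite /c; field; rewrite !gt_eqF.
  have hU : (mu setT <= \sum_(k <oo) mu (U k))%E.
    apply: le_trans (outer_measure_sigma_subadditive mu U).
    exact: le_outer_measure.
  rewrite EFinM -totalE; apply: (@le_trans _ _ (c%:E * \sum_(k <oo) mu (U k))%E).
    by apply: lee_pmul => //; rewrite ?lee_fin.
  rewrite -nneseriesZl => [|k _]; last by [].
  apply: lee_nneseries => [k _ _|k _]; first by rewrite mule_ge0// lee_fin.
  rewrite rhausdorffE disc_areaE -EFinM lee_fin.
  have := iso (U k) (rdiam (U k)); rewrite rdiam_ge0/= => /(_ _ (@dist_le_rdiam R (U k))) h.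
  have {}h : rhausdorff (U k) <= total / 16 * (1 + e) * rdiam (U k) ^+ 2.
    by apply: h; rewrite -lee_fin -diamE.
  apply: le_trans (ler_wpM2l c0 h) _; rewrite le_eqVlt; apply/orP; left; apply/eqP.
  by rewrite /c; field; rewrite !gt_eqF.
apply/ler_addgt0Pr => y y0.
pose e := Num.min 1 (y / total).
have e0 : 0 < e by rewrite lt_min ltr01 divr_gt0.
have e1 : e <= 1 by rewrite ge_min lexx.
apply: le_trans (key e e0 e1) _; rewrite mulrDr mulr1 lerD2l mulrC -ler_pdivlMr//.
by rewrite ge_min lexx orbT.
Qed.

Lemma sphere_area : total = 4 * pi :> R.
Proof. by apply/eqP; rewrite eq_le total_le total_ge. Qed.

End lower_bound.

(** * The mean field and the energy *)

Section mean_field_theory.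
Context {R : realType}.
Local Notation mu := (sphere_hausdorff R).
Implicit Types (f g : S2 R -> R) (p q : S2 R) (eta a : R).

Lemma integral_bmeas f : bmeas f -> (\int[area]_p (f p)%:E = (intS f)%:E)%E.
Proof.
move=> bf; rewrite /intS /Rintegral fineK//.
exact: (integrable_fin_num measurableT (bmeas_integrable bf)).
Qed.

Lemma eq_intS f g : f =1 g -> intS f = intS g.
Proof. by move=> /funext ->. Qed.

Lemma intS_antisym (h : isometry R) f : bmeas f -> (forall p, f (h p) = - f p) -> intS f = 0.
Proof.
move=> bf hf; have := intS_iso h bf.
rewrite (eq_intS (g := fun p => -1 * f p)); last by move=> p; rewrite hf mulN1r.
by rewrite (intSZ _ bf); lra.
Qed.

Lemma intS_z2 : intS (fun p => cz p ^+ 2) = total / 3.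
Proof. by have := even_momentE (R := R) 1; rewrite /even_moment. Qed.

Lemma intS_z4 : intS (fun p => cz p ^+ 4) = total / 5.
Proof. by have := even_momentE (R := R) 2; rewrite /even_moment. Qed.

Lemma intS_z2y2 : intS (fun p => cz p ^+ 2 * cy p ^+ 2) = total / 15.
Proof.
have h : 3 * intS (fun p => cz p ^+ 2 * cy p ^+ 2) = total / 5.
  by rewrite -[RHS](even_momentE 2); exact: (mixed_moment 1).
by lra.
Qed.

Lemma bmeas_z2 : bmeas (fun p : S2 R => cz p ^+ 2). Proof. exact: bmeasX bmeas_cz. Qed.
Lemma bmeas_y2 : bmeas (fun p : S2 R => cy p ^+ 2). Proof. exact: bmeasX bmeas_cy. Qed.
Lemma bmeas_x2 : bmeas (fun p : S2 R => cx p ^+ 2). Proof. exact: bmeasX bmeas_cx. Qed.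
Lemma bmeas_xy : bmeas (fun p : S2 R => cx p * cy p). Proof. exact: bmeasM bmeas_cx bmeas_cy. Qed.
Lemma bmeas_xz : bmeas (fun p : S2 R => cx p * cz p). Proof. exact: bmeasM bmeas_cx bmeas_cz. Qed.
Lemma bmeas_yz : bmeas (fun p : S2 R => cy p * cz p). Proof. exact: bmeasM bmeas_cy bmeas_cz. Qed.

Lemma intS_y2 : intS (fun p => cy p ^+ 2) = total / 3.
Proof.
have [h hp] := @iso_coord_swapyz R; rewrite -intS_z2 -(intS_iso h bmeas_z2).
by apply: eq_intS => p; have [_ _ ->] := hp p.
Qed.

Lemma intS_x2 : intS (fun p => cx p ^+ 2) = total / 3.
Proof.
have [h hp] := @iso_coord_swap R; rewrite -intS_y2 -(intS_iso h bmeas_y2).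
by apply: eq_intS => p; have [_ -> _] := hp p.
Qed.

Lemma intS_z2x2 : intS (fun p => cz p ^+ 2 * cx p ^+ 2) = total / 15.
Proof.
have [h hp] := @iso_coord_swap R.
rewrite -intS_z2y2 -(intS_iso h (bmeasM bmeas_z2 bmeas_y2)).
by apply: eq_intS => p; have [_ -> ->] := hp p.
Qed.

Lemma intS_xy : intS (fun p => cx p * cy p) = 0.
Proof.
have [h hp] := @iso_coord_negx R; apply: (intS_antisym (h := h) bmeas_xy) => p.
by have [-> -> _] := hp p; rewrite mulNr.
Qed.

Lemma intS_xz : intS (fun p => cx p * cz p) = 0.
Proof.
have [h hp] := @iso_coord_negx R; apply: (intS_antisym (h := h) bmeas_xz) => p.
by have [-> _ ->] := hp p; rewrite mulNr.
Qed.

Lemma intS_yz : intS (fun p => cy p * cz p) = 0.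
Proof.
have [h hp] := @iso_coord_negz R; apply: (intS_antisym (h := h) bmeas_yz) => p.
by have [_ -> ->] := hp p; rewrite mulrN.
Qed.

Lemma mean_fieldE eta g p :
  mean_field eta g p = intS (fun q => (dot (sval p) (sval q) ^+ 2 - 3^-1) * g q) - eta.
Proof. by []. Qed.

Section combination.
Variables (F1 F2 F3 F4 F5 F6 : S2 R -> R) (c1 c2 c3 c4 c5 c6 : R).
Hypothesis (b1 : bmeas F1) (b2 : bmeas F2) (b3 : bmeas F3).
Hypothesis (b4 : bmeas F4) (b5 : bmeas F5) (b6 : bmeas F6).

Let b12 := bmeasD (bmeasZ c1 b1) (bmeasZ c2 b2).
Let b123 := bmeasD b12 (bmeasZ c3 b3).
Let b1234 := bmeasD b123 (bmeasZ c4 b4).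
Let b12345 := bmeasD b1234 (bmeasZ c5 b5).

Lemma bmeas_comb6 : bmeas (fun p => c1 * F1 p + c2 * F2 p + c3 * F3 p + c4 * F4 p +
  c5 * F5 p + c6 * F6 p).
Proof. exact: bmeasD b12345 (bmeasZ c6 b6). Qed.

Lemma intS_comb6 : intS (fun p => c1 * F1 p + c2 * F2 p + c3 * F3 p + c4 * F4 p +
  c5 * F5 p + c6 * F6 p) = c1 * intS F1 + c2 * intS F2 + c3 * intS F3 +
  c4 * intS F4 + c5 * intS F5 + c6 * intS F6.
Proof.
rewrite (intSD b12345 (bmeasZ c6 b6)) (intSD b1234 (bmeasZ c5 b5)).
rewrite (intSD b123 (bmeasZ c4 b4)) (intSD b12 (bmeasZ c3 b3)).
rewrite (intSD (bmeasZ c1 b1) (bmeasZ c2 b2)).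
by rewrite (intSZ _ b1) (intSZ _ b2) (intSZ _ b3) (intSZ _ b4) (intSZ _ b5) (intSZ _ b6).
Qed.

End combination.

(** Shows the mean field to be a quadratic polynomial in [p], with the second moments of [g] as
    coefficients. *)
Lemma intS_dot2 g p : bmeas g ->
  intS (fun q => dot (sval p) (sval q) ^+ 2 * g q) =
  cx p ^+ 2 * intS (fun q => cx q ^+ 2 * g q) + cy p ^+ 2 * intS (fun q => cy q ^+ 2 * g q)
  + cz p ^+ 2 * intS (fun q => cz q ^+ 2 * g q)
  + 2 * (cx p * cy p) * intS (fun q => cx q * cy q * g q)
  + 2 * (cx p * cz p) * intS (fun q => cx q * cz q * g q)
  + 2 * (cy p * cz p) * intS (fun q => cy q * cz q * g q).
Proof.
move=> bg; rewrite -(intS_comb6 _ _ _ _ _ _ (bmeasM bmeas_x2 bg) (bmeasM bmeas_y2 bg)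
  (bmeasM bmeas_z2 bg) (bmeasM bmeas_xy bg) (bmeasM bmeas_xz bg) (bmeasM bmeas_yz bg)).
by apply: eq_intS => q; rewrite dot_coord; ring.
Qed.

Lemma bmeas_dot2 p : bmeas (fun q => dot (sval p) (sval q) ^+ 2).
Proof. by apply: eq_bmeas (bmeasX 2 (bmeas_dot (sval p))) => q; rewrite dotC. Qed.

Lemma intS_kernel g p : bmeas g ->
  intS (fun q => (dot (sval p) (sval q) ^+ 2 - 3^-1) * g q) =
  intS (fun q => dot (sval p) (sval q) ^+ 2 * g q) - 3^-1 * intS g.
Proof.
move=> bg; rewrite -(intSZ _ bg) -(intSB (bmeasM (bmeas_dot2 p) bg) (bmeasZ _ bg)).
by apply: eq_intS => q; rewrite mulrBl.
Qed.

Lemma intS_trace g : bmeas g -> intS (fun q => cx q ^+ 2 * g q) +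
  intS (fun q => cy q ^+ 2 * g q) + intS (fun q => cz q ^+ 2 * g q) = intS g.
Proof.
move=> bg; have [[b1 b2] b3] := (bmeasM bmeas_x2 bg, bmeasM bmeas_y2 bg, bmeasM bmeas_z2 bg).
rewrite -(intSD b1 b2) -(intSD (bmeasD b1 b2) b3); apply: eq_intS => q.
by rewrite -!mulrDl sphere_eq mul1r.
Qed.

Lemma bmeas_mean_field eta g : bmeas g -> bmeas (mean_field eta g).
Proof.
move=> bg.
apply: eq_bmeas (bmeasB (bmeas_comb6 (intS (fun q => cx q ^+ 2 * g q))
  (intS (fun q => cy q ^+ 2 * g q)) (intS (fun q => cz q ^+ 2 * g q))
  (2 * intS (fun q => cx q * cy q * g q)) (2 * intS (fun q => cx q * cz q * g q))
  (2 * intS (fun q => cy q * cz q * g q)) bmeas_x2 bmeas_y2 bmeas_z2 bmeas_xy bmeas_xz bmeas_yz)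
  (bmeas_cst (3^-1 * intS g + eta))) => p.
by rewrite mean_fieldE (intS_kernel p bg) (intS_dot2 p bg); ring.
Qed.

(* The quadratic form of [g] in the mean field is traceless, so only [- eta]
   survives. *)
Lemma intS_mean_field eta g : bmeas g -> intS (mean_field eta g) = - eta * total.
Proof.
move=> bg; pose K := intS_comb6 (intS (fun q => cx q ^+ 2 * g q))
  (intS (fun q => cy q ^+ 2 * g q)) (intS (fun q => cz q ^+ 2 * g q))
  (2 * intS (fun q => cx q * cy q * g q)) (2 * intS (fun q => cx q * cz q * g q))
  (2 * intS (fun q => cy q * cz q * g q)) bmeas_x2 bmeas_y2 bmeas_z2 bmeas_xy bmeas_xz bmeas_yz.
transitivity (intS (fun p => (intS (fun q => cx q ^+ 2 * g q) * cx p ^+ 2 +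
  intS (fun q => cy q ^+ 2 * g q) * cy p ^+ 2 + intS (fun q => cz q ^+ 2 * g q) * cz p ^+ 2 +
  2 * intS (fun q => cx q * cy q * g q) * (cx p * cy p) +
  2 * intS (fun q => cx q * cz q * g q) * (cx p * cz p) +
  2 * intS (fun q => cy q * cz q * g q) * (cy p * cz p)) - (3^-1 * intS g + eta))).
  by apply: eq_intS => p; rewrite mean_fieldE (intS_kernel p bg) (intS_dot2 p bg); ring.
rewrite (intSB (bmeas_comb6 _ _ _ _ _ _ bmeas_x2 bmeas_y2 bmeas_z2 bmeas_xy bmeas_xz bmeas_yz)
  (bmeas_cst _)) K intS_cst intS_xy intS_xz intS_yz intS_x2 intS_y2 intS_z2.
by rewrite -(intS_trace bg); field.
Qed.

Lemma intS_kernel1 p : intS (fun q => dot (sval p) (sval q) ^+ 2 - 3^-1) = 0.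
Proof.
rewrite (intSB (bmeas_dot2 p) (bmeas_cst _)) intS_cst.
have -> : intS (fun q => dot (sval p) (sval q) ^+ 2) =
    intS (fun q => dot (sval p) (sval q) ^+ 2 * 1) by apply: eq_intS => q; rewrite mulr1.
rewrite (intS_dot2 p (bmeas_cst 1)).
have s1 f : intS (fun q => f q * 1) = intS f by apply: eq_intS => q; rewrite mulr1.
rewrite !s1 intS_xy intS_xz intS_yz intS_x2 intS_y2 intS_z2 !mulr0 !addr0 -!mulrDl sphere_eq.
lra.
Qed.

(** [z^2 - 1/3] is a spherical harmonic of degree 2, hence an eigenfunction of the rotation
    invariant kernel; the eigenvalue results from the fourth moments [1/5] and [1/15]. *)
Lemma intS_kernel_z2 p :
  intS (fun q => (dot (sval p) (sval q) ^+ 2 - 3^-1) * (cz q ^+ 2 - 3^-1)) =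
  2 / 15 * total * (cz p ^+ 2 - 3^-1).
Proof.
have bk := bmeasB (bmeas_dot2 p) (bmeas_cst 3^-1).
transitivity (intS (fun q => (dot (sval p) (sval q) ^+ 2 - 3^-1) * cz q ^+ 2) -
  3^-1 * intS (fun q => dot (sval p) (sval q) ^+ 2 - 3^-1)).
  rewrite -(intSZ _ bk) -(intSB (bmeasM bk bmeas_z2) (bmeasZ _ bk)).
  by apply: eq_intS => q; ring.
rewrite intS_kernel1 mulr0 subr0 (intS_kernel p bmeas_z2) (intS_dot2 p bmeas_z2) intS_z2.
have -> : intS (fun q => cx q ^+ 2 * cz q ^+ 2) = total / 15.
  by rewrite -intS_z2x2; apply: eq_intS => q; rewrite mulrC.
have -> : intS (fun q => cy q ^+ 2 * cz q ^+ 2) = total / 15.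
  by rewrite -intS_z2y2; apply: eq_intS => q; rewrite mulrC.
have -> : intS (fun q => cz q ^+ 2 * cz q ^+ 2) = total / 5.
  by rewrite -intS_z4; apply: eq_intS => q; ring.
have odd (f : S2 R -> R) (h : isometry R) : bmeas f -> (forall q, f (h q) = - f q) ->
   (forall q, cz (h q) ^+ 2 = cz q ^+ 2) -> intS (fun q => f q * cz q ^+ 2) = 0.
  move=> bf hf hz; apply: (intS_antisym (h := h) (bmeasM bf bmeas_z2)) => q.
  by rewrite hf hz mulNr.
have [hx hxp] := @iso_coord_negx R; have [hz hzp] := @iso_coord_negz R.
rewrite (odd _ hx bmeas_xy); [|by move=> q; have [-> -> _] := hxp q; rewrite mulNr
   |by move=> q; have [_ _ ->] := hxp q].
rewrite (odd _ hx bmeas_xz); [|by move=> q; have [-> _ ->] := hxp q; rewrite mulNr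
   |by move=> q; have [_ _ ->] := hxp q].
rewrite (odd _ hz bmeas_yz); [|by move=> q; have [_ -> ->] := hzp q; rewrite mulrN
   |by move=> q; have [_ _ ->] := hzp q; rewrite sqrrN].
by have := sphere_eq p => h; rewrite (_ : cx p ^+ 2 = 1 - cy p ^+ 2 - cz p ^+ 2); [field|lra].
Qed.

End mean_field_theory.

(** * Relative entropy, local minimality and the failure of strictness *)

Section energy_theory.
Context {R : realType}.
Local Notation mu := (sphere_hausdorff R).
Implicit Types (f g : S2 R -> R) (p q : S2 R) (eta a e : R).

Lemma bmeas_ln f lo : bmeas f -> 0 < lo -> (forall p, lo <= f p) ->
  bmeas (fun p => ln (f p)).
Proof.
move=> [mf [M fM]] lo0 flo; split.
  exact: (measurableT_comp (@measurable_ln R) mf).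
exists (M + `|ln lo|) => p.
have fp0 : 0 < f p by exact: lt_le_trans (flo p).
have h1 : ln lo <= ln (f p) by rewrite ler_ln ?posrE.
have h2 : ln (f p) < f p by exact: ln_sublinear.
have h3 := le_trans (ler_norm _) (fM p).
have := ler_norm (- ln lo); rewrite normrN => h4; have h5 := normr_ge0 (ln lo).
by rewrite ler_norml; apply/andP; split; lra.
Qed.

Lemma ae_eq_funS2 f g (F : R -> S2 R -> \bar R) : (\forall p \ae area, f p = g p) ->
  ae_eq area setT (fun p => F (f p) p) (fun p => F (g p) p).
Proof. by apply: filterS => p -> _. Qed.

Lemma mean_field_ae eta f g : measurable_fun setT f -> measurable_fun setT g ->
  (\forall p \ae area, f p = g p) -> mean_field eta f = mean_field eta g.
Proof.
move=> mf mg fg; apply/funext => p; congr (_ - _); rewrite /Rintegral; congr fine.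
have mk : measurable_fun [set: S2 R] (fun q : S2 R => dot (sval p) (sval q) ^+ 2 - 3^-1).
  by case: (bmeasB (bmeas_dot2 p) (bmeas_cst 3^-1)).
apply: (ae_eq_integral _ _ measurableT).
- by apply/measurable_EFinP; exact: measurable_funM mk mf.
- by apply/measurable_EFinP; exact: measurable_funM mk mg.
- exact: (ae_eq_funS2 (fun x q => ((dot (sval p) (sval q) ^+ 2 - 3^-1) * x)%:E) fg).
Qed.

Lemma energy_integrand eta f p : 0 < mean_field eta f p ->
  ((f p * ln (f p))%:E - (f p)%:E * lne (mean_field eta f p)%:E =
   (f p * ln (f p) - f p * ln (mean_field eta f p))%:E)%E.
Proof. by move=> m0; rewrite lne_EFin// -EFinM -EFinB. Qed.

(** Allows a density to be replaced by a bounded representative. The two mean fields agree at every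
    point, since they are integrals, so a positive lower bound for one serves both. *)
Lemma energy_ae eta f g lo : measurable_fun setT f -> bmeas g ->
  0 < lo -> (forall p, lo <= mean_field eta g p) ->
  (\forall p \ae area, f p = g p) -> energy eta f = energy eta g.
Proof.
move=> mf bg lo0 hlo fg; have [mg _] := bg.
have mM : measurable_fun setT (fun p => ln (mean_field eta g p)).
  by have [] := bmeas_ln (bmeas_mean_field eta bg) lo0 hlo.
have m0 p : 0 < mean_field eta g p by exact: lt_le_trans (hlo p).
have mint (h : S2 R -> R) : measurable_fun setT h -> measurable_fun [set: S2 R]
    (fun p => ((h p * ln (h p))%:E - (h p)%:E * lne (mean_field eta g p)%:E)%E).
  move=> mh.
  rewrite (_ : (fun p => _) =
    (fun p => (h p * ln (h p) - h p * ln (mean_field eta g p))%:E)); last first.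
    by apply/funext => p; rewrite lne_EFin// -EFinM -EFinB.
  apply/measurable_EFinP; apply: measurable_funB (measurable_funM mh mM).
  exact: measurable_funM mh (measurableT_comp (@measurable_ln R) mh).
rewrite /energy (mean_field_ae eta mf mg fg).
apply: (ae_eq_integral _ _ measurableT); [exact: mint|exact: mint|].
exact: (ae_eq_funS2 (fun x p => ((x * ln x)%:E - x%:E * lne (mean_field eta g p)%:E)%E) fg).
Qed.

Lemma bmeas_energy eta g lo lo' : bmeas g -> 0 < lo -> (forall p, lo <= g p) ->
  0 < lo' -> (forall p, lo' <= mean_field eta g p) ->
  bmeas (fun p => g p * ln (g p) - g p * ln (mean_field eta g p)).
Proof.
move=> bg l0 hl l0' hl'.
exact: bmeasB (bmeasM bg (bmeas_ln bg l0 hl))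
  (bmeasM bg (bmeas_ln (bmeas_mean_field eta bg) l0' hl')).
Qed.

Lemma energyE eta g lo lo' : bmeas g -> 0 < lo -> (forall p, lo <= g p) ->
  0 < lo' -> (forall p, lo' <= mean_field eta g p) ->
  energy eta g = (intS (fun p => g p * ln (g p) - g p * ln (mean_field eta g p)))%:E.
Proof.
move=> bg l0 hl l0' hl'.
rewrite -(integral_bmeas (bmeas_energy bg l0 hl l0' hl')).
apply: eq_integral => p _; apply: energy_integrand.
exact: lt_le_trans (hl' p).
Qed.

Local Notation c := ((4 * pi)^-1 : R).
Local Notation eta0 := (- (2 / 15)).
(** Both the eigenvalue [2 / 15 * total] of the kernel on traceless quadratic forms and the integral
    [- eta0 * total] of the mean field of a bounded measurable function. *)
Local Notation kappa := (8 * pi / 15 : R).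

Lemma kappa_gt0 : 0 < kappa :> R.
Proof. by rewrite divr_gt0// mulr_gt0// pi_gt0. Qed.

Lemma inv_4pi_gt0 : 0 < c :> R.
Proof. by rewrite invr_gt0 mulr_gt0// pi_gt0. Qed.

Lemma pi_lt4 : pi < 4 :> R.
Proof. by have := @pihalf_lt2 R; lra. Qed.

Lemma inv_4pi_bounds : 1 / 16 <= c <= 1 / 8.
Proof.
have P0 := pi_gt0 R; have p2 := pi_ge2 R; have p4 := @pi_lt4.
have pi4 : 0 < 4 * pi :> R by lra.
by apply/andP; split;
  [rewrite -[leRHS]div1r ler_pdivlMr//|rewrite -[leLHS]div1r ler_pdivrMr//]; lra.
Qed.

(** This is [ln x <= x - 1] at [x = b / a], the pointwise form of nonnegativity of relative
    entropy. *)
Lemma gibbs a b : 0 < a -> 0 < b -> a - b <= a * ln a - a * ln b :> R.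
Proof.
move=> a0 b0.
have : ln (1 + (b / a - 1)) <= b / a - 1.
  by apply: le_ln1Dx; rewrite ltrBrDr addNr divr_gt0.
rewrite addrC subrK ln_div ?posrE// => h.
have : a * (ln b - ln a) <= a * (b / a - 1) by rewrite ler_pM2l.
by rewrite [X in _ <= X]mulrBr mulrCA divff ?gt_eqF// !mulr1; lra.
Qed.

(* With [G := mean_field / kappa], a probability density, the integrand is
   [g ln (g / G) - g ln kappa], and the first term is a relative entropy. *)
Lemma energy_ge g lo lo' : bmeas g -> 0 < lo -> (forall p, lo <= g p) ->
  0 < lo' -> (forall p, lo' <= mean_field eta0 g p) -> intS g = 1 ->
  ((- ln kappa)%:E <= energy eta0 g)%E.
Proof.
move=> bg l0 hl l0' hl' g1; rewrite (energyE bg l0 hl l0' hl') lee_fin.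
have k0 := kappa_gt0; have bM := bmeas_mean_field eta0 bg.
(* The lower bound given by [gibbs] with [b] the value of [G]; its integral is
   [1 - 1 - ln kappa]. *)
pose lb p := g p - (kappa^-1 * mean_field eta0 g p + ln kappa * g p).
have blb := bmeasB bg (bmeasD (bmeasZ kappa^-1 bM) (bmeasZ (ln kappa) bg)).
have <- : intS lb = - ln kappa.
  rewrite /lb (intSB bg (bmeasD (bmeasZ kappa^-1 bM) (bmeasZ (ln kappa) bg))).
  rewrite (intSD (bmeasZ kappa^-1 bM) (bmeasZ (ln kappa) bg)).
  rewrite (intSZ _ bM) (intSZ _ bg) g1 (intS_mean_field eta0 bg) sphere_area.
  by have := pi_gt0 R; move: (@pi R) => P P0; field; rewrite gt_eqF.
apply: (le_intS blb (bmeas_energy bg l0 hl l0' hl')) => p.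
have g0 : 0 < g p by exact: lt_le_trans (hl p).
have m0 : 0 < mean_field eta0 g p by exact: lt_le_trans (hl' p).
have mk : 0 < kappa^-1 * mean_field eta0 g p by rewrite mulr_gt0// invr_gt0.
have lnG : ln (kappa^-1 * mean_field eta0 g p) = ln (mean_field eta0 g p) - ln kappa.
  by rewrite [kappa^-1 * _]mulrC [LHS]ln_div ?posrE//.
have := gibbs g0 mk; rewrite lnG /lb; move: (ln kappa) (kappa^-1 * _) => k G.
by rewrite mulrBr (mulrC k); lra.
Qed.

Lemma energy_self_consistent g lo : bmeas g -> 0 < lo -> (forall p, lo <= g p) ->
  (forall p, mean_field eta0 g p = kappa * g p) -> intS g = 1 ->
  energy eta0 g = (- ln kappa)%:E.
Proof.
move=> bg l0 hl hM g1; have k0 := kappa_gt0.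
have hl' p : kappa * lo <= mean_field eta0 g p by rewrite hM ler_pM2l.
rewrite (energyE bg l0 hl (mulr_gt0 k0 l0) hl'); congr EFin.
have -> : - ln kappa = - ln kappa * intS g by rewrite g1 mulr1.
rewrite -(intSZ _ bg); apply: eq_intS => p.
have g0 : 0 < g p by exact: lt_le_trans (hl p).
rewrite hM [ln (_ * g p)]lnM ?posrE//.
by move: (ln kappa) => k; ring.
Qed.

Lemma densities_bmeas g : bmeas g -> (forall p, 0 <= g p) -> intS g = 1 -> densities g.
Proof.
move=> bg g0 g1; split; [exact/Lfun1_integrable/bmeas_integrable|exact: aeW|].
by rewrite (integral_bmeas bg) g1.
Qed.

(* The coefficient [15 / 2] is the one for which the mean field of the
   perturbation is [kappa] times the perturbation. *)
Definition perturb a : S2 R -> R := fun p => c + c * (15 / 2 * a) * (cz p ^+ 2 - 3^-1).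

Lemma bmeas_traceless_z2 : bmeas (fun p : S2 R => cz p ^+ 2 - 3^-1).
Proof. exact: bmeasB bmeas_z2 (bmeas_cst 3^-1). Qed.

Lemma bmeas_perturb a : bmeas (perturb a).
Proof. exact: bmeasD (bmeas_cst c) (bmeasZ _ bmeas_traceless_z2). Qed.

Lemma cz2_bounds p : 0 <= cz p ^+ 2 <= 1.
Proof.
by rewrite sqr_ge0 -(sphere_eq p) lerDr addr_ge0 // sqr_ge0.
Qed.

Lemma perturb_near a p : 0 <= a -> `|perturb a p - c| <= a.
Proof.
move=> a0; rewrite /perturb addrAC subrr add0r.
have /andP[h1 h2] := cz2_bounds p; have /andP[c1 c2] := inv_4pi_bounds.
have c0 := inv_4pi_gt0.
have a15 : 0 <= 15 / 2 * a by lra.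
have ca : 0 <= c * (15 / 2 * a) by rewrite mulr_ge0// ltW.
rewrite normrM (ger0_norm ca).
have z : `|cz p ^+ 2 - 3^-1| <= 1 by rewrite ler_norml; apply/andP; split; lra.
apply: (@le_trans _ _ (1 / 8 * (15 / 2 * a) * 1)); last by lra.
by apply: ler_pM => //; apply: ler_wpM2r.
Qed.

Lemma intS_perturb a : intS (perturb a) = 1.
Proof.
rewrite /perturb (intSD (bmeas_cst c) (bmeasZ _ bmeas_traceless_z2)) (intSZ _ bmeas_traceless_z2).
rewrite (intSB bmeas_z2 (bmeas_cst 3^-1)) !intS_cst intS_z2 sphere_area.
by have := pi_gt0 R; move: (@pi R) => P P0; field; rewrite gt_eqF.
Qed.

Lemma mean_field_perturb a p : mean_field eta0 (perturb a) p = kappa * perturb a p.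
Proof.
rewrite mean_fieldE.
have bk := bmeasB (bmeas_dot2 p) (bmeas_cst 3^-1).
transitivity (c * intS (fun q => dot (sval p) (sval q) ^+ 2 - 3^-1) +
  c * (15 / 2 * a) * intS (fun q => (dot (sval p) (sval q) ^+ 2 - 3^-1) * (cz q ^+ 2 - 3^-1))
  - eta0).
  congr (_ - _); rewrite -(intSZ _ bk) -(intSZ _ (bmeasM bk bmeas_traceless_z2)).
  rewrite -(intSD (bmeasZ _ bk) (bmeasZ _ (bmeasM bk bmeas_traceless_z2))).
  by apply: eq_intS => q; rewrite /perturb; ring.
rewrite intS_kernel1 intS_kernel_z2 sphere_area /perturb.
by have := pi_gt0 R; move: (@pi R) => P P0; field; rewrite gt_eqF.
Qed.

Lemma isotropicE : @isotropic R = perturb 0.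
Proof. by apply/funext => p; rewrite /perturb /isotropic !(mulr0, mul0r) addr0. Qed.

Lemma perturb_ge a p : 0 <= a <= 1 / 32 -> 1 / 32 <= perturb a p.
Proof.
move=> /andP[a0 a1]; have := perturb_near p a0; have /andP[c1 _] := inv_4pi_bounds.
by rewrite ler_norml => /andP[h _]; lra.
Qed.

Lemma energy_perturb a : 0 <= a <= 1 / 32 -> energy eta0 (perturb a) = (- ln kappa)%:E.
Proof.
move=> a01; have l0 : 0 < 1 / 32 :> R by lra.
by apply: (energy_self_consistent (bmeas_perturb a) l0 (fun p => perturb_ge p a01)
  (mean_field_perturb a) (intS_perturb a)).
Qed.

Lemma densities_perturb a : 0 <= a <= 1 / 32 -> densities (perturb a).
Proof.
move=> a01; apply: (densities_bmeas (bmeas_perturb a)) (intS_perturb a) => p.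
by apply: le_trans (perturb_ge p a01); lra.
Qed.

(** Equality would make [z^2 - 1/3] vanish almost everywhere, but the integral of its square is
    [1/5 - 2/9 + 1/9 = 4/45] of the total. *)
Lemma perturb_nonconstant a : 0 < a -> ~ (perturb a = @isotropic R %[ae area]).
Proof.
move=> a0 h; have c0 := inv_4pi_gt0.
have b4 := bmeasX 2 bmeas_traceless_z2.
have : intS (fun p => (cz p ^+ 2 - 3^-1) ^+ 2) = 0.
  apply: EFin_inj; rewrite -(integral_bmeas b4).
  rewrite (ae_eq_integral (cst 0%E) _ measurableT); first by rewrite integral0.
  - by apply/measurable_EFinP; case: b4.
  - exact: measurable_cst.
  - move: h; apply: filterS => p hp _ /=; congr EFin.
    have : c * (15 / 2 * a) * (cz p ^+ 2 - 3^-1) = 0.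
      have := hp I; rewrite /perturb /isotropic; lra.
    move=> /eqP; rewrite !mulf_eq0 (gt_eqF c0) (gt_eqF a0) /= ?orbF.
    have -> : (15 : R) == 0 = false by rewrite pnatr_eq0.
    have -> : ((2 : R)^-1 == 0) = false by rewrite invr_eq0 pnatr_eq0.
    by rewrite /= => /eqP ->; rewrite expr0n.
have -> : intS (fun p => (cz p ^+ 2 - 3^-1) ^+ 2) = total * (4 / 45).
  have b44 : bmeas (fun p : S2 R => cz p ^+ 4) by exact: bmeasX bmeas_cz.
  transitivity (intS (fun p => cz p ^+ 4 - (2 / 3 * cz p ^+ 2 - 9^-1))).
    by apply: eq_intS => p; field.
  rewrite (intSB b44 (bmeasB (bmeasZ _ bmeas_z2) (bmeas_cst _))).
  rewrite (intSB (bmeasZ _ bmeas_z2) (bmeas_cst _)) (intSZ _ bmeas_z2) intS_cst intS_z2 intS_z4.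
  by field.
by have := @total_gt0 R; lra.
Qed.

(** The [L^infty] norm is defined by cases on whether the whole space has positive measure. *)
Lemma area_gt0 : (0 < @area R setT)%E.
Proof. by rewrite area_setT lte_fin total_gt0. Qed.

Lemma Lnorm_infty_lt f e : ('N[area]_+oo[EFin \o f] < e%:E)%E ->
  \forall p \ae area, `|f p| < e.
Proof.
rewrite unlock area_gt0 => h.
apply: filterS (ess_sup_ge area (abse \o (EFin \o f))) => p hp.
by rewrite -lte_fin; apply: le_lt_trans h.
Qed.

Lemma Lnorm_infty_le f e : (forall p, `|f p| <= e) -> ('N[area]_+oo[EFin \o f] <= e%:E)%E.
Proof.
by move=> fe; rewrite unlock area_gt0; apply/ess_supP; apply: aeW => p /=; rewrite lee_fin.
Qed.

(** The kernel annihilates constants, so only [g - c] contributes, and the kernel takes values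
    between [-1/3] and [2/3]. *)
Lemma mean_field_lower g e : bmeas g -> 0 <= e -> (forall p, `|g p - c| <= e) ->
  forall p, 2 / 15 - 2 / 3 * e * total <= mean_field eta0 g p.
Proof.
move=> bg e0 ge p; rewrite mean_fieldE.
have bk := bmeasB (bmeas_dot2 p) (bmeas_cst 3^-1).
have bgc := bmeasB bg (bmeas_cst c).
have -> : intS (fun q => (dot (sval p) (sval q) ^+ 2 - 3^-1) * g q) =
   intS (fun q => (dot (sval p) (sval q) ^+ 2 - 3^-1) * (g q - c)).
  rewrite -[LHS]subr0 -(mulr0 c) -(intS_kernel1 p) -(intSZ _ bk).
  rewrite -(intSB (bmeasM bk bg) (bmeasZ _ bk)).
  by apply: eq_intS => q; ring.
have : intS (fun=> - (2 / 3 * e)) <=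
    intS (fun q => (dot (sval p) (sval q) ^+ 2 - 3^-1) * (g q - c)).
  apply: (le_intS (bmeas_cst _) (bmeasM bk bgc)) => q.
  suff : `|(dot (sval p) (sval q) ^+ 2 - 3^-1) * (g q - c)| <= 2 / 3 * e.
    by rewrite ler_norml => /andP[].
  rewrite normrM; apply: ler_pM => //; rewrite ler_norml.
  have := dot_le1 p q; have := dot_geN1 p q; have := sqr_ge0 (dot (sval p) (sval q)).
  by move=> ? ? ?; apply/andP; split; [lra|nra].
by rewrite intS_cst; lra.
Qed.

Lemma isotropic_local_minimiser : Linfty_local_minimiser (energy eta0) (@isotropic R).
Proof.
have a0 : 0 <= (0 : R) <= 1 / 32 by apply/andP; split; lra.
split; first by rewrite isotropicE; exact: densities_perturb.
(* Small enough that [c - 1/100 >= 1/32] and, by [pi < 4], that the mean field stays above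
   [2/15 - 8/75 = 2/75]. *)
exists (1 / 100); first by lra.
move=> g [gL _ g1] /Lnorm_infty_lt gnear.
rewrite isotropicE (energy_perturb a0).
have /andP[c1 c2] := inv_4pi_bounds.
have mg : measurable_fun setT g.
  by apply/measurable_EFinP; move/Lfun1_integrable: gL => /measurable_int.
(* Truncation gives a representative of [g] that is close to [c] at every point. *)
pose h p := Num.max (c - 1 / 100) (Num.min (g p) (c + 1 / 100)).
have hb p : c - 1 / 100 <= h p <= c + 1 / 100.
  rewrite le_max lexx /= ge_max ge_min lexx orbT andbT; lra.
have bh : bmeas h.
  split.
    apply: measurable_maxr; first exact: measurable_cst.
    by apply: measurable_minr => //; exact: measurable_cst.
  by exists 1 => p; have /andP[? ?] := hb p; rewrite ler_norml; apply/andP; split; lra.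
have gh : \forall p \ae area, g p = h p.
  apply: filterS gnear => p; rewrite /isotropic /= ltr_norml => /andP[g2 g3].
  by rewrite /h min_l ?max_r; lra.
have hl p : 1 / 32 <= h p by have /andP[? _] := hb p; lra.
have hn p : `|h p - c| <= 1 / 100.
  by have /andP[? ?] := hb p; rewrite ler_norml; apply/andP; split; lra.
have h1 : intS h = 1.
  apply: EFin_inj; rewrite -(integral_bmeas bh) -g1.
  apply: (ae_eq_integral _ _ measurableT).
  - by apply/measurable_EFinP; case: bh.
  - exact/measurable_EFinP.
  - by move: gh; apply: filterS => p -> _.
have e0 : 0 <= 1 / 100 :> R by lra.
have l32 : 0 < 1 / 32 :> R by lra.
have Ml := mean_field_lower bh e0 hn.
have lo0 : 0 < 2 / 15 - 2 / 3 * (1 / 100) * total :> R.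
  by rewrite sphere_area; have := @pi_lt4; lra.
rewrite (energy_ae mg bh lo0 Ml gh).
exact: energy_ge bh l32 hl lo0 Ml h1.
Qed.

Lemma isotropic_not_strict_local_minimiser :
  ~ strict_Linfty_local_minimiser (energy eta0) (@isotropic R).
Proof.
move=> [_ [e e0 strict]].
(* The first bound puts the perturbation inside the ball, the second keeps it at least [1/32]. *)
pose a := Num.min (e / 2) (1 / 32).
have a0 : 0 < a by rewrite lt_min; apply/andP; split; lra.
have a01 : 0 <= a <= 1 / 32 by rewrite (ltW a0) /= ge_min lexx orbT.
have ae : a < e.
  by apply: (@le_lt_trans _ _ (e / 2)); [rewrite ge_min lexx|lra].
have z01 : 0 <= (0 : R) <= 1 / 32 by apply/andP; split; lra.
have Nae : ('N[area]_+oo[EFin \o (perturb a \- isotropic)%R] < e%:E)%E.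
  apply: (@le_lt_trans _ _ a%:E); last by rewrite lte_fin.
  apply: Lnorm_infty_le => p; exact: perturb_near (ltW a0).
have := strict _ (densities_perturb a01) Nae (perturb_nonconstant a0).
by rewrite {1}isotropicE (energy_perturb a01) (energy_perturb z01) ltxx.
Qed.

End energy_theory.

Theorem corollary2p13 (R : realType) :
  Linfty_local_minimiser (energy (- (2 / 15))) (@isotropic R) /\
  ~ strict_Linfty_local_minimiser (energy (- (2 / 15))) (@isotropic R).
Proof.
split; first exact: isotropic_local_minimiser.
exact: isotropic_not_strict_local_minimiser.
Qed.
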